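(* Let $f,h,q,\Phi$ be as in the context and assume: (1) there is $\underline{m}>0$ with $\nabla_x^\top h(x)\nabla_x h(x)\succeq \underline{m} I$ for all $x\in\mathbb{R}^n$; (2) the set $\{x\in\mathbb{R}^n:h(x)=0\}$ is connected and $\tilde f(\eta)=f(\Phi^{-1}(0,\eta))$ is $\rho_\eta$-strongly convex on $\mathbb{R}^{n-m}$, $\rho_\eta>0$; (3) $\Phi$ and $\Phi^{-1}$ are globally Lipschitz on $\mathbb{R}^n$, with constants $L_\Phi$ and $L_\Psi$; (4) there is $L_1>0$ such that for all $y\in\mathbb{R}^m$, $\eta\in\mathbb{R}^{n-m}$, with $\tilde x=\Phi^{-1}(y,\eta)$ and $p=\Phi^{-1}(0,\eta)$, $\|\nabla_x^\top q(\tilde x)\nabla_x f(\tilde x)-\nabla_x^\top q(p)\nabla_x f(p)\|\le L_1\|y\|$; (5) the function $\varphi(x)=-(\nabla_x^\top h(x)\nabla_x h(x))^{-1}\nabla_x^\top h(x)\nabla_x f(x)$ is globally Lipschitz on $\mathbb{R}^n$ with some constant $L_2>0$. Consider the proportional-integral dynamics $$\dot x=-\nabla_x f(x)-\nabla_x h(x)\lambda,\qquad \lambda=k_p h(x)+k_i z,\qquad \dot z=h(x).$$ There exists a constant $k_p^\star>0$ such that, if $k_p>k_p^\star$ and $0<k_i<\underline{m}k_p^2$, then $(x^\star,\lambda^\star)$ is a globally exponentially stable equilibrium of these dynamics (in the coordinates $(x,\lambda)$), i.e., there exist real constants $c_\pi\ge1$, $\rho_\pi>0$ such that, for all initial conditions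 and all $t\ge0$, $$\left\|\begin{bmatrix}x(t)-x^\star\\ \lambda(t)-\lambda^\star\end{bmatrix}\right\|\le c_\pi e^{-\rho_\pi t}\left\|\begin{bmatrix}x(0)-x^\star\\ \lambda(0)-\lambda^\star\end{bmatrix}\right\|.$$
   Context: $\|\cdot\|$ is the Euclidean norm (and the induced matrix norm). For $g:\mathbb{R}^n\to\mathbb{R}^k$, $\nabla_x^\top g(x)\in\mathbb{R}^{k\times n}$ is the Jacobian and $\nabla_x g(x)$ its transpose. $f:\mathbb{R}^n\to\mathbb{R}$ and $h:\mathbb{R}^n\to\mathbb{R}^m$ are smooth; the problem is $\min_x f(x)$ subject to $h(x)=0$. $q:\mathbb{R}^n\to\mathbb{R}^{n-m}$ is a smooth map with $Q(x):=\nabla_x^\top q(x)\nabla_x q(x)\succeq \underline{q} I$ for some $\underline{q}>0$ and all $x$, with $\nabla_x^\top q(x)\nabla_x h(x)=0$ for all $x\in\mathbb{R}^n$, and such that $\Phi(x)=(h(x),q(x))=(y,\eta)$, $y\in\mathbb{R}^m$, $\eta\in\mathbb{R}^{n-m}$, is a global diffeomorphism of $\mathbb{R}^n$. $\rho_\eta$-strong convexity means $\tilde f(\eta_2)\ge\tilde f(\eta_1)+\nabla_\eta^\top\tilde f(\eta_1)(\eta_2-\eta_1)+\frac{\rho_\eta}{2}\|\eta_2-\eta_1\|^2$ for all $\eta_1,\eta_2$. Under (1)–(2) the problem has a unique global optimizer $x^\star$, and $\lambda^\star\in\mathbb{R}^m$ is the unique Lagrange multiplier with $\nabla_x f(x^\star)+\nabla_x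 h(x^\star)\lambda^\star=0$, $h(x^\star)=0$. *)

(* Defs.v *)
From HB Require Import structures.
From mathcomp Require Import all_boot all_order all_algebra.
From mathcomp Require Import all_classical all_reals all_analysis.

Set Implicit Arguments.
Unset Strict Implicit.
Unset Printing Implicit Defensive.

Import Order.TTheory GRing.Theory Num.Theory.
Import numFieldNormedType.Exports.

Local Open Scope classical_set_scope.
Local Open Scope ring_scope.

(* Vectors of R^n are row vectors, so formulas written for column vectors      *)
(* appear transposed.  For g : 'rV_n -> 'rV_k, the library's 'J g x is the     *)
(* n x k matrix of the partial derivatives of g_j along x_i, that is nabla g   *)
(* (the transpose of the usual k x n Jacobian matrix).                         *)

(* The norm provided by the library on 'rV[R]_n is the sup norm; it is used    *)
(* below only through the topology it induces.                                 *)
Definition enorm (R : realType) (n : nat) (v : 'rV[R]_n) : R :=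
  Num.sqrt (\sum_(i < n) v 0 i ^+ 2).

Definition elipschitz (R : realType) (n k : nat) (L : R)
    (g : 'rV[R]_n -> 'rV[R]_k) : Prop :=
  forall x y, enorm (g x - g y) <= L * enorm (x - y).

Definition grad (R : realType) (n : nat) (f : 'rV[R]_n -> R) (x : 'rV[R]_n) :
    'rV[R]_n :=
  \row_i 'D_(delta_mx 0 i) f x.

Fixpoint Ck (R : realType) (V W : normedModType R) (k : nat) (g : V -> W) :
    Prop :=
  match k with
  | 0 => continuous g
  | k'.+1 => (forall x, differentiable g x) /\ forall v, Ck k' ('D_v g)
  end.

Definition smooth (R : realType) (V W : normedModType R) (g : V -> W) : Prop :=
  forall k, Ck k g.

Definition diffeomorphism (R : realType) (V W : normedModType R)
    (Phi : V -> W) (Psi : W -> V) : Prop :=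
  [/\ smooth Phi, smooth Psi, cancel Phi Psi & cancel Psi Phi].

Definition psd (R : realType) (k : nat) (A : 'M[R]_k) : Prop :=
  A^T = A /\ forall v : 'rV[R]_k, 0 <= (v *m A *m v^T) 0 0.

Definition strongly_convex (R : realType) (k : nat) (rho : R)
    (g : 'rV[R]_k -> R) : Prop :=
  forall a b : 'rV[R]_k,
    g a + (grad g a *m (b - a)^T) 0 0 + rho / 2 * enorm (b - a) ^+ 2 <= g b.

Section Problem.
Variables (R : realType) (n m : nat).
Variables (f : 'rV[R]_n -> R) (h : 'rV[R]_n -> 'rV[R]_m).

Definition gram (k : nat) (g : 'rV[R]_n -> 'rV[R]_k) (x : 'rV[R]_n) : 'M[R]_k :=
  ('J g x)^T *m 'J g x.

(* Transpose of - (gram h x)^-1 * (nabla h x)^T * nabla f x; the Gram matrix   *)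
(* is symmetric.                                                               *)
Definition phi (x : 'rV[R]_n) : 'rV[R]_m :=
  - (grad f x *m 'J h x *m invmx (gram h x)).

Definition coords (k : nat) (q : 'rV[R]_n -> 'rV[R]_k) (x : 'rV[R]_n) :
    'rV[R]_(m + k) :=
  row_mx (h x) (q x).

Definition global_optimizer (xs : 'rV[R]_n) : Prop :=
  h xs = 0 /\ forall x, h x = 0 -> f xs <= f x.

Definition lagrange_multiplier (xs : 'rV[R]_n) (ls : 'rV[R]_m) : Prop :=
  grad f xs + ls *m ('J h xs)^T = 0 /\ h xs = 0.

Variables kp ki : R.

Definition pi_output (x : 'rV[R]_n) (z : 'rV[R]_m) : 'rV[R]_m :=
  kp *: h x + ki *: z.

(* The values at negative times are irrelevant: the trajectory is continuous   *)
(* on [0, +oo[ and satisfies the differential equations on ]0, +oo[ (hence     *)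
(* also with the right derivative at 0 when the vector field is continuous).   *)
Definition pi_solution (x : R -> 'rV[R]_n) (z : R -> 'rV[R]_m) : Prop :=
  [/\ {within `[0, +oo[, continuous x},
      {within `[0, +oo[, continuous z} &
      forall t : R, 0 < t ->
        is_derive t (1 : R) x
          (- grad f (x t) - pi_output (x t) (z t) *m ('J h (x t))^T) /\
        is_derive t (1 : R) z (h (x t))].

(* Forward completeness (every initial condition has a trajectory defined for  *)
(* all t >= 0) is part of the definition.  For ki != 0, ranging over the       *)
(* initial (x, z) is the same as ranging over the initial (x, lambda).         *)
Definition globally_exponentially_stable (xs : 'rV[R]_n) (ls : 'rV[R]_m) :
    Prop :=
  (forall (x0 : 'rV[R]_n) (z0 : 'rV[R]_m),
     exists (x : R -> 'rV[R]_n) (z : R -> 'rV[R]_m),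
       [/\ pi_solution x z, x 0 = x0 & z 0 = z0]) /\
  exists c rho : R, [/\ 1 <= c, 0 < rho &
    forall (x : R -> 'rV[R]_n) (z : R -> 'rV[R]_m), pi_solution x z ->
    forall t : R, 0 <= t ->
      enorm (row_mx (x t - xs) (pi_output (x t) (z t) - ls)) <=
      c * expR (- rho * t) *
      enorm (row_mx (x 0 - xs) (pi_output (x 0) (z 0) - ls))].

End Problem.

(* Main.v *)
Require Import Defs.
From HB Require Import structures.
From mathcomp Require Import all_boot all_order all_algebra.
From mathcomp Require Import all_classical all_reals all_analysis.
From mathcomp Require Import ring lra.
Set Implicit Arguments.
Unset Strict Implicit.
Unset Printing Implicit Defensive.
Import Order.TTheory GRing.Theory Num.Theory.
Import numFieldNormedType.Exports.
Local Open Scope classical_set_scope.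
Local Open Scope ring_scope.

(** Write [y = h x] and [eta = q x].  Since the gradients of [q] are orthogonal
    to those of [h], the dynamics split in two blocks.

    - The multiplier block.  With [w = lambda - ls] and [zeta = ki z - ls], the
      pair [(w, zeta)] obeys a linear system, damped at a rate proportional to
      [kp], and forced by [phi x - ls].  As [phi] is Lipschitz the forcing is
      bounded by [|y| + |eta - eta*|], while [y = (w - zeta) / kp].
    - The reduced block.  [eta] follows a gradient descent of the strongly convex
      reduced cost, in a variable metric, with an error at most [L1 |y|].

    A quadratic energy [U] of the first block and the excess [W] of the reduced
    cost therefore satisfy a pair of coupled inequalities, and for [kp] above a
    threshold independent of [ki] the sum [W + (mix / kp) U] decays
    exponentially ([drift_le]).  This bounds the state at all times by the
    energy at any earlier time.

    It does not give the theorem yet: the gradient of the reduced cost is not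
    assumed Lipschitz, so [W] at time 0 is not bounded by a multiple of
    [|eta - eta*|^2], and the constant would depend on the initial condition.
    What replaces such a bound is a uniform estimate of the transient
    ([transient_decay]).

    - [eta] cannot overshoot.  While the reduced gradient dominates the error,
      [eta] crosses the nested convex sublevel sets of the reduced cost inwards
      at an angle bounded from below.  The length of such a curve is at most a
      constant times its initial distance to a common point of these sets; the
      constant depends only on the dimension and on the angle, not on the sets
      ([length_bound_all], [reduced_overshoot]).  Once the gradient is
      dominated, [W = O(|y|^2)].
    - Hence on a short time interval, whose length depends only on the
      constants, the distance of [eta] and the energy [U] stay bounded by their
      initial size [E] ([transient_short]).
    - On this interval [W' <= - c W^2 / E + O(E)], because convexity gives
      [W <= |gradient| |eta - eta*|].  The solutions of this inequality come
      down from infinity, so [W = O(E)] at some time of the interval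
      ([transient_low]); from that time on the exponential decay applies.

    The length estimate is proved by induction on the dimension, as for the
    steepest-descent curves of quasiconvex functions.  If a curve moved far away
    from its start without changing direction, a central projection would
    turn it into a long curve in a space of lower dimension
    ([directions_apart]); as the unit ball is totally bounded, excursions are
    bounded ([kept_dist_le]).  Then all later points lie in a cone around some
    axis ([cone_axis]), and the heights of the future of the curve over a
    finite set of axes increase with its length ([length_boundS]).

    Trajectories exist for all times because the energy confines them to
    a compact set, on which the field is Lipschitz ([pi_solution_exists]). *)

(** * Euclidean norm and calculus of curves *)

Section Euclid.
Variable R : realType.

Definition dot n (u v : 'rV[R]_n) : R := \sum_i u 0 i * v 0 i.

Section Dot.
Variable n : nat.
Implicit Types u v w : 'rV[R]_n.

Lemma dotC u v : dot u v = dot v u.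
Proof. by apply: eq_bigr => i _; rewrite mulrC. Qed.

Lemma dotDl u v w : dot (u + v) w = dot u w + dot v w.
Proof. by rewrite -big_split; apply: eq_bigr => i _; rewrite mxE mulrDl. Qed.

Lemma dotZl a u v : dot (a *: u) v = a * dot u v.
Proof. by rewrite /dot mulr_sumr; apply: eq_bigr => i _; rewrite mxE mulrA. Qed.

Lemma dotNl u v : dot (- u) v = - dot u v.
Proof. by rewrite -scaleN1r dotZl mulN1r. Qed.

Lemma dotDr u v w : dot u (v + w) = dot u v + dot u w.
Proof. by rewrite dotC dotDl !(dotC _ u). Qed.

Lemma dotZr a u v : dot u (a *: v) = a * dot u v.
Proof. by rewrite dotC dotZl dotC. Qed.

Lemma dotNr u v : dot u (- v) = - dot u v.
Proof. by rewrite dotC dotNl dotC. Qed.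

Lemma dot0l u : dot 0 u = 0.
Proof. by rewrite -(scale0r 0) dotZl mul0r. Qed.

Lemma dot0r u : dot u 0 = 0.
Proof. by rewrite dotC dot0l. Qed.

Definition dotE := (dotDl, dotDr, dotZl, dotZr, dotNl, dotNr, dot0l, dot0r).

Lemma dot_sumr (I : Type) (s : seq I) (P : pred I) u (F : I -> 'rV[R]_n) :
  dot u (\sum_(i <- s | P i) F i) = \sum_(i <- s | P i) dot u (F i).
Proof. exact: (big_morph (dot u) (fun a b => dotDr u a b) (dot0r u)). Qed.

Lemma dot_ge0 u : 0 <= dot u u.
Proof. by apply: sumr_ge0 => i _; rewrite -expr2 sqr_ge0. Qed.

Lemma enorm_ge0 u : 0 <= enorm u.
Proof. exact: sqrtr_ge0. Qed.

Lemma enorm_sqr u : enorm u ^+ 2 = dot u u.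
Proof.
rewrite sqr_sqrtr; last by apply: sumr_ge0 => i _; exact: sqr_ge0.
by apply: eq_bigr => i _; rewrite expr2.
Qed.

Lemma coord_le_enorm u i : `|u 0 i| <= enorm u.
Proof.
rewrite -sqrtr_sqr; apply: ler_wsqrtr.
by rewrite (bigD1 i)//= lerDl sumr_ge0// => j _; rewrite sqr_ge0.
Qed.

Lemma enorm_eq0 u : enorm u = 0 -> u = 0.
Proof.
move=> u0; apply/rowP => i; rewrite mxE; apply/eqP; rewrite -normr_le0 -u0.
exact: coord_le_enorm.
Qed.

Lemma enorm0 : enorm (0 : 'rV[R]_n) = 0.
Proof. by rewrite /enorm big1 ?sqrtr0// => i _; rewrite mxE expr0n. Qed.

Lemma enorm_gt0 u : u != 0 -> 0 < enorm u.
Proof.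
move=> u0; rewrite lt_def enorm_ge0 andbT.
by apply: contra_neq u0 => /enorm_eq0.
Qed.

Lemma enormZ a u : enorm (a *: u) = `|a| * enorm u.
Proof.
rewrite /enorm -sqrtr_sqr -sqrtrM ?sqr_ge0//; congr Num.sqrt.
by rewrite mulr_sumr; apply: eq_bigr => i _; rewrite mxE exprMn.
Qed.

Lemma enormN u : enorm (- u) = enorm u.
Proof. by rewrite -scaleN1r enormZ normrN1 mul1r. Qed.

Lemma enormB u v : enorm (u - v) = enorm (v - u).
Proof. by rewrite -enormN opprB. Qed.

Lemma dot_le u v : dot u v <= enorm u * enorm v.
Proof.
have [->|u0] := eqVneq u 0; first by rewrite dot0l enorm0 mul0r.
have [->|v0] := eqVneq v 0; first by rewrite dot0r enorm0 mulr0.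
have a0 := enorm_gt0 u0; have b0 := enorm_gt0 v0.
have := dot_ge0 (enorm v *: u - enorm u *: v).
rewrite !dotE (dotC v u) -!enorm_sqr => h.
have ab0 : 0 < enorm u * enorm v by rewrite mulr_gt0.
rewrite -subr_ge0 -(pmulr_rge0 _ ab0) -(pmulr_rge0 _ (ltr0Sn R 1)).
by apply: le_trans h _; rewrite le_eqVlt; apply/orP; left; apply/eqP; ring.
Qed.

Lemma dot_abs u v : `|dot u v| <= enorm u * enorm v.
Proof.
rewrite ler_norml dot_le andbT lerNl -dotNl.
by rewrite (le_trans (dot_le _ _))// enormN.
Qed.

Lemma enormD u v : enorm (u + v) <= enorm u + enorm v.
Proof.
rewrite -(@ler_pXn2r _ 2)// ?nnegrE ?addr_ge0 ?enorm_ge0//.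
rewrite enorm_sqr !dotE (dotC v u) sqrrD !enorm_sqr.
have := dot_le u v; lra.
Qed.

Lemma enormBD u v : enorm (u - v) <= enorm u + enorm v.
Proof. by rewrite (le_trans (enormD _ _))// enormN. Qed.

Lemma enorm_dist u v : enorm u - enorm v <= enorm (u - v).
Proof. by rewrite lerBlDr -{1}(subrK v u) enormD. Qed.

Lemma enorm_tri u v w : enorm (u - w) <= enorm (u - v) + enorm (v - w).
Proof. by rewrite -{1}(subrK v u) -addrA enormD. Qed.

Lemma enorm_sum (I : Type) (s : seq I) (P : pred I) (F : I -> 'rV[R]_n) :
  enorm (\sum_(i <- s | P i) F i) <= \sum_(i <- s | P i) enorm (F i).
Proof.
elim/big_rec2 : _ => [|i a b _ h]; first by rewrite enorm0.
by rewrite (le_trans (enormD _ _))// lerD2l.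
Qed.

Lemma enorm_le_sum u : enorm u <= \sum_i `|u 0 i|.
Proof.
rewrite {1}(row_sum_delta u) (le_trans (enorm_sum _ _ _))// ler_sum// => i _.
rewrite enormZ ler_piMr// /enorm (bigD1 i)//= big1 ?addr0 ?mxE ?eqxx//=.
  by rewrite expr1n sqrtr1.
by move=> j ji; rewrite !mxE (negbTE ji) expr0n.
Qed.

Lemma dot_mx u v : (u *m v^T) 0 0 = dot u v.
Proof. by rewrite mxE; apply: eq_bigr => i _; rewrite mxE. Qed.

Lemma enorm_dir u : u != 0 -> enorm ((enorm u)^-1 *: u) = 1.
Proof.
move=> /enorm_gt0 u0.
by rewrite enormZ ger0_norm ?invr_ge0 ?enorm_ge0// mulVf// gt_eqF.
Qed.

End Dot.

Lemma dot_mulmx m n (u : 'rV[R]_m) (A : 'M[R]_(m, n)) v :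
  dot (u *m A) v = dot u (v *m A^T).
Proof. by rewrite -!dot_mx trmx_mul trmxK mulmxA. Qed.

Lemma dot_row_mx m n (u1 v1 : 'rV[R]_m) (u2 v2 : 'rV[R]_n) :
  dot (row_mx u1 u2) (row_mx v1 v2) = dot u1 v1 + dot u2 v2.
Proof.
rewrite /dot big_split_ord /=; congr (_ + _); apply: eq_bigr => i _.
  by rewrite !row_mxEl.
by rewrite !row_mxEr.
Qed.

Lemma enorm_row_mx m n (u : 'rV[R]_m) (v : 'rV[R]_n) :
  enorm (row_mx u v) ^+ 2 = enorm u ^+ 2 + enorm v ^+ 2.
Proof. by rewrite !enorm_sqr dot_row_mx. Qed.

Lemma enorm_row_mx_le m n (u : 'rV[R]_m) (v : 'rV[R]_n) :
  enorm (row_mx u v) <= enorm u + enorm v.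
Proof.
rewrite -(@ler_pXn2r _ 2)// ?nnegrE ?addr_ge0 ?enorm_ge0// enorm_row_mx sqrrD.
by rewrite -addrA lerD2l lerDr mulrn_wge0// mulr_ge0 ?enorm_ge0.
Qed.

Lemma enorm_lrow_mx m n (u : 'rV[R]_m) (v : 'rV[R]_n) :
  enorm u <= enorm (row_mx u v).
Proof.
by rewrite -(@ler_pXn2r _ 2)// ?nnegrE ?enorm_ge0// enorm_row_mx lerDl sqr_ge0.
Qed.

Lemma enorm_rrow_mx m n (u : 'rV[R]_m) (v : 'rV[R]_n) :
  enorm v <= enorm (row_mx u v).
Proof.
by rewrite -(@ler_pXn2r _ 2)// ?nnegrE ?enorm_ge0// enorm_row_mx lerDr sqr_ge0.
Qed.

End Euclid.

Section Continuity.
Variables (R : realType) (n : nat).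

Lemma coord_le_norm (v : 'rV[R]_n) i : `|v 0 i| <= `|v|.
Proof.
by rewrite [leRHS]/Num.Def.normr/= mx_normrE; exact: (le_bigmax _ _ (0, i)).
Qed.

Lemma norm_le_coord (v : 'rV[R]_n) x : 0 <= x -> (forall i, `|v 0 i| <= x) ->
  `|v| <= x.
Proof.
move=> x0 h; rewrite [leLHS]/Num.Def.normr/= mx_normrE.
by apply: bigmax_le => //= -[i j] _ /=; rewrite ord1.
Qed.

Lemma enorm_le_norm (v : 'rV[R]_n) : enorm v <= n%:R * `|v|.
Proof.
apply: (le_trans (enorm_le_sum _)).
apply: (@le_trans _ _ (\sum_(i < n) `|v|)); last by rewrite sumr_const card_ord mulr_natl.
by apply: ler_sum => i _; exact: coord_le_norm.
Qed.

Lemma norm_le_enorm (v : 'rV[R]_n) : `|v| <= enorm v.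
Proof. by apply: norm_le_coord; [exact: enorm_ge0|exact: coord_le_enorm]. Qed.

Lemma enorm_continuous : continuous (@enorm R n).
Proof.
move=> x; apply/(@cvgrPdist_lt _ _ _ _ (nbhs_filter (x : 'rV[R]_n : normedModType R))) => e e0; near=> y.
have d : n.+1%:R * `|x - y| < e.
  rewrite mulrC -ltr_pdivlMr//; near: y.
  apply/nbhs_ballP; exists (e / n.+1%:R) => /=; first by rewrite divr_gt0.
  by move=> y; rewrite -ball_normE.
apply: le_lt_trans d; apply: (@le_trans _ _ (n%:R * `|x - y|)); last first.
  by rewrite ler_wpM2r// ler_nat.
apply: le_trans (enorm_le_norm _).
rewrite ler_norml enorm_dist andbT lerNl opprB enormB; exact: enorm_dist.
Unshelve. all: by end_near. Qed.

End Continuity.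

Section Calculus.
Variable R : realType.
Implicit Types (u : R -> R) (a b t : R).

Lemma is_derive_coord n (x : R -> 'rV[R]_n) (dx : 'rV[R]_n) t i :
  is_derive t (1 : R) x dx -> is_derive t (1 : R) (fun s => x s 0 i) (dx 0 i).
Proof.
move=> [dex <-]; apply: DeriveDef; first by move/derivable_mxP: dex; apply.
by rewrite derive_mx// mxE.
Qed.

Lemma is_derive_rowP n (x : R -> 'rV[R]_n) (dx : 'rV[R]_n) t :
  (forall i, is_derive t (1 : R) (fun s => x s 0 i) (dx 0 i)) ->
  is_derive t (1 : R) x dx.
Proof.
move=> h; have dex : derivable x t 1.
  by apply/derivable_mxP => i j; rewrite ord1; have [] := h j.
apply: DeriveDef => //; rewrite derive_mx//; apply/rowP => j.
by rewrite mxE; have [_ <-] := h j.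
Qed.

Lemma is_derive_sumr n (F : 'I_n -> R -> R) (dF : 'I_n -> R) t :
  (forall i, is_derive t (1 : R) (F i) (dF i)) ->
  is_derive t (1 : R) (fun s => \sum_i F i s) (\sum_i dF i).
Proof.
move=> h; rewrite (_ : (fun s => _) = \sum_i F i).
  exact: is_derive_sum.
by apply/funext => s; rewrite fct_sumE.
Qed.

Lemma is_derive_dot n (x y : R -> 'rV[R]_n) (dx dy : 'rV[R]_n) t :
  is_derive t (1 : R) x dx -> is_derive t (1 : R) y dy ->
  is_derive t (1 : R) (fun s => dot (x s) (y s)) (dot dx (y t) + dot (x t) dy).
Proof.
move=> hx hy; rewrite -big_split/=; apply: is_derive_sumr => i.
have hxi := is_derive_coord i hx; have hyi := is_derive_coord i hy.
have -> : dx 0 i * y t 0 i + x t 0 i * dy 0 i = x t 0 i *: dy 0 i + y t 0 i *: dx 0 i.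
  by rewrite addrC /GRing.scale/= (mulrC (dx 0 i)).
exact: is_deriveM hxi hyi.
Qed.

Lemma is_derive_scalev n (c : R -> R) (x : R -> 'rV[R]_n) (dc : R) (dx : 'rV[R]_n) t :
  is_derive t (1 : R) c dc -> is_derive t (1 : R) x dx ->
  is_derive t (1 : R) (fun s => c s *: x s) (dc *: x t + c t *: dx).
Proof.
move=> hc hx; apply: is_derive_rowP => i; rewrite !mxE.
under eq_fun do rewrite mxE.
have hxi := is_derive_coord i hx.
have -> : dc * x t 0 i + c t * dx 0 i = c t *: dx 0 i + x t 0 i *: dc.
  by rewrite addrC /GRing.scale/= (mulrC dc).
exact: is_deriveM hc hxi.
Qed.

Lemma is_derive_continuous (V : normedModType R) (x : R -> V) dx t :
  is_derive t (1 : R) x dx -> {for t, continuous x}.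
Proof.
by move=> [/derivable1_diffP dex _]; exact: differentiable_continuous.
Qed.

Lemma nincr_derive u u' a b : a <= b ->
  (forall t, a < t < b -> is_derive t (1 : R) u (u' t)) ->
  (forall t, a < t < b -> u' t <= 0) ->
  {within `[a, b], continuous u} -> u b <= u a.
Proof.
move=> ab du u'0 cu; have [<-//|aNb] := eqVneq a b.
have lab : a < b by rewrite lt_neqAle aNb.
have du' t : t \in `]a, b[%R -> is_derive t (1 : R) u (u' t).
  by rewrite in_itv; exact: du.
have [c cab e] := MVT lab du' cu.
rewrite -subr_le0 e; apply: mulr_le0_ge0; last by rewrite subr_ge0.
by apply: u'0; move: cab; rewrite in_itv.
Qed.

Lemma within_continuousW (V : topologicalType) (x : R -> V) a b :
  (forall t, a <= t <= b -> {for t, continuous x}) ->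
  {within `[a, b], continuous x}.
Proof.
move=> h; apply: continuous_in_subspaceT => t; rewrite inE/= in_itv/= => /h.
exact.
Qed.

Lemma nincr_derive_cc u u' a b : a <= b ->
  (forall t, a <= t <= b -> is_derive t (1 : R) u (u' t)) ->
  (forall t, a < t < b -> u' t <= 0) -> u b <= u a.
Proof.
move=> ab du u'0; apply: (nincr_derive ab _ u'0).
  by move=> t /andP[h1 h2]; apply: du; rewrite !ltW.
by apply: within_continuousW => t /du; exact: is_derive_continuous.
Qed.

Lemma is_derive_addf (V : normedModType R) (x y : R -> V) dx dy t :
  is_derive t (1 : R) x dx -> is_derive t (1 : R) y dy ->
  is_derive t (1 : R) (fun s => x s + y s) (dx + dy).
Proof. by move=> hx hy; exact: is_deriveD. Qed.

Lemma is_derive_subf (V : normedModType R) (x y : R -> V) dx dy t :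
  is_derive t (1 : R) x dx -> is_derive t (1 : R) y dy ->
  is_derive t (1 : R) (fun s => x s - y s) (dx - dy).
Proof. by move=> hx hy; exact: is_deriveB. Qed.

Lemma is_derive_constf (V : normedModType R) (v : V) t :
  is_derive t (1 : R) (fun=> v) 0.
Proof. exact: is_derive_cst. Qed.

Lemma is_derive_mulf (x y : R -> R) dx dy t :
  is_derive t (1 : R) x dx -> is_derive t (1 : R) y dy ->
  is_derive t (1 : R) (fun s => x s * y s) (dx * y t + x t * dy).
Proof.
move=> hx hy; have -> : dx * y t + x t * dy = x t *: dy + y t *: dx.
  by rewrite addrC /GRing.scale/= (mulrC dx).
exact: is_deriveM hx hy.
Qed.

Lemma is_derive_mulCf (k : R) (x : R -> R) dx t :
  is_derive t (1 : R) x dx -> is_derive t (1 : R) (fun s => k * x s) (k * dx).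
Proof. by move=> hx; exact: is_deriveZ. Qed.

Lemma is_derive_expf (x : R -> R) dx t :
  is_derive t (1 : R) x dx ->
  is_derive t (1 : R) (fun s => expR (x s)) (expR (x t) * dx).
Proof. by move=> hx; exact: (is_derive1_comp (is_derive_expR _) hx). Qed.

Lemma IVT_pt u a b v : a <= b ->
  (forall t, a <= t <= b -> {for t, continuous u}) ->
  u a <= v <= u b -> exists2 t, a <= t <= b & u t = v.
Proof.
move=> ab cu /andP[av vb].
have [|c] := IVT ab (within_continuousW cu) (v := v).
  by rewrite ge_min le_max av vb orbT.
by rewrite in_itv/= => ? ?; exists c.
Qed.

End Calculus.

(** * Curves crossing nested half-spaces *)

Section DescentCurves.
Variables (R : realType) (n : nat).
Implicit Types (U : 'M[R]_n) (c a b s t : R) (gam dgam nu : R -> 'rV[R]_n)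
  (l dl : R -> R) (M P e v w : 'rV[R]_n).

(** A curve [gam] of the subspace [U] whose whole future lies, at each time [s],
    in the half-space of inner normal [nu s] bounded at [gam s].  The clock [l]
    dominates its arc length, and [c] bounds from below the cosine of the angle
    between motion and normal, measured with the clock.  For [c = 1] the normal
    is the unit tangent, as for steepest-descent curves of quasiconvex
    functions; a smaller [c] allows for a variable metric and for errors. *)
Definition descent_curve U c a b gam dgam nu l dl : Prop :=
  [/\ forall t, a <= t <= b -> (gam t <= U)%MS,
      forall t, a <= t <= b ->
        is_derive t (1 : R) gam (dgam t) /\ is_derive t (1 : R) l (dl t),
      forall t, a <= t <= b -> enorm (dgam t) <= dl t /\ enorm (nu t) <= 1,
      forall t, a <= t <= b -> c * dl t <= dot (nu t) (dgam t) &
      forall s t, a <= s -> s <= t -> t <= b ->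
        0 <= dot (nu s) (gam t - gam s)].

(** [M] lies in all the half-spaces crossed so far, as does every minimizer when
    the half-spaces support sublevel sets. *)
Definition kept a b gam nu M :=
  forall s, a <= s <= b -> 0 <= dot (nu s) (M - gam s).

Lemma descent_curve_sub U c a b a1 b1 gam dgam nu l dl :
  a <= a1 -> b1 <= b -> descent_curve U c a b gam dgam nu l dl ->
  descent_curve U c a1 b1 gam dgam nu l dl.
Proof.
move=> aa bb [h1 h2 h3 h4 h5].
have sub t : a1 <= t <= b1 -> a <= t <= b.
  by move=> /andP[? ?]; apply/andP; split; [exact: le_trans aa _|exact: le_trans bb].
split=> [t /sub/h1//|t /sub/h2//|t /sub/h3//|t /sub/h4//|s t as1 st tb].
by apply: h5 => //; [exact: le_trans as1|exact: le_trans bb].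
Qed.

Lemma kept_sub a b a1 b1 gam nu M : a <= a1 -> b1 <= b ->
  kept a b gam nu M -> kept a1 b1 gam nu M.
Proof.
move=> aa bb h s /andP[h1 h2]; apply: h.
by rewrite (le_trans aa h1) (le_trans h2 bb).
Qed.

Lemma kept_future U c a b gam dgam nu l dl t :
  descent_curve U c a b gam dgam nu l dl -> t <= b ->
  kept a t gam nu (gam t).
Proof. by move=> [_ _ _ _ h] tb s /andP[? ?]; exact: h. Qed.

Lemma kept_conv a b gam nu (I : finType) (A : pred I) (be : I -> R)
    (p : I -> 'rV[R]_n) :
  (forall i, A i -> 0 <= be i) -> \sum_(i | A i) be i = 1 ->
  (forall i, A i -> kept a b gam nu (p i)) ->
  kept a b gam nu (\sum_(i | A i) be i *: p i).
Proof.
move=> be0 be1 hp s hs.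
have -> : \sum_(i | A i) be i *: p i - gam s =
    \sum_(i | A i) be i *: (p i - gam s).
  rewrite -{1}(scale1r (gam s)) -be1 scaler_suml -sumrB.
  by apply: eq_bigr => i _; rewrite scalerBr.
rewrite dot_sumr sumr_ge0// => i Ai.
by rewrite dotZr mulr_ge0 ?be0//; exact: hp.
Qed.

Lemma descent_curve_translate U c a b gam dgam nu l dl M : (M <= U)%MS ->
  descent_curve U c a b gam dgam nu l dl ->
  descent_curve U c a b (fun t => gam t - M) dgam nu l dl.
Proof.
move=> MU [h1 h2 h3 h4 h5]; split=> // [t ht|t ht|s t as1 st tb].
- by rewrite addmx_sub ?eqmx_opp ?h1.
- have [h2a h2b] := h2 _ ht; split=> //.
  by rewrite -(subr0 (dgam t)); apply: is_derive_subf => //; exact: is_derive_constf.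
- by rewrite opprB addrA subrK; exact: h5.
Qed.

Lemma kept_translate a b gam nu M :
  kept a b gam nu M -> kept a b (fun t => gam t - M) nu 0.
Proof. by move=> h s hs; rewrite sub0r opprB; exact: h. Qed.

Section OneCurve.
Variables (U : 'M[R]_n) (c a b : R) (gam dgam nu : R -> 'rV[R]_n) (l dl : R -> R).
Hypothesis dc : descent_curve U c a b gam dgam nu l dl.

Lemma clock_ge0 t : a <= t <= b -> 0 <= dl t.
Proof.
by move=> ht; have [_ _ h _ _] := dc; have [h1 _] := h t ht; exact: le_trans (enorm_ge0 _) h1.
Qed.

Lemma clock_ndecr s t : a <= s -> s <= t -> t <= b -> l s <= l t.
Proof.
move=> as1 st tb; have [_ d _ _ _] := dc; rewrite -lerN2.
have sub r : s <= r <= t -> a <= r <= b.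
  by move=> /andP[h1 h2]; rewrite (le_trans as1 h1) (le_trans h2 tb).
apply: (@nincr_derive_cc _ (fun r => - l r) (fun r => - dl r)) => // r hr.
  by apply: is_deriveN; have [] := d r (sub _ hr).
by rewrite oppr_le0 clock_ge0// sub//; move: hr => /andP[? ?]; rewrite !ltW.
Qed.

Lemma chord_le_clock s t : a <= s -> s <= t -> t <= b ->
  enorm (gam t - gam s) <= l t - l s.
Proof.
move=> as1 st tb; have [_ d h _ _] := dc.
have sub r : s <= r <= t -> a <= r <= b.
  by move=> /andP[h1 h2]; rewrite (le_trans as1 h1) (le_trans h2 tb).
set D := gam t - gam s.
have [D0|D0] := eqVneq D 0.
  by rewrite D0 enorm0 subr_ge0 clock_ndecr.
have nD := enorm_gt0 D0.
have : dot D (gam t) - enorm D * l t <= dot D (gam s) - enorm D * l s.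
  apply: (@nincr_derive_cc _ (fun r => dot D (gam r) - enorm D * l r)
    (fun r => dot D (dgam r) - enorm D * dl r)) => // r hr.
    have [dg dlr] := d r (sub _ hr).
    have := is_derive_dot (is_derive_constf D r) dg; rewrite dot0l add0r => dd.
    exact: (is_derive_subf dd (is_derive_mulCf (enorm D) dlr)).
  have hr' : a <= r <= b by apply: sub; move: hr => /andP[? ?]; rewrite !ltW.
  have [h1 _] := h r hr'.
  rewrite subr_le0 (le_trans (dot_le _ _))// ler_wpM2l// ?enorm_ge0//.
move=> h0; have hh : enorm D * enorm D <= enorm D * (l t - l s).
  rewrite -expr2 enorm_sqr {2}/D dotDr dotNr; lra.
by rewrite -(ler_pM2l nD).
Qed.

Lemma curve_continuous t : a <= t <= b -> {for t, continuous gam}.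
Proof. by have [_ d _ _ _] := dc => /d[/is_derive_continuous]. Qed.

Lemma clock_continuous t : a <= t <= b -> {for t, continuous l}.
Proof. by have [_ d _ _ _] := dc => /d[_ /is_derive_continuous]. Qed.

End OneCurve.

End DescentCurves.

(** * A curve going far away changes direction *)

Section Directions.
Variables (R : realType) (n : nat).
Implicit Types (U : 'M[R]_n) (c a b s t : R) (gam dgam nu : R -> 'rV[R]_n)
  (l dl : R -> R) (M P e v w : 'rV[R]_n).

(** The constant [C] must serve all curves: it depends on [c] and on the
    dimension only. *)
Definition length_bound k := forall c, 0 < c -> c <= 1 -> exists C, 0 < C /\
  forall U a b gam dgam nu l dl, a <= b -> (\rank U <= k)%N ->
    descent_curve U c a b gam dgam nu l dl -> kept a b gam nu 0 ->
    l b - l a <= C * enorm (gam a).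

Definition proj e v : 'rV[R]_n := v - dot v e *: e.

Lemma projD e v w : proj e (v + w) = proj e v + proj e w.
Proof. by rewrite /proj dotDl scalerDl opprD addrACA. Qed.

Lemma projZ e x v : proj e (x *: v) = x *: proj e v.
Proof. by rewrite /proj dotZl scalerBr scalerA. Qed.

Section Unit.
Variable e : 'rV[R]_n.
Hypothesis e1 : dot e e = 1.

Lemma proj_unit : proj e e = 0.
Proof. by rewrite /proj e1 scale1r subrr. Qed.

Lemma proj_orth v : dot (proj e v) e = 0.
Proof. by rewrite /proj !dotE e1 mulr1 subrr. Qed.

Lemma enorm_proj v : enorm (proj e v) <= enorm v.
Proof.
rewrite -(@ler_pXn2r _ 2)// ?nnegrE ?enorm_ge0// !enorm_sqr /proj !dotE e1.
rewrite (dotC e v); have := sqr_ge0 (dot v e); lra.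
Qed.

Lemma proj_sub U v : (e <= U)%MS -> (v <= U)%MS ->
  (proj e v <= U :&: kermx e^T)%MS.
Proof.
move=> eU vU; rewrite sub_capmx addmx_sub ?eqmx_opp ?scalemx_sub//=.
apply/sub_kermxP/matrixP => i j; rewrite !ord1 dot_mx mxE.
exact: proj_orth.
Qed.

Lemma rank_proj U : (e <= U)%MS -> (\rank (U :&: kermx e^T)%MS < \rank U)%N.
Proof.
move=> eU; rewrite ltn_neqAle mxrankS ?capmxSl// andbT.
rewrite (mxrank_leqif_eq (capmxSl U (kermx e^T))).
apply/negP => /eqmxP h; move: eU; rewrite -h sub_capmx => /andP[_ /sub_kermxP].
move=> /matrixP/(_ 0 0); rewrite dot_mx mxE e1 => /eqP.
by rewrite oner_eq0.
Qed.

End Unit.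

(** A half-space bounded at [lam e + sig] that contains both [0] and [p e], with
    [lam] well inside the interval from [0] to [p], cannot be steep along [e]: its normal [nu] is
    almost orthogonal to [e], up to the distance of [sig] to the line.  Here
    [ne] and [ns] stand for the products of [nu] with [e] and [sig], and [x] for
    the norm of [sig]. *)
Lemma normal_between (p lam ne ns x r : R) : 0 < r -> r / 2 <= lam ->
  r / 2 <= p - lam -> 0 <= - (lam * ne + ns) -> 0 <= p * ne - (lam * ne + ns) ->
  - ns <= x -> ns <= 0 /\ `|ne| <= 2 / r * x.
Proof.
move=> r0 h1 h2 h3 h4 h5.
have ns0 : ns <= 0.
  have [ne0|ne0] := leP 0 ne; first by have := mulr_ge0 (le_trans (ltW (divr_gt0 r0 (ltr0Sn _ 1))) h1) ne0; lra.
  have : (p - lam) * ne <= 0 by apply: mulr_ge0_le0; lra.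
  lra.
split=> //; rewrite -(@ler_pM2l _ (r / 2)); last by rewrite divr_gt0.
rewrite mulrA (_ : r / 2 * (2 / r) = 1) ?mul1r; last by field; rewrite gt_eqF.
have [ne0|ne0] := leP 0 ne.
  by rewrite ger0_norm//; have := ler_wpM2r ne0 h1; lra.
rewrite ltr0_norm//.
have ne1 : 0 <= - ne by lra.
by have := ler_wpM2r ne1 h2; lra.
Qed.

(** Projecting centrally onto the orthogonal of [e], from [0] when the curve
    advances along [e] and from [p e] when it recedes, keeps the half-space
    condition up to a dilation of the projected point.  The factor
    [1 + 2 d / r], with [d] the progress along [e], serves both cases; [As] and
    [At] are the products of the normal with the projections at times [s] and
    [t]. *)
Lemma projected_halfspace (p lams lamt ne As At d r : R) : 0 < r ->
  r / 2 <= lams -> r / 2 <= p - lams -> `|lamt - lams| <= d ->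
  0 <= (lamt * ne + At) - (lams * ne + As) ->
  0 <= - (lams * ne + As) -> 0 <= p * ne - (lams * ne + As) ->
  As <= 0 -> (1 + 2 / r * d) * As <= At.
Proof.
move=> r0 h1 h2 hd h3 h4 h5 As0.
have K0 : 0 < 2 / r by rewrite divr_gt0.
have key x y : 0 < x -> 0 <= y -> y <= d -> r / 2 <= x ->
    2 / r * d * As <= y * (As / x).
  move=> x0 y0 yd xr.
  have : y / x <= 2 / r * d.
    rewrite ler_pdivrMr//; apply: (le_trans yd).
    have := ler_wpM2l (ltW K0) xr.
    rewrite (_ : 2 / r * (r / 2) = 1); last by field; rewrite gt_eqF.
    by move=> /(ler_wpM2l (le_trans y0 yd)); lra.
  by move=> /(ler_wnM2r As0); rewrite (_ : y * (As / x) = y / x * As) //; ring.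
have r2 : 0 < r / 2 by rewrite divr_gt0.
have [hl|hl] := leP lams lamt.
  have x0 : 0 < lams by lra.
  have hne : ne <= - As / lams by rewrite ler_pdivlMr//; lra.
  have y0 : 0 <= lamt - lams by lra.
  have yd : lamt - lams <= d by rewrite ger0_norm// in hd.
  have := key _ _ x0 y0 yd h1; have := ler_wpM2l y0 hne.
  rewrite mulNr mulrN; lra.
have x0 : 0 < p - lams by lra.
have hne : As / (p - lams) <= ne by rewrite ler_pdivrMr//; lra.
have y0 : 0 <= lams - lamt by lra.
have yd : lams - lamt <= d by rewrite distrC ger0_norm// in hd.
have := key _ _ x0 y0 yd h2; have := ler_wpM2l y0 hne; lra.
Qed.

End Directions.

(** Suppose that [gam a] and [gam b] were almost aligned with a unit vector [e],
    [gam b] being at least twice as far from the origin.  For a while the curve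
    stays near [|gam a| e], well inside the segment from [0] to [gam b], and
    both ends of that segment lie in all its half-spaces.  So the normals are
    almost orthogonal to [e], and the projection to the orthogonal of [e],
    dilated by the exponential [E] of the clock, is again a curve of the same
    kind, in one dimension less.  It starts near the origin, hence is short;
    but its clock and the clock of [gam] run at comparable speeds. *)
Lemma directions_apart (R : realType) n k : @length_bound R n k ->
  forall c, 0 < c -> c <= 1 -> exists kap, 0 < kap /\
  forall (U : 'M[R]_n) a b (gam dgam nu : R -> 'rV[R]_n) (l dl : R -> R),
    a <= b -> (\rank U <= k.+1)%N ->
    descent_curve U c a b gam dgam nu l dl -> kept a b gam nu 0 ->
    gam a != 0 -> 2 * enorm (gam a) <= enorm (gam b) ->
    kap <= enorm ((enorm (gam a))^-1 *: gam a - (enorm (gam b))^-1 *: gam b).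
Proof.
move=> Lk c c0 c1.
have [||C [C0 HC]] := Lk (c / 4); [lra|lra|].
set D := 1 - expR (- (c / 4)).
have D0 : 0 < D by rewrite subr_gt0 -[ltRHS]expR0 ltr_expR; lra.
exists (Num.min (c / 8) (D / C)); split.
  by rewrite lt_min !divr_gt0.
move=> U a b gam dgam nu l dl ab rU dc k0 ga0 hab.
rewrite leNgt; apply/negP; set x := enorm (_ - _); rewrite lt_min => /andP[xc xD].
set r := enorm (gam a) in hab x xc xD *; set p := enorm (gam b) in hab x xc xD *.
have r0 : 0 < r by exact: enorm_gt0.
have p0 : 0 < p by lra.
set e := p^-1 *: gam b in x xc xD.
have e1 : dot e e = 1.
  rewrite -enorm_sqr enorm_dir ?expr1n//.
  by apply/eqP => gb0; move: p0; rewrite /p gb0 enorm0 ltxx.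
have ne1 : enorm e = 1 by rewrite /enorm -/(enorm e) -(sqrtr1 R) -e1 -enorm_sqr /enorm sqr_sqrtr// sumr_ge0// => i _; exact: sqr_ge0.
have gbE : gam b = p *: e by rewrite scalerA divff ?scale1r// gt_eqF.
have [h1 h2 h3 h4 h5] := dc.
have eU : (e <= U)%MS by rewrite scalemx_sub// h1// ab lexx.
clearbody e.
have cr : c * r <= r by rewrite ler_piMl// ltW.
have cr0 : 0 < c * r by rewrite mulr_gt0.
(* Until [T], that is, while the clock advances by at most [c r / 8], the curve
   remains within [c r / 4] of [r e]. *)
have [T /andP[aT Tb] lT] : exists2 T, a <= T <= b & l T = l a + c * r / 8.
  apply: IVT_pt => //; first by move=> t ht; exact: (clock_continuous dc).
  have := chord_le_clock dc (lexx a) ab (lexx b).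
  have := enorm_dist (gam b) (gam a); rewrite -/r -/p; lra.
have sub t : a <= t <= T -> a <= t <= b.
  by move=> /andP[-> /= tT]; exact: le_trans Tb.
set w := gam a - r *: e.
have nw : enorm w = r * x.
  rewrite /w (_ : _ - _ = r *: (r^-1 *: gam a - e)); last first.
    by rewrite scalerBr [r *: (_ *: gam a)]scalerA divff ?scale1r// gt_eqF.
  by rewrite enormZ ger0_norm// ltW.
have rx : r * x <= c * r / 8.
  by rewrite (mulrC c) -mulrA ler_wpM2l ?ltW.
have clk t : a <= t <= T -> 0 <= l t - l a <= c * r / 8.
  move=> /andP[t1 t2]; have t3 := le_trans t2 Tb.
  have := clock_ndecr dc (lexx a) t1 t3; have := clock_ndecr dc t1 t2 Tb; lra.
set v := fun t => gam t - gam a + w.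
have gv t : gam t = v t + r *: e by rewrite /v /w addrA subrK subrK.
have nv t : a <= t <= T -> enorm (v t) <= c * r / 4.
  move=> ht; have [t1 t2] := andP ht; have [q1 q2] := andP (clk t ht).
  rewrite (le_trans (enormD _ _))// nw.
  have := chord_le_clock dc (lexx a) t1 (le_trans t2 Tb); lra.
set sig := fun t => proj e (gam t); set lam := fun t => dot (gam t) e.
have nsig t : a <= t <= T -> enorm (sig t) <= c * r / 4.
  move=> ht; rewrite /sig gv projD projZ proj_unit// scaler0 addr0.
  by rewrite (le_trans (enorm_proj e1 _))// nv.
have hlam t : a <= t <= T -> 3 / 4 * r <= lam t <= 5 / 4 * r.
  move=> ht; rewrite /lam gv dotDl dotZl e1 mulr1.
  have := dot_abs (v t) e; rewrite ne1 mulr1 ler_norml => /andP[q1 q2].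
  have := nv t ht; lra.
have gE s t : dot (nu s) (gam t) = lam t * dot (nu s) e + dot (nu s) (sig t).
  by rewrite /sig /proj /lam !dotE; ring.
have nb t : a <= t <= T -> dot (nu t) (sig t) <= 0 /\
    `|dot (nu t) e| <= 2 / r * enorm (sig t).
  move=> ht; have ht' := sub t ht; have [l1 l2] := andP (hlam t ht).
  apply: (@normal_between _ p (lam t)) => //; [lra|lra| | |].
  - by have := k0 t ht'; rewrite sub0r dotNr gE.
  - have [t1 t2] := andP ht'; have := h5 t b t1 t2 (lexx b).
    by rewrite dotDr dotNr gbE dotZr gE.
  - rewrite -dotNl (le_trans (dot_le _ _))// enormN ler_piMl ?enorm_ge0//.
    by have [] := h3 t ht'.
(* [E] turns the dilation of [projected_halfspace], through [1 + x <= exp x],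
   into a factor that is multiplicative along the curve. *)
set K := 2 / r; have K0 : 0 < K by rewrite divr_gt0.
set E := fun t => expR (- (K * (l t - l a))).
have E0 t : 0 < E t by exact: expR_gt0.
have dE t : a <= t <= T -> is_derive t (1 : R) E (E t * (- (K * dl t))).
  move=> /sub/h2[_ hl]; apply: is_derive_expf; apply: is_deriveN.
  apply: is_derive_mulCf; rewrite -{1}(subr0 (dl t)); apply: is_derive_subf.
have dsig t : a <= t <= T -> is_derive t (1 : R) sig (proj e (dgam t)).
  move=> /sub/h2[hg _]; apply: is_derive_subf.
  have hd := is_derive_dot hg (is_derive_constf e t).
  have := is_derive_scalev hd (is_derive_constf e t).
  by rewrite !dot0r addr0 scaler0 addr0.
set U1 := (U :&: kermx e^T)%MS.
set sg := fun t => E t *: sig t.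
set dsg := fun t => (E t * (- (K * dl t))) *: sig t + E t *: proj e (dgam t).
set l1 := fun t => - (2 / K * E t).
set dl1 := fun t => 2 * (E t * dl t).
have rU1 : (\rank U1 <= k)%N.
  by have := leq_trans (rank_proj e1 eU) rU; rewrite ltnS.
have dc1 : descent_curve U1 (c / 4) a T sg dsg nu l1 dl1.
  split=> [t ht|t ht|t ht|t ht|s t as1 st tT].
    + by rewrite scalemx_sub// proj_sub// h1// sub.
    + split; rewrite /dsg /dl1; first by apply: is_derive_scalev; [exact: dE|exact: dsig].
      rewrite (_ : 2 * (E t * dl t) = - (2 / K * (E t * (- (K * dl t))))); last first.
        by field; rewrite gt_eqF.
      by apply: is_deriveN; apply: is_derive_mulCf; exact: dE.
    + have [q1 q2] := h3 t (sub t ht); split=> //.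
      rewrite (le_trans (enormD _ _))// !enormZ normrM normrN normrM.
      rewrite (gtr0_norm (E0 t)) (gtr0_norm K0) (ger0_norm (clock_ge0 dc (sub t ht))).
      have q3 := enorm_proj e1 (dgam t); have q4 := nsig t ht.
      have q5 : K * enorm (sig t) <= 1.
        have := ler_wpM2l (ltW K0) q4; move/le_trans; apply.
        rewrite (_ : K * (c * r / 4) = c / 2); last by rewrite /K; field; rewrite gt_eqF.
        lra.
      have q6 := ler_wpM2l (clock_ge0 dc (sub t ht)) q5.
      have q7 : K * dl t * enorm (sig t) + enorm (proj e (dgam t)) <= 2 * dl t by lra.
      have := ler_wpM2l (ltW (E0 t)) q7; rewrite /dl1; lra.
    + have [q1 q2] := nb t ht; have q3 := h4 t (sub t ht).
      have [q4 q5] := h3 t (sub t ht); have dl0 := clock_ge0 dc (sub t ht).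
      rewrite /dl1 /dsg dotDr [dot _ (_ *: sig t)]dotZr [dot _ (E t *: _)]dotZr.
      rewrite mulrN mulNr.
      have q6 : dot (dgam t) e * dot (nu t) e <= c / 2 * dl t.
        apply: (le_trans (ler_norm _)); rewrite normrM mulrC.
        apply: ler_pM => //.
          apply: (le_trans q2); have := ler_wpM2l (ltW K0) (nsig t ht).
          rewrite (_ : K * (c * r / 4) = c / 2) //.
          by rewrite /K; field; rewrite gt_eqF.
        by rewrite (le_trans (dot_abs _ _))// ne1 mulr1.
      have q7 : 0 <= E t * (K * dl t) * - dot (nu t) (sig t).
        apply: mulr_ge0; last by rewrite oppr_ge0.
        by apply: mulr_ge0; [exact: ltW|exact: mulr_ge0 (ltW K0) dl0].
      have q8 : c / 2 * dl t <= dot (nu t) (proj e (dgam t)).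
        by rewrite /proj !dotE; lra.
      have := ler_wpM2l (ltW (E0 t)) q8; lra.
    + have hs : a <= s <= T by rewrite as1 (le_trans st).
      have ht : a <= t <= T by rewrite (le_trans as1).
      have [q1 _] := nb s hs; have [m1 m2] := andP (hlam s hs).
      have [s1 s2] := andP (sub s hs).
      have q2 : (1 + 2 / r * (l t - l s)) * dot (nu s) (sig s) <= dot (nu s) (sig t).
        apply: (@projected_halfspace _ p (lam s) (lam t) (dot (nu s) e)) => //.
        * lra.
        * lra.
        * rewrite /lam -dotNl -dotDl (le_trans (dot_abs _ _))// ne1 mulr1.
          exact: (chord_le_clock dc as1 st (le_trans tT Tb)).
        * by have := h5 s t as1 st (le_trans tT Tb); rewrite dotDr dotNr !gE.
        * by have := k0 s (sub s hs); rewrite sub0r dotNr gE.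
        * have := h5 s b s1 s2 (lexx b).
          by rewrite dotDr dotNr gbE dotZr gE.
      have q3 : expR (K * (l t - l s)) * dot (nu s) (sig s) <= dot (nu s) (sig t).
        apply: le_trans q2; apply: ler_wnM2r => //; exact: expR_ge1Dx.
      have := ler_wpM2l (ltW (E0 t)) q3.
      rewrite mulrA /E -expRD (_ : _ + _ = - (K * (l s - l a))); last by ring.
      rewrite -/(E s) -/(E t) /sg dotDr dotNr [dot _ (E t *: _)]dotZr [dot _ (E s *: _)]dotZr; lra.
have k1 : kept a T sg nu 0.
  move=> t ht; have [q1 _] := nb t ht.
    by rewrite sub0r dotNr dotZr oppr_ge0 mulr_ge0_le0// ltW.
have := HC U1 a T sg dsg nu l1 dl1 aT rU1 dc1 k1; rewrite /l1 /sg {rU1 dc1 k1}.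
rewrite /E subrr mulr0 oppr0 expR0 scale1r => hfin.
have q1 : enorm (sig a) <= r * x.
  rewrite -nw /sig gv projD projZ proj_unit// scaler0 addr0 /v subrr add0r.
  exact: enorm_proj.
move: hfin; rewrite lT addrAC subrr add0r.
rewrite (_ : K * (c * r / 8) = c / 4); last by rewrite /K; field; rewrite gt_eqF.
rewrite (_ : 2 / K = r); last by rewrite /K; field; rewrite gt_eqF.
move=> hfin; have : r * D <= C * (r * x).
  by have := ler_wpM2l (ltW C0) q1; rewrite /D; lra.
rewrite mulrCA ler_pM2l// => hD.
by move: xD; rewrite ltr_pdivlMr// mulrC ltNge hD.
Qed.

(** * Bounded excursions *)

Section Spread.
Variables (R : realType) (n : nat).
Implicit Types (U : 'M[R]_n) (c a b s t : R) (gam dgam nu : R -> 'rV[R]_n)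
  (l dl : R -> R) (M v w : 'rV[R]_n).

Lemma unit_ball_net (kap : R) : 0 < kap ->
  exists (I : finType) (p : I -> 'rV[R]_n),
    forall v, enorm v <= 1 -> exists i, enorm (v - p i) < kap.
Proof.
move=> kap0; set N := (Num.bound (n.+1%:R / kap)).
have hN : n.+1%:R / kap < N%:R.
  by apply: archi_boundP; rewrite divr_ge0// ltW.
have N0 : 0 < N%:R :> R by apply: le_lt_trans hN; rewrite divr_ge0// ltW.
exists {ffun 'I_n -> 'I_(2 * N).+1}.
exists (fun k : {ffun 'I_n -> 'I_(2 * N).+1} => \row_i ((k i)%:R / N%:R - 1)) => v v1.
have vi (i : 'I_n) : -1 <= v 0 i <= 1.
  by rewrite -ler_norml (le_trans (coord_le_enorm _ _)).
have x0 (i : 'I_n) : 0 <= (v 0 i + 1) * N%:R.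
  by apply: mulr_ge0; [have := vi i; lra|exact: ltW].
have hk (i : 'I_n) : (Num.truncn ((v 0 i + 1) * N%:R)%R < (2 * N).+1)%N.
  rewrite ltnS -(ler_nat R); have /andP[q _] := truncn_itv (x0 i); apply: (le_trans q).
  rewrite natrM; apply: ler_wpM2r; first exact: ltW.
  by have := vi i; lra.
exists [ffun i => Ordinal (hk i)].
apply: (le_lt_trans (enorm_le_sum _)).
apply: (@le_lt_trans _ _ (\sum_(i < n) N%:R^-1)).
  apply: ler_sum => i _; rewrite !mxE ffunE/=.
  have /andP[q1 q2] := truncn_itv (x0 i).
  set q := Num.truncn _ in q1 q2 *.
  rewrite (_ : _ - _ = ((v 0 i + 1) * N%:R - q%:R) / N%:R); last first.
    by field; rewrite gt_eqF.
  rewrite normrM normfV (gtr0_norm N0) ler_piMl ?invr_ge0 ?(ltW N0)//.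
  by rewrite ger0_norm ?subr_ge0//; move: q2; rewrite -natr1; lra.
rewrite sumr_const card_ord -[_^-1 *+ n]mulr_natl ltr_pdivrMr// mulrC -ltr_pdivrMr//.
by apply: le_lt_trans hN; rewrite ler_pM2r ?invr_gt0// ler_nat.
Qed.

Lemma unit_ball_pigeonhole (kap : R) : 0 < kap -> exists N : nat,
  forall v : nat -> 'rV[R]_n, (forall i, (i <= N)%N -> enorm (v i) <= 1) ->
  exists i j, [/\ (i < j)%N, (j <= N)%N & enorm (v i - v j) < kap].
Proof.
move=> kap0; have [|I [p hp]] := unit_ball_net (kap := kap / 2).
  by rewrite divr_gt0.
exists #|I| => v v1.
have hv (i : 'I_#|I|.+1) : exists k, enorm (v i - p k) < kap / 2.
  by apply: hp; apply: v1; rewrite -ltnS.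
pose f (i : 'I_#|I|.+1) := projT1 (cid (hv i)).
have hf (i : 'I_#|I|.+1) : enorm (v i - p (f i)) < kap / 2 by exact: projT2 (cid (hv i)).
have /injectivePn[i [j ij fij]] : ~~ injectiveb f.
  apply/negP => /injectiveP /leq_card; by rewrite card_ord ltnn.
have close : enorm (v i - v j) < kap.
  apply: (le_lt_trans (enorm_tri _ (p (f i)) _)).
  have := hf i; have := hf j; rewrite -fij (enormB (v j)).
  by move=> h1 h2; rewrite [ltRHS]splitr ltrD.
case: (ltngtP i j) => hij.
- by exists i, j; split=> //; rewrite -ltnS.
- by exists j, i; rewrite enormB; split=> //; rewrite -ltnS.
- by move: ij; rewrite (val_inj hij) eqxx.
Qed.

Lemma doubling_times gam (ep : R) (N : nat) a b : a <= b -> 0 < ep ->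
  (forall t, a <= t <= b -> {for t, continuous gam}) ->
  enorm (gam a) <= ep -> 2 ^+ N * ep <= enorm (gam b) ->
  exists t : nat -> R,
    (forall i, (i <= N)%N -> a <= t i <= b /\ enorm (gam (t i)) = 2 ^+ i * ep) /\
    forall i j, (i <= j)%N -> (j <= N)%N -> t i <= t j.
Proof.
move=> ab ep0 cg ga; elim: N b ab cg => [|N IH] b ab cg gb.
  have [t ht||t ht et] := @IVT_pt _ (@enorm R n \o gam) a b ep ab.
  - by apply: continuous_comp; [exact: cg|exact: enorm_continuous].
  - by rewrite /= ga; move: gb; rewrite expr0 mul1r.
  exists (fun=> t); split=> [i|]//; rewrite leqn0 => /eqP ->.
  by rewrite expr0 mul1r.
have h2 : ep <= 2 ^+ N.+1 * ep by rewrite ler_peMl ?exprn_ege1 ?ler1n// ltW.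
have [t ht||b1 /andP[ab1 b1b] eb1] :=
    @IVT_pt _ (@enorm R n \o gam) a b (2 ^+ N.+1 * ep) ab.
- by apply: continuous_comp; [exact: cg|exact: enorm_continuous].
- by rewrite /= gb (le_trans ga h2).
have [t ht||t [t1 t2]] := IH b1 ab1.
- by apply: cg; move: ht => /andP[-> /= q]; exact: le_trans b1b.
- rewrite [leRHS]eb1; apply: ler_wpM2r; first exact: ltW.
  by rewrite ler_eXn2l ?ltr1n.
exists (fun i => if i == N.+1 then b1 else t i); split=> [i|i j].
  rewrite leq_eqVlt; case: eqP => [-> _|_ /= /t1[/andP[q1 q2] q3]].
    by rewrite ab1 b1b.
  by rewrite q1 q3 (le_trans q2).
move=> ij; rewrite leq_eqVlt; case: eqP => [je _|_ /= jN].
  case: eqP => [//|iN]; have := t1 i; case=> [|/andP[]//].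
  by rewrite -ltnS ltn_neqAle; move/eqP: iN => -> /=; rewrite -je.
by rewrite ltn_eqF ?(leq_trans _ jN)//; exact: t2.
Qed.

(** Each time the distance to [M] doubles, the direction seen from [M] has moved
    away from all the earlier ones by a fixed amount ([directions_apart]); the
    unit ball has room for finitely many such directions. *)
Lemma kept_dist_le k : @length_bound R n k ->
  forall c, 0 < c -> c <= 1 -> exists B, 1 <= B /\
  forall U a b gam dgam nu l dl M, a <= b -> (\rank U <= k.+1)%N ->
    descent_curve U c a b gam dgam nu l dl -> (M <= U)%MS ->
    kept a b gam nu M -> enorm (gam b - M) <= B * enorm (gam a - M).
Proof.
move=> Lk c c0 c1; have [kap [kap0 hkap]] := directions_apart Lk c0 c1.
have [N hN] := unit_ball_pigeonhole kap0.
exists (2 ^+ N); split; first by rewrite exprn_ege1// ler1n.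
move=> U a b gam dgam nu l dl M ab rU dc MU kM.
have {}dc := descent_curve_translate MU dc.
have {}kM := kept_translate kM.
set g := fun t => gam t - M in dc kM; rewrite -/(g b) -/(g a).
have N0 : 0 < 2 ^+ N :> R by exact: exprn_gt0.
rewrite mulrC -ler_pdivrMr//; apply/ler_addgt0Pr => d d0.
rewrite leNgt; apply/negP; rewrite ltr_pdivlMr// => hb.
set ep := enorm (g a) + d in hb.
have ep0 : 0 < ep by have := enorm_ge0 (g a); rewrite /ep; lra.
have [t ht|||t [t1 t2]] := @doubling_times g ep N a b ab ep0.
- exact: (curve_continuous dc ht).
- by rewrite lerDl ltW.
- by rewrite mulrC ltW.
have nt i : (i <= N)%N -> 0 < enorm (g (t i)).
  by move=> /t1[_ ->]; rewrite mulr_gt0// exprn_gt0.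
have gt0 i : (i <= N)%N -> g (t i) != 0.
  by move=> /nt h; apply/eqP => g0; move: h; rewrite g0 enorm0 ltxx.
have [|i [j [ij jN hij]]] := hN (fun i => (enorm (g (t i)))^-1 *: g (t i)).
  by move=> i iN; rewrite enorm_dir// gt0.
have iN := leq_trans (ltnW ij) jN.
have [/andP[q1 q2] q3] := t1 i iN; have [/andP[p1 p2] p3] := t1 j jN.
have tij := t2 i j (ltnW ij) jN.
have := hkap U (t i) (t j) g dgam nu l dl tij rU (descent_curve_sub q1 p2 dc)
  (kept_sub q1 p2 kM) (gt0 i iN).
rewrite q3 p3 => /(_ _) h; move: hij; rewrite ltNge => /negP; apply.
rewrite /= q3 p3; apply: h.
rewrite mulrA -exprS ler_wpM2r ?(ltW ep0)//.
by rewrite ler_eXn2l// ltr1n.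
Qed.

End Spread.

(** * The future of a curve lies in a cone *)

Section Caratheodory.
Variables (R : realType) (n : nat).

Lemma affine_dependence m (u : 'I_m -> 'rV[R]_n) (S : {set 'I_m}) :
  (n.+1 < #|S|)%N -> exists c : 'I_m -> R,
  [/\ forall i, i \notin S -> c i = 0, \sum_i c i = 0,
      \sum_i c i *: u i = 0 & exists i, 0 < c i].
Proof.
move=> nS; pose A : 'M[R]_(#|S|, n + 1) :=
  \matrix_j (row_mx (u (enum_val j)) (const_mx 1 : 'rV[R]_1)).
have A0 : kermx A != 0.
  rewrite kermx_eq0 /row_free; apply/eqP => rA.
  by have := rank_leq_col A; rewrite rA addn1 leqNgt nS.
pose v := nz_row (kermx A).
have vA : v *m A = 0 by apply/sub_kermxP; exact: nz_row_sub.
have v0 : v != 0 by rewrite nz_row_eq0.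
pose c i := \sum_(j | enum_val j == i) v 0 j.
have cE (V : lmodType R) (F : 'I_m -> V) :
    \sum_i c i *: F i = \sum_j v 0 j *: F (enum_val j).
  rewrite [RHS](partition_big (fun j => enum_val j) predT)//=.
  apply: eq_bigr => i _; rewrite /c scaler_suml.
  by apply: eq_bigr => j /eqP ->.
have c1 : \sum_i c i *: u i = 0.
  rewrite cE; apply/rowP => k.
  transitivity ((v *m A) 0 (lshift 1 k)); last by rewrite vA !mxE.
  rewrite mxE summxE; apply: eq_bigr => j _.
  by rewrite !mxE (unsplitK (inl _ k)).
have cs : \sum_i c i = 0.
  transitivity (\sum_j v 0 j).
    by rewrite [RHS](partition_big (fun j => enum_val j) predT).
  transitivity ((v *m A) 0 (rshift n 0)); last by rewrite vA mxE.
  by rewrite mxE; apply: eq_bigr => j _; rewrite !mxE (unsplitK (inr _ 0)) mxE mulr1.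
exists c; split => // [i iS|].
  rewrite /c big_pred0// => j; apply/negP => /eqP e.
  by move: iS; rewrite -e enum_valP.
apply: contrapT => h; move/negP: v0; apply.
have c0 i : c i = 0.
  have cle j : c j <= 0 by rewrite leNgt; apply/negP => cj; apply: h; exists j.
  have /eqP : \sum_i - c i = 0 by rewrite sumrN cs oppr0.
  rewrite psumr_eq0 => [/allP/(_ i)|j _]; last by rewrite oppr_ge0.
  by rewrite mem_index_enum oppr_eq0/= => /(_ isT)/eqP.
apply/eqP/rowP => j; rewrite [RHS]mxE -(c0 (enum_val j)) /c.
by rewrite (big_pred1 j)// => k; rewrite (inj_eq enum_val_inj).
Qed.

Lemma caratheodory m (u : 'I_m -> 'rV[R]_n) (al : 'I_m -> R) :
  (forall i, 0 <= al i) -> \sum_i al i = 1 -> exists be : 'I_m -> R,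
  [/\ forall i, 0 <= be i, \sum_i be i = 1,
      \sum_i be i *: u i = \sum_i al i *: u i &
      (#|[set i | be i != 0%R]%SET| <= n.+1)%N].
Proof.
have [N] := ubnP #|[set i | al i != 0%R]%SET|.
elim: N al => // N IH al; rewrite ltnS => alN al0 al1.
have [le|lt] := leqP #|[set i | al i != 0%R]%SET| n.+1; first by exists al.
have [c [cS c0 cu [i1 ci1]]] := affine_dependence u lt.
have [i0 ci0 hmin] := @arg_minP _ R _ i1 (fun i => 0 < c i) (fun i => al i / c i) ci1.
pose be i := al i - al i0 / c i0 * c i.
have be0 i : 0 <= be i.
  rewrite /be subr_ge0; have [ci|ci] := ltP 0 (c i).
    by rewrite -ler_pdivlMr//; exact: hmin.
  apply: le_trans (al0 i); apply: mulr_ge0_le0 => //.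
  by rewrite divr_ge0// ltW.
have be1 : \sum_i be i = 1 by rewrite sumrB -mulr_sumr c0 mulr0 subr0.
have beu : \sum_i be i *: u i = \sum_i al i *: u i.
  rewrite /be; under eq_bigr do rewrite scalerBl -scalerA.
  by rewrite sumrB -scaler_sumr cu scaler0 subr0.
have [|//|//|ga [g1 g2 g3 g4]] := IH be.
  apply: leq_trans alN; apply: proper_card; apply/properP; split.
    apply/fintype.subsetP => i; rewrite !inE; apply: contra => /eqP ai.
    by rewrite /be ai (cS i) ?mulr0 ?subrr// inE ai eqxx.
  exists i0; rewrite inE; last by rewrite /be divfK ?subrr ?eqxx// gt_eqF.
  by apply: contraTneq ci0 => ai; rewrite (cS i0) ?ltxx// inE ai eqxx.
by exists ga; split=> //; rewrite g3.
Qed.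

End Caratheodory.

Section Cone.
Variables (R : realType) (n : nat).
Variables (U : 'M[R]_n) (c a b B : R) (gam dgam nu : R -> 'rV[R]_n) (l dl : R -> R).
Hypothesis dc : descent_curve U c a b gam dgam nu l dl.
Hypothesis B1 : 1 <= B.
Hypothesis HB : forall s t M, a <= s -> s <= t -> t <= b -> (M <= U)%MS ->
  kept s t gam nu M -> enorm (gam t - M) <= B * enorm (gam s - M).

Let dir t s : 'rV[R]_n := (enorm (gam s - gam t))^-1 *: (gam s - gam t).

Lemma kept_later r s t : a <= r -> t <= b -> s <= t -> kept r s gam nu (gam t).
Proof.
move=> ar tb st; apply: (kept_sub (lexx r) st).
exact: kept_future (descent_curve_sub ar (lexx b) dc) tb.
Qed.

(** Suppose that a positive combination of directions from [gam t] to later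
    points almost vanishes.  Then [gam t] is close to a convex combination [M]
    of these points; at the earliest time [s i0] among theirs [M] has been kept,
    so [kept_dist_le] puts [gam (s i0)] close to [gam t] as well, which bounds
    the weight of [i0].  The other weights follow by induction. *)
Lemma sum_directions_ge m (s : 'I_m -> R) t (al : 'I_m -> R) (A : {set 'I_m}) :
  a <= t -> (forall i, t <= s i <= b) -> (forall i, gam (s i) != gam t) ->
  (forall i, 0 <= al i) ->
  \sum_(i in A) al i <= (2 * B + 3) ^+ #|A| *
    enorm (\sum_(i in A) al i *: dir t (s i)).
Proof.
move=> ta hs hg al0; have [N] := ubnP #|A|; elim: N A => // N IH A; rewrite ltnS => AN.
have [->|[i1 Ai1]] := set_0Vmem A.
  by rewrite !big_set0 enorm0 mulr0.
have [i0 Ai0 hmin] := @arg_minP _ R _ i1 (fun i => i \in A) s Ai1.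
set w := \sum_(i in A) al i *: _.
pose d i := enorm (gam (s i) - gam t).
have d0 i : 0 < d i by apply: enorm_gt0; rewrite subr_eq0.
set w' := \sum_(i in (A :\ i0)%SET) al i *: dir t (s i).
have wE : w = al i0 *: dir t (s i0) + w' by rewrite /w (big_setD1 i0 Ai0).
have key : al i0 <= (B + 1) * enorm w.
  have [->|al_n0] := eqVneq (al i0) 0.
    by rewrite mulr_ge0 ?enorm_ge0//; have := B1; lra.
  have al_gt0 : 0 < al i0 by rewrite lt_def al_n0 al0.
  pose S := \sum_(i in A) al i / d i.
  have S_i0 : al i0 / d i0 <= S.
    rewrite /S (big_setD1 i0)//= lerDl sumr_ge0// => i _.
    by rewrite divr_ge0 ?al0// ltW.
  have S0 : 0 < S by apply: lt_le_trans S_i0; rewrite divr_gt0.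
  pose be i := al i / d i / S.
  have be0 i : 0 <= be i by rewrite !divr_ge0 ?al0// ltW.
  have be1 : \sum_(i in A) be i = 1 by rewrite -mulr_suml divff// gt_eqF.
  pose M := \sum_(i in A) be i *: gam (s i).
  have ME : M - gam t = S^-1 *: w.
    rewrite /M -{1}(scale1r (gam t)) -be1 scaler_suml -sumrB scaler_sumr.
    apply: eq_bigr => i _; rewrite /dir !scalerA -scalerBr; congr (_ *: _).
    by rewrite /be /d; ring.
  have [s1 s2] := andP (hs i0).
  have MU : (M <= U)%MS.
    have [h1 _ _ _ _] := dc; apply: summx_sub => i Ai; rewrite scalemx_sub// h1//.
    by have [q1 q2] := andP (hs i); rewrite q2 (le_trans ta).
  have kM : kept t (s i0) gam nu M.
    apply: kept_conv => // i Ai; have [q1 q2] := andP (hs i).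
    by apply: kept_later => //; exact: hmin.
  have h1 := HB ta s1 s2 MU kM.
  have nM : enorm (gam t - M) = S^-1 * enorm w.
    by rewrite enormB ME enormZ ger0_norm// invr_ge0 ltW.
  have h2 : d i0 <= (B + 1) * (S^-1 * enorm w).
    rewrite -nM; apply: (le_trans (enorm_tri _ M _)); rewrite (enormB M).
    by rewrite mulrDl mul1r lerD2r.
  have h3 : d i0 * S <= (B + 1) * enorm w.
    have := ler_wpM2r (ltW S0) h2.
    by rewrite (_ : _ * _ * S = (B + 1) * enorm w)//; field; rewrite gt_eqF.
  apply: le_trans h3; have := ler_wpM2l (ltW (d0 i0)) S_i0.
  by rewrite [d i0 * (_ / _)]mulrC divfK ?gt_eqF// mulrC.
have cA : #|A| = #|(A :\ i0)%SET|.+1 by rewrite (cardsD1 i0) Ai0.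
have h : \sum_(i in (A :\ i0)%SET) al i <= (2 * B + 3) ^+ #|(A :\ i0)%SET| * enorm w'.
  by apply: IH; rewrite -cA.
rewrite (big_setD1 i0)//= cA exprS.
set D := (2 * B + 3) ^+ _ in h *.
have D1 : 1 <= D by apply: exprn_ege1; have := B1; lra.
have nw' : enorm w' <= (B + 2) * enorm w.
  have -> : w' = w - al i0 *: dir t (s i0) by rewrite wE addrC addKr.
  rewrite (le_trans (enormBD _ _))// enormZ enorm_dir ?subr_eq0// mulr1.
  by rewrite ger0_norm//; lra.
have e0 := enorm_ge0 w.
have h2 := ler_wpM2l (le_trans ler01 D1) nw'.
have h3 : (B + 1) * enorm w <= D * ((B + 1) * enorm w).
  by rewrite ler_peMl// mulr_ge0//; have := B1; lra.
lra.
Qed.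

End Cone.

Lemma enorm_comb_sqr (R : realType) n (w u : 'rV[R]_n) (x : R) :
  enorm ((1 - x) *: w + x *: u) ^+ 2 =
  (1 - x) ^+ 2 * dot w w + 2 * (1 - x) * x * dot w u + x ^+ 2 * dot u u.
Proof. by rewrite enorm_sqr !dotE (dotC u w); ring. Qed.

Section ConeAxis.
Variables (R : realType) (n : nat).
Variables (U : 'M[R]_n) (c a b B : R) (gam dgam nu : R -> 'rV[R]_n) (l dl : R -> R).
Hypothesis dc : descent_curve U c a b gam dgam nu l dl.
Hypothesis B1 : 1 <= B.
Hypothesis HB : forall s t M, a <= s -> s <= t -> t <= b -> (M <= U)%MS ->
  kept s t gam nu M -> enorm (gam t - M) <= B * enorm (gam s - M).

Let dir t s : 'rV[R]_n := (enorm (gam s - gam t))^-1 *: (gam s - gam t).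

Definition dir_hull t : set 'rV[R]_n := [set w | exists m (s al : 'I_m -> R),
  [/\ forall i, t <= s i <= b, forall i, gam (s i) != gam t,
      forall i, 0 <= al i, \sum_i al i = 1 & w = \sum_i al i *: dir t (s i)]].

(** The exponent comes from Caratheodory's theorem: [n + 1] directions suffice
    to write a point of the hull. *)
Definition hull_gap : R := ((2 * B + 3) ^+ n.+1)^-1.

Lemma hull_gap_gt0 : 0 < hull_gap.
Proof. by rewrite invr_gt0 exprn_gt0//; have := B1; lra. Qed.

Lemma hull_gap_le1 : hull_gap <= 1.
Proof.
have D1 : 1 <= (2 * B + 3) ^+ n.+1 by apply: exprn_ege1; have := B1; lra.
by rewrite invf_le1// (lt_le_trans ltr01).
Qed.

Lemma dir_hull_gap t w : a <= t -> dir_hull t w -> hull_gap <= enorm w.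
Proof.
move=> at1 [m [s [al [h1 h2 h3 h4 ->]]]].
have [be [b1 b2 <- b4]] := caratheodory (fun i => dir t (s i)) h3 h4.
have D1 : 1 <= 2 * B + 3 by have := B1; lra.
have := sum_directions_ge dc B1 HB [set i | be i != 0%R]%SET at1 h1 h2 b1.
have sumE (V : nmodType) (F : 'I_m -> V) : (forall i, be i = 0 -> F i = 0) ->
    \sum_(i in [set i | be i != 0%R]%SET) F i = \sum_i F i.
  move=> hF; rewrite [RHS](bigID (fun i => be i == 0))/= [X in _ = X + _]big1 ?add0r.
    by apply: eq_bigl => i; rewrite finset.inE.
  by move=> i /eqP/hF.
rewrite !sumE; [|by move=> i ->; rewrite scale0r|by []].
rewrite b2 => h; rewrite /hull_gap -[leLHS]mulr1 ler_pdivrMl; last first.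
  by rewrite exprn_gt0// (lt_le_trans ltr01).
by apply: (le_trans h); rewrite ler_wpM2r ?enorm_ge0// ler_weXn2l.
Qed.

Lemma dir_hull_step t w s (th : R) : 0 <= th <= 1 -> dir_hull t w ->
  t <= s <= b -> gam s != gam t -> dir_hull t ((1 - th) *: w + th *: dir t s).
Proof.
move=> /andP[th0 th1] [m [s' [al [h1 h2 h3 h4 ->]]]] hs gs.
exists m.+1, (fun i => oapp s' s (unlift ord0 i)),
  (fun i => oapp (fun j => (1 - th) * al j) th (unlift ord0 i)); split.
- by move=> i; case: unliftP => [j|] _ /=.
- by move=> i; case: unliftP => [j|] _ /=.
- move=> i; case: unliftP => [j|] _ //=; apply: mulr_ge0 => //; lra.
- rewrite big_ord_recl unlift_none; under eq_bigr do rewrite liftK.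
  by rewrite /= -mulr_sumr h4 mulr1 addrC subrK.
- rewrite big_ord_recl unlift_none addrC; under [in RHS]eq_bigr do rewrite liftK.
  by congr (_ + _); rewrite scaler_sumr; apply: eq_bigr => i _ /=; rewrite scalerA.
Qed.

(** The axis is a nearly shortest vector [w] of the hull of the directions: it is
    not small, and a direction almost orthogonal to it would allow to shorten
    it by moving towards that direction.  Taking [w] nearly shortest avoids
    a compactness argument for the hull. *)
Lemma cone_axis t : a <= t -> t <= b -> exists w, enorm w <= 1 /\
  forall s, t <= s <= b ->
    hull_gap ^+ 2 / 2 * enorm (gam s - gam t) <= dot w (gam s - gam t).
Proof.
move=> at1 tb; have [[s0 [hs0 gs0]]|none] := pselect (exists s, t <= s <= b /\ gam s != gam t); last first.
  exists 0; split; first by rewrite enorm0.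
  move=> s hs; have -> : gam s = gam t.
    by apply/eqP; apply: contrapT => /negP gs; apply: none; exists s.
  by rewrite subrr enorm0 dot0r mulr0.
set de := hull_gap; have de0 : 0 < de := hull_gap_gt0; have de1 : de <= 1 := hull_gap_le1.
pose S : set R := [set enorm w ^+ 2 | w in dir_hull t].
have h0 : dir_hull t (dir t s0).
  exists 1%N, (fun=> s0), (fun=> 1); split=> // [|]; first by rewrite big_ord1.
  by rewrite big_ord1 scale1r.
have hS : has_inf S.
  split; first by exists (enorm (dir t s0) ^+ 2), (dir t s0).
  by exists 0 => _ [w _ <-]; rewrite sqr_ge0.
(* [de ^+ 4 / 16] is what a step of size [de ^+ 2 / 8] towards a direction at
   angle cosine below [de ^+ 2 / 2] would gain. *)
have dd0 : 0 < de ^+ 4 / 16 by rewrite divr_gt0// exprn_gt0.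
have [_ [w hw <-] wE] := inf_adherent dd0 hS.
have gap := dir_hull_gap at1 hw.
have ndir s : gam s != gam t -> enorm (dir t s) = 1.
  by move=> gs; rewrite enorm_dir// subr_eq0.
have nw1 : enorm w <= 1.
  case: hw => m [s [al [h1 h2 h3 h4 ->]]].
  rewrite (le_trans (enorm_sum _ _ _))// -h4 ler_sum// => i _.
  by rewrite enormZ ndir// mulr1 ger0_norm.
exists w; split=> // s hs.
have [->|gs] := eqVneq (gam s) (gam t); first by rewrite subrr enorm0 dot0r mulr0.
set u := dir t s.
have hu : de ^+ 2 / 2 <= dot w u.
  pose th := de ^+ 2 / 8.
  have dd1 : de ^+ 2 <= 1 by rewrite exprn_ile1// ltW.
  have d20 : 0 < de ^+ 2 by rewrite exprn_gt0.
  have th01 : 0 <= th <= 1 by rewrite /th; lra.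
  have h1 := dir_hull_step th01 hw hs gs.
  have : inf S <= enorm ((1 - th) *: w + th *: u) ^+ 2.
    by apply: ge_inf; [case: hS|exists ((1 - th) *: w + th *: u)].
  have u1 : dot u u = 1 by rewrite -enorm_sqr ndir// expr1n.
  have w2 : de ^+ 2 <= dot w w.
    by rewrite -enorm_sqr ler_pXn2r ?nnegrE ?enorm_ge0// ltW.
  have w1 : dot w w <= 1 by rewrite -enorm_sqr expr_le1 ?enorm_ge0.
  have wu : `|dot w u| <= 1.
    by rewrite (le_trans (dot_abs _ _))// ndir// mulr1.
  move: wE; rewrite enorm_comb_sqr u1 enorm_sqr => wE h2.
  have := wu; rewrite ler_norml => /andP[wu1 wu2].
  have th0 : 0 < th by rewrite divr_gt0.
  have e4 : de ^+ 4 / 16 = 4 * (th * th) by rewrite /th; field.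
  have h3 : 0 <= th * (2 * dot w u - 2 * dot w w + th * (dot w w - 2 * dot w u + 1) + 4 * th).
    rewrite e4 in wE; lra.
  have h4 : 0 <= 2 * dot w u - 2 * dot w w + th * (dot w w - 2 * dot w u + 1) + 4 * th.
    by rewrite -(pmulr_rge0 _ th0).
  have h5 : th * (dot w w - 2 * dot w u + 1) <= th * 4.
    by rewrite ler_pM2l//; lra.
  by rewrite /th in h4 h5; lra.
have := ler_wpM2r (enorm_ge0 (gam s - gam t)) hu.
move/le_trans; apply; rewrite /u /dir dotZr mulrAC mulVf ?mul1r//.
by rewrite gt_eqF// enorm_gt0// subr_eq0.
Qed.

End ConeAxis.

(** * The length of a descent curve *)

Section RightGrowth.
Variable R : realType.

(** The hypotheses say that the upper right derivative is not positive and that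
    no jump from the left is upward.  Downward jumps are allowed: the heights
    subtracted from the clock in [length_boundS] may jump upwards. *)
Lemma right_growth_le (u : R -> R) (a b : R) : a <= b ->
  (forall t ep, a <= t -> t < b -> 0 < ep -> exists2 de, 0 < de &
     forall s, t < s -> s < t + de -> s <= b -> u s <= u t + ep * (s - t)) ->
  (forall t ep, a < t -> t <= b -> 0 < ep -> exists2 de, 0 < de &
     forall s, t - de < s -> s <= t -> a <= s -> u t <= u s + ep) ->
  u b <= u a.
Proof.
move=> ab hR hL; suff key ep : 0 < ep -> u b <= u a + ep * (b - a).
  apply/ler_addgt0Pr => e e0.
  have ba : 0 < b - a + 1 by lra.
  have e1 : 0 < e / (b - a + 1) by rewrite divr_gt0.
  apply: (le_trans (key _ e1)); rewrite lerD2l mulrAC ler_pdivrMr//.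
  by rewrite ler_pM2l//; lra.
move=> ep0; pose S := [set t | a <= t <= b /\ u t <= u a + ep * (t - a)].
have Sa : S a by split; [rewrite lexx ab|rewrite subrr mulr0 addr0].
have hS : has_sup S by split; [exists a|exists b => t [/andP[]]].
set T := sup S.
have aT : a <= T by apply: sup_upper_bound.
have Tb : T <= b by apply: sup_le_ub; [exists a|move=> t [/andP[]]].
have uT : u T <= u a + ep * (T - a).
  have [<-|aT'] := eqVneq a T; first by rewrite subrr mulr0 addr0.
  have ltaT : a < T by rewrite lt_neqAle aT'.
  apply/ler_addgt0Pr => e e0; have [de de0 h] := hL T e ltaT Tb e0.
  have [s [/andP[s1 s2] s3] s4] := sup_adherent de0 hS.
  have sT : s <= T by apply: sup_upper_bound => //; split=> //; rewrite s1.
  apply: (le_trans (h s s4 sT s1)); rewrite lerD2r (le_trans s3)// lerD2l.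
  by rewrite ler_pM2l// lerD2r.
have [<-//|Tb'] := eqVneq T b.
have ltTb : T < b by rewrite lt_neqAle Tb'.
have [de de0 h] := hR T ep aT ltTb ep0.
pose s := Num.min (T + de / 2) b.
have s1 : T < s by rewrite lt_min ltTb andbT ltrDl divr_gt0.
have s2 : s < T + de by rewrite gt_min; apply/orP; left; lra.
have sb : s <= b by rewrite ge_min lexx orbT.
have : s <= T; last by rewrite leNgt s1.
apply: sup_upper_bound => //; split; first by rewrite sb (le_trans aT (ltW s1)).
have := h s s1 s2 sb; lra.
Qed.

Lemma is_derive_right_ge (x : R -> R) (D t ep : R) :
  is_derive t (1 : R) x D -> 0 <= D -> 0 < ep ->
  exists2 de, 0 < de & forall s, t < s -> s < t + de -> x t <= x s + ep * (s - t).
Proof.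
move=> [dx Dx] D0 ep0.
have : (fun h : R => h^-1 *: (x (h *: (1 : R) + t) - x t)) @ 0^' --> D.
  by rewrite -Dx; exact: dx.
move=> /cvgrPdist_lt/(_ ep ep0) [de /= de0 hde].
exists de => // s ts sde.
have st0 : s - t != 0 by rewrite subr_eq0 gt_eqF.
have := hde (s - t); rewrite /ball_/= sub0r normrN gtr0_norm ?subr_gt0//.
have -> : (s - t) *: (1 : R) + t = s by rewrite [_ *: _]mulr1 subrK.
have lt1 : s - t < de by lra.
move=> /(_ lt1 st0); rewrite ltr_norml => /andP[_].
rewrite [_ *: _]mulrC => h.
have : D - ep < (x s - x t) / (s - t) by lra.
rewrite ltr_pdivlMr ?subr_gt0// => h2.
have : 0 <= D * (s - t) by rewrite mulr_ge0// subr_ge0 ltW.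
lra.
Qed.

End RightGrowth.

Section LengthBound.
Variables (R : realType) (n : nat).

Lemma length_bound0 : @length_bound R n 0.
Proof.
move=> c c0 c1; exists 1; split=> // U a b gam dgam nu l dl ab rU dc k0.
have U0 : U = 0 by apply/eqP; rewrite -mxrank_eq0 -leqn0.
have [h1 h2 h3 h4 h5] := dc.
have g0 t : a <= t <= b -> gam t = 0.
  by move=> /h1; rewrite U0 submx0 => /eqP.
have gt_ge0 := enorm_ge0 (gam a).
suff : l b <= l a by lra.
apply: (@nincr_derive_cc _ l dl) => // [t /h2[]//|t /andP[t1 t2]].
have ht : a <= t <= b by rewrite !ltW.
have [hg _] := h2 t ht.
have dg0 : dgam t = 0.
  have near0 : \near t, gam t = cst 0 t.
    near=> s; rewrite g0//.
    have : s \in `]a, b[ by near: s; apply: near_in_itvoo; rewrite in_itv/= t1.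
    by rewrite in_itv/= => /andP[s1 s2]; rewrite !ltW.
  have [dg <-] := hg.
  by rewrite (near_eq_derive _ near0) ?oner_eq0// derive_cst.
have := h4 t ht; rewrite dg0 dot0r pmulr_rle0//.
Unshelve. all: by end_near. Qed.

(** By [cone_axis] each time has an axis along which the future recedes linearly,
    and up to a small error the axis can be taken in a finite net [p].  Hence
    [F], the sum over the net of the lowest heights reached in the future, never
    decreases and grows at least like the distance travelled by the curve.  As
    [F] ranges in an interval of size proportional to [|gam a|], and the clock
    runs at most [1 / c] times as fast as the curve moves along [nu], the clock
    is bounded. *)
Lemma length_boundS k : @length_bound R n k -> @length_bound R n k.+1.
Proof.
move=> Lk c c0 c1; have [B [B1 HB]] := kept_dist_le Lk c0 c1.
pose ka := @hull_gap R n B ^+ 2 / 2.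
have hg0 : 0 < hull_gap n B by exact: hull_gap_gt0.
have ka0 : 0 < ka by apply: divr_gt0 => //; exact: exprn_gt0.
have [|I [p hp]] := @unit_ball_net R n (ka / 2); first by rewrite divr_gt0.
pose pg := ka / 2 / (B + 1).
have B10 : 0 < B + 1 by lra.
have p0 : 0 < pg by apply: (divr_gt0 _ B10); exact: divr_gt0.
pose C := \sum_(j : I) (2 * B * enorm (p j)).
have C0 : 0 <= C.
  by apply: sumr_ge0 => j _; apply: mulr_ge0; [lra|exact: enorm_ge0].
exists ((C + 1) / (c * pg)); split; first by apply: divr_gt0; [lra|exact: mulr_gt0].
move=> U a b gam dgam nu l dl ab rU dc k0.
have {}HB s t M : a <= s -> s <= t -> t <= b -> (M <= U)%MS ->
    kept s t gam nu M -> enorm (gam t - M) <= B * enorm (gam s - M).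
  move=> as1 st tb MU kM.
  exact: HB st rU (descent_curve_sub as1 tb dc) MU kM.
have [h1 h2 h3 h4 h5] := dc.
have ng t : a <= t <= b -> enorm (gam t) <= B * enorm (gam a).
  move=> /andP[t1 t2]; have := HB a t 0 (lexx a) t1 t2 (sub0mx _ _).
  by rewrite !subr0; apply; exact: kept_sub k0.
pose h j t := inf [set dot (p j) (gam s) | s in [set s | t <= s <= b]].
have hlb j t : a <= t -> t <= b ->
    has_inf [set dot (p j) (gam s) | s in [set s | t <= s <= b]].
  move=> at1 tb; split; first by exists (dot (p j) (gam b)), b => //=; rewrite tb lexx.
  exists (- (enorm (p j) * (B * enorm (gam a)))) => _ [s /= /andP[s1 s2] <-].
  rewrite lerNl -dotNr (le_trans (dot_le _ _))// enormN ler_wpM2l ?enorm_ge0//.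
  by apply: ng; rewrite s2 (le_trans at1).
have hle j s t : a <= s -> s <= t -> t <= b -> h j s <= dot (p j) (gam t).
  move=> as1 st tb; apply: ge_inf; last by exists t => //=; rewrite st.
  by case: (hlb j s as1 (le_trans st tb)).
have hge j t x : a <= t -> t <= b ->
    (forall s, t <= s <= b -> x <= dot (p j) (gam s)) -> x <= h j t.
  move=> at1 tb hx; apply: lb_le_inf; first by case: (hlb j t at1 tb).
  by move=> _ [s /= hs <-]; exact: hx.
have hnd j s t : a <= s -> s <= t -> t <= b -> h j s <= h j t.
  move=> as1 st tb; apply: hge => // [|r /andP[r1 r2]]; first exact: le_trans as1 _.
  by apply: hle => //; exact: le_trans st _.
pose F t := \sum_j h j t.
have Fnd s t : a <= s -> s <= t -> t <= b -> F s <= F t.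
  by move=> as1 st tb; apply: ler_sum => j _; exact: hnd.
have Fgrow s t : a <= s -> s <= t -> t <= b ->
    pg * enorm (gam t - gam s) <= F t - F s.
  move=> as1 st tb; have sb := le_trans st tb; have at1 := le_trans as1 st.
  have [w [w1 hw]] := cone_axis dc B1 HB as1 sb.
  have [j pj] := hp w w1.
  have hj r : s <= r <= b ->
      ka / 2 * enorm (gam r - gam s) <= dot (p j) (gam r - gam s).
    move=> hr; have := hw r hr; rewrite -/ka.
    have := dot_le (w - p j) (gam r - gam s).
    have := ler_wpM2r (enorm_ge0 (gam r - gam s)) (ltW pj).
    rewrite (_ : dot (w - p j) _ = dot w (gam r - gam s) - dot (p j) (gam r - gam s)).
      lra.
    by rewrite dotDl dotNl.
  have hts : h j s + pg * enorm (gam t - gam s) <= h j t.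
    apply: hge => // r /andP[r1 r2].
    have rs : s <= r <= b by rewrite r2 (le_trans st).
    have e1 := hj r rs; have e2 := hle j s s as1 (lexx s) sb.
    have e3 : enorm (gam t - gam s) <= (B + 1) * enorm (gam r - gam s).
      have := HB s t (gam r) as1 st tb (h1 r _) (kept_later dc as1 r2 r1).
      rewrite (le_trans as1) ?r2; last by case/andP: rs.
      move=> /(_ isT) e4; have := enorm_tri (gam t) (gam r) (gam s).
      by move: e4; rewrite (enormB (gam s)); lra.
    have e5 : pg * enorm (gam t - gam s) <= ka / 2 * enorm (gam r - gam s).
      have := ler_wpM2l (ltW p0) e3; rewrite /pg.
      rewrite (_ : ka / 2 / (B + 1) * ((B + 1) * _) = ka / 2 * enorm (gam r - gam s)) //.
      by field; apply: lt0r_neq0; lra.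
    move: e1; rewrite dotDr dotNr; lra.
  rewrite /F -sumrB (bigD1 j)//= -[leLHS]addr0 lerD//; first lra.
  by apply: sumr_ge0 => i _; rewrite subr_ge0 hnd.
have Frange : F b - F a <= C * enorm (gam a).
  rewrite /F -sumrB /C mulr_suml; apply: ler_sum => j _.
  have e1 : h j b <= enorm (p j) * (B * enorm (gam a)).
    apply: (le_trans (hle j b b ab (lexx b) (lexx b))).
    by rewrite (le_trans (dot_le _ _))// ler_wpM2l ?enorm_ge0// ng// ab lexx.
  have e2 : - (enorm (p j) * (B * enorm (gam a))) <= h j a.
    apply: hge => // s hs.
    rewrite lerNl -dotNr (le_trans (dot_le _ _))// enormN ler_wpM2l ?enorm_ge0//.
    exact: ng.
  lra.
have final : pg * c * l b - F b <= pg * c * l a - F a.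
  apply: (@right_growth_le _ (fun t => pg * c * l t - F t) a b ab).
  - move=> t ep at1 tb ep0.
    have ht : a <= t <= b by rewrite at1 ltW.
    have [hg hl] := h2 t ht.
    pose x s := dot (nu t) (gam s) - c * l s.
    have dx : is_derive t (1 : R) x (dot (nu t) (dgam t) - c * dl t).
      have := is_derive_dot (is_derive_constf (nu t) t) hg; rewrite dot0l add0r => dn.
      exact: (is_derive_subf dn (is_derive_mulCf c hl)).
    have [||de de0 hde] := is_derive_right_ge (ep := ep / pg) dx.
    + by rewrite subr_ge0 h4.
    + by rewrite divr_gt0.
    exists de => // s ts sde sb.
    have e1 := hde s ts sde; have e2 := Fgrow t s at1 (ltW ts) sb.
    have e3 : dot (nu t) (gam s - gam t) <= enorm (gam s - gam t).
      rewrite (le_trans (dot_le _ _))// ler_piMl ?enorm_ge0//.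
      by have [] := h3 t ht.
    move: e1 e3; rewrite /x dotDr dotNr => e1 e3.
    have e4 : c * (l s - l t) - ep / pg * (s - t) <= enorm (gam s - gam t) by lra.
    have := ler_wpM2l (ltW p0) e4.
    rewrite mulrBr (_ : pg * (ep / pg * (s - t)) = ep * (s - t)); first lra.
    by field; rewrite gt_eqF.
  - move=> t ep at1 tb ep0.
    have ht : a <= t <= b by rewrite (ltW at1).
    have := clock_continuous dc ht.
    have cc0 : 0 < pg * c by exact: mulr_gt0.
    move=> /cvgrPdist_lt/(_ (ep / (pg * c))) [|de /= de0 hde].
      by rewrite divr_gt0.
    exists de => // s ts sde sb.
    have := hde s; rewrite /ball_/= ger0_norm ?subr_ge0//.
    have lt1 : t - s < de by lra.
    move=> /(_ lt1); rewrite ltr_norml => /andP[_ e1].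
    have := Fnd s t sb sde tb; have := ler_wpM2l (ltW cc0) (ltW e1).
    rewrite (_ : pg * c * (ep / (pg * c)) = ep); first lra.
    by field; rewrite !gt_eqF.
have cp0 : 0 < c * pg by exact: mulr_gt0.
rewrite mulrAC ler_pdivlMr//.
have := enorm_ge0 (gam a); lra.
Qed.

Theorem length_bound_all k : @length_bound R n k.
Proof. by elim: k => [|k]; [exact: length_bound0|exact: length_boundS]. Qed.

End LengthBound.

(** * Global solutions of Lipschitz differential equations *)

Section Primitive.
Variable R : realType.

Lemma primitive_exists (g : R -> R) : continuous g -> exists G : R -> R,
  G 0 = 0 /\ forall t : R, -1 < t -> is_derive t (1 : R) G (g t).
Proof.
move=> cg; pose mu := @lebesgue_measure R.
pose F x := (\int[mu]_(t in [set` `[-1, x]]) g t)%R.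
exists (fun t => F t - F 0); split; first by rewrite subrr.
move=> t t1.
have gi : mu.-integrable `[-1, t + 1] (EFin \o g).
  apply: continuous_compact_integrable; first exact: segment_compact.
  exact: continuous_subspaceT.
have [|dF FE] := @continuous_FTC1_closed R g (-1) t (t + 1) _ gi t1 (cg t).
  by rewrite ltrDl.
have dFt : is_derive t (1 : R) F (g t) by apply: DeriveDef; [exact: dF|rewrite -derive1E; exact: FE].
by rewrite -(subr0 (g t)); exact: (is_derive_subf dFt (is_derive_constf (F 0) t)).
Qed.

End Primitive.

Section Picard.
Variable R : realType.

Lemma geometric_limit (u : nat -> R) (D : R) :
  (forall k, `|u k.+1 - u k| <= D / 2 ^+ k) ->
  exists l, forall k, `|u k - l| <= 2 * D / 2 ^+ k.
Proof.
move=> hu; pose e k := 2 * D / 2 ^+ k.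
have eS k : e k - e k.+1 = D / 2 ^+ k.
  by rewrite /e exprS; field; rewrite expf_neq0.
have D0 : 0 <= D by have := hu 0%N; rewrite expr0 divr1; apply: le_trans.
have e0 k : 0 <= e k by rewrite divr_ge0 ?mulr_ge0 ?exprn_ge0.
have am : {homo (fun k => u k - e k) : i j / (i <= j)%N >-> i <= j}.
  apply: homo_leq => // [x y z|k]; first exact: le_trans.
  have := hu k; rewrite ler_norml -eS => /andP[? ?]; lra.
have bm : {homo (fun k => - (u k + e k)) : i j / (i <= j)%N >-> i <= j}.
  apply: homo_leq => // [x y z|k]; first exact: le_trans.
  have := hu k; rewrite ler_norml -eS => /andP[? ?]; lra.
have ab i j : u i - e i <= u j + e j.
  have := am _ _ (leq_maxl i j); have := bm _ _ (leq_maxr i j).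
  have := e0 (maxn i j); lra.
pose S := [set u i - e i | i in [set: nat]].
have hS : has_sup S.
  by split; [exists (u 0%N - e 0%N), 0%N|exists (u 0%N + e 0%N) => _ [i _ <-]].
exists (sup S) => k; rewrite -/(e k) ler_norml; apply/andP; split.
  have : sup S <= u k + e k by apply: sup_le_ub => [|_ [i _ <-]//]; case: hS.
  lra.
have : u k - e k <= sup S by apply: sup_upper_bound => //; exists k.
lra.
Qed.

Lemma le_geometric (x y E : R) :
  (forall k, x <= y + E / 2 ^+ k) -> x <= y.
Proof.
move=> h; apply/ler_addgt0Pr => e e0.
have [E0|E0] := leP E 0.
  by apply: (le_trans (h 0%N)); rewrite expr0 divr1 lerD2l (le_trans E0)// ltW.
pose N := Num.bound (E / e).
have hN : E / e < N%:R by apply: archi_boundP; rewrite divr_ge0// ltW.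
apply: (le_trans (h N)); rewrite lerD2l ler_pdivrMr ?exprn_gt0// mulrC -ler_pdivrMr//.
apply: (le_trans (ltW hN)); rewrite -natrX ler_nat ltnW//.
exact: ltn_expl.
Qed.

Variable n : nat.

Lemma norm_growth (X D : R -> 'rV[R]_n) (w w' : R -> R) (S T : R) : S <= T ->
  (forall t, S <= t <= T -> is_derive t (1 : R) X (D t)) ->
  (forall t, S <= t <= T -> is_derive t (1 : R) w (w' t)) ->
  (forall t, S <= t <= T -> `|D t| <= w' t) ->
  `|X T - X S| <= w T - w S.
Proof.
move=> T0 dX dw hD.
have sub t : S < t < T -> S <= t <= T by move=> /andP[? ?]; rewrite !ltW.
have key (s : bool) i : (-1) ^+ s * (X T 0 i - X S 0 i) <= w T - w S.
  have := @nincr_derive_cc _ (fun t => (-1) ^+ s * X t 0 i - w t)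
    (fun t => (-1) ^+ s * D t 0 i - w' t) S T T0.
  have h1 t : S <= t <= T -> is_derive t (1 : R)
      (fun t => (-1) ^+ s * X t 0 i - w t) ((-1) ^+ s * D t 0 i - w' t).
    move=> ht; have hx := is_derive_coord i (dX t ht).
    exact: (is_derive_subf (is_derive_mulCf ((-1) ^+ s) hx) (dw t ht)).
  move=> /(_ h1) h2; have : (-1) ^+ s * X T 0 i - w T <= (-1) ^+ s * X S 0 i - w S.
    apply: h2 => t /sub ht; rewrite subr_le0 (le_trans _ (hD t ht))//.
    apply: (le_trans (ler_norm _)); rewrite normrM normrX normrN1 expr1n mul1r.
    exact: coord_le_norm.
  lra.
apply: norm_le_coord => [|i].
  have := nincr_derive_cc (u := fun t => - w t) (u' := fun t => - w' t) T0.
  have h1 t : S <= t <= T -> is_derive t (1 : R) (fun t => - w t) (- w' t).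
    by move=> /dw; exact: is_deriveN.
  move=> /(_ h1) h2; suff : - w T <= - w S by lra.
  by apply: h2 => t /sub ht; rewrite oppr_le0 (le_trans _ (hD t ht)).
rewrite !mxE ler_norml; have := key false i; have := key true i.
by rewrite expr0 expr1; lra.
Qed.

Lemma vector_primitive_exists (g : R -> 'rV[R]_n) : continuous g ->
  exists G : R -> 'rV[R]_n, G 0 = 0 /\
    forall t : R, -1 < t -> is_derive t (1 : R) G (g t).
Proof.
move=> cg.
have h i : exists G : R -> R, G 0 = 0 /\
    forall t : R, -1 < t -> is_derive t (1 : R) G (g t 0 i).
  apply: primitive_exists => t.
  apply: (@continuous_comp _ _ _ g (fun v : 'rV[R]_n => v 0 i)); first exact: cg.
  exact: coord_continuous.
pose G i := projT1 (cid (h i)).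
have hG i : G i 0 = 0 /\ forall t : R, -1 < t -> is_derive t (1 : R) (G i) (g t 0 i).
  exact: projT2 (cid (h i)).
exists (fun t => \row_i G i t); split.
  by apply/rowP => i; rewrite !mxE; have [] := hG i.
move=> t t1; apply: is_derive_rowP => i.
rewrite (_ : (fun s => _) = G i); last by apply/funext => s; rewrite mxE.
by have [_ hGi] := hG i; exact: hGi.
Qed.

Variables (Fld : 'rV[R]_n -> 'rV[R]_n) (K M : R).
Hypothesis K0 : 0 < K.
Hypothesis FldL : forall x y, `|Fld x - Fld y| <= K * `|x - y|.
Hypothesis FldM : forall x, `|Fld x| <= M.
Variable x0 : 'rV[R]_n.

Let pos (t : R) := Num.max t 0.

Let pos_cont : continuous pos.
Proof. by move=> t; apply: continuous_max => //; exact: cst_continuous. Qed.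

Let Fld_cont : continuous Fld.
Proof.
move=> x; apply/(@cvgrPdist_lt _ _ _ _ (nbhs_filter (x : 'rV[R]_n : normedModType R))) => e e0; near=> y.
apply: (le_lt_trans (FldL _ _)); rewrite mulrC -ltr_pdivlMr//; near: y.
apply/nbhs_ballP; exists (e / K) => /=; first by rewrite divr_gt0.
by move=> y; rewrite -ball_normE.
Unshelve. all: by end_near. Qed.

Let step (X : R -> 'rV[R]_n) : R -> 'rV[R]_n :=
  match pselect (continuous (fun t => Fld (X (pos t)))) with
  | left h => fun t => x0 + projT1 (cid (vector_primitive_exists h)) t
  | right _ => fun=> x0
  end.

Let stepP X : continuous (fun t => X (pos t)) ->
  step X 0 = x0 /\
  forall t : R, -1 < t -> is_derive t (1 : R) (step X) (Fld (X (pos t))).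
Proof.
move=> cX; rewrite /step; case: pselect => [h|[]]; last first.
  by move=> t; apply: continuous_comp; [exact: cX|exact: Fld_cont].
have [G0 dG] := projT2 (cid (vector_primitive_exists h)).
split; first by rewrite G0 addr0.
move=> t t1; rewrite -(add0r (Fld _)).
exact: (is_derive_addf (is_derive_constf x0 t) (dG t t1)).
Qed.

Let iterate k := iter k step (fun=> x0).

Let step_cont X : continuous (fun t => X (pos t)) ->
  continuous (fun t => step X (pos t)).
Proof.
move=> /stepP[_ h] t; apply: continuous_comp; first exact: pos_cont.
apply: is_derive_continuous; apply: h.
by rewrite /pos lt_max ltrN10 orbT.
Qed.

Let iterate_cont k : continuous (fun t => iterate k (pos t)).
Proof. by elim: k => [|k]; [move=> t; exact: cst_continuous|exact: step_cont]. Qed.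

Let iterate_derive k (t : R) : 0 <= t ->
  is_derive t (1 : R) (iterate k.+1) (Fld (iterate k t)).
Proof.
move=> t0; have [_ h] := stepP (@iterate_cont k).
by rewrite -{2}(max_l t0); apply: h; rewrite (lt_le_trans _ t0)// ltrN10.
Qed.

Let iterate0 k : iterate k 0 = x0.
Proof. by case: k => [//|k]; have [] := stepP (@iterate_cont k). Qed.

Let weight_derive (C t : R) : is_derive t (1 : R)
  (fun s => C / 2 * expR (2 * K * s)) (K * C * expR (2 * K * t)).
Proof.
rewrite (_ : K * C * _ = C / 2 * (expR (2 * K * t) * (2 * K * 1))); last by field.
exact: (is_derive_mulCf (C / 2) (is_derive_expf (is_derive_mulCf (2 * K) (is_derive_id _ _)))).
Qed.

(** In the supremum norm weighted by [expR (- 2 K t)] the Picard operator contracts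
    by the factor [1 / 2] on the whole half-line, so the iterates converge
    without any restriction on time. *)
Let contraction (X Y : R -> 'rV[R]_n) (C T : R) : 0 <= T -> 0 <= C -> X 0 = Y 0 ->
  forall X1 Y1 : R -> 'rV[R]_n,
  (forall t : R, 0 <= t -> is_derive t (1 : R) X (Fld (X1 t))) ->
  (forall t : R, 0 <= t -> is_derive t (1 : R) Y (Fld (Y1 t))) ->
  (forall t : R, 0 <= t -> `|X1 t - Y1 t| <= C * expR (2 * K * t)) ->
  `|X T - Y T| <= C / 2 * expR (2 * K * T).
Proof.
move=> T0 C0 XY X1 Y1 dX dY h.
have := @norm_growth (fun t => X t - Y t) (fun t => Fld (X1 t) - Fld (Y1 t))
  (fun s => C / 2 * expR (2 * K * s)) (fun t => K * C * expR (2 * K * t)) 0 T T0.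
rewrite XY subrr subr0 mulr0 expR0 mulr1 => H.
have : C / 2 * expR (2 * K * T) - C / 2 <= C / 2 * expR (2 * K * T) by lra.
apply: le_trans; apply: H => t /andP[t0 _].
- exact: (is_derive_subf (dX t t0) (dY t t0)).
- exact: weight_derive.
- by rewrite (le_trans (FldL _ _))// -mulrA ler_pM2l// h.
Qed.

Lemma picard_global : exists X : R -> 'rV[R]_n, X 0 = x0 /\
  forall t : R, 0 <= t -> is_derive t (1 : R) X (Fld (X t)).
Proof.
have M0 : 0 <= M := le_trans (normr_ge0 _) (FldM 0).
pose C := M / (2 * K).
have C0 : 0 <= C by rewrite divr_ge0// mulr_ge0// ltW.
have lip k s t : 0 <= s -> s <= t -> `|iterate k t - iterate k s| <= M * (t - s).
  move=> s0 st; case: k => [|k]; first by rewrite subrr normr0 mulr_ge0// subr_ge0.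
  have := @norm_growth (iterate k.+1) (fun r => Fld (iterate k r))
    (fun r => M * r) (fun=> M) s t st; rewrite mulrBr; apply=> // r /andP[r0 _].
    by apply: iterate_derive; exact: le_trans r0.
  rewrite -[M in is_derive _ _ _ M]mulr1.
  exact: (is_derive_mulCf M (is_derive_id _ _)).
have diff k (t : R) : 0 <= t ->
    `|iterate k.+1 t - iterate k t| <= C * expR (2 * K * t) / 2 ^+ k.
  elim: k t => [|k IH] t t0.
    rewrite (_ : iterate 0 t = iterate 1 0); last by rewrite (iterate0 1).
    rewrite expr0 divr1.
    have := lip 1%N 0 t (lexx 0) t0; rewrite subr0 => h1; apply: (le_trans h1).
    have h2 := expR_ge1Dx (2 * K * t).
    have := ler_wpM2l C0 h2; rewrite mulrDr (_ : C * (2 * K * t) = M * t); first lra.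
    by rewrite /C; field; rewrite gt_eqF.
  have := @contraction (iterate k.+2) (iterate k.+1) (C / 2 ^+ k) t t0 _ _
    (iterate k.+1) (iterate k) (@iterate_derive k.+1) (@iterate_derive k) _.
  rewrite exprS (_ : C / 2 ^+ k / 2 * _ = C * expR (2 * K * t) / (2 * 2 ^+ k)); last first.
    by field; rewrite expf_neq0.
  apply; first by rewrite divr_ge0// exprn_ge0.
    by rewrite !iterate0.
  by move=> r r0; apply: (le_trans (IH r r0)); rewrite mulrAC.
have lim (t : R) i : exists l, forall k, 0 <= t ->
    `|iterate k t 0 i - l| <= 2 * (C * expR (2 * K * t)) / 2 ^+ k.
  have [t0|t0] := leP 0 t; last by exists 0.
  have [|l hl] := @geometric_limit (fun k => iterate k t 0 i) (C * expR (2 * K * t)).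
    move=> k; apply: le_trans (diff k t t0).
    by have := coord_le_norm (iterate k.+1 t - iterate k t) i; rewrite !mxE.
  by exists l => k _; exact: hl.
pose Y (t : R) : 'rV[R]_n := \row_i projT1 (cid (lim t i)).
have hY k (t : R) : 0 <= t -> `|iterate k t - Y t| <= 2 * (C * expR (2 * K * t)) / 2 ^+ k.
  move=> t0; apply: norm_le_coord => [|i].
    apply: divr_ge0; last exact: exprn_ge0.
    by apply: mulr_ge0 => //; apply: mulr_ge0 => //; exact: expR_ge0.
  by rewrite !mxE; exact: (projT2 (cid (lim t i)) k t0).
have Ylip s t : 0 <= s -> s <= t -> `|Y t - Y s| <= M * (t - s).
  move=> s0 st; have t0 := le_trans s0 st.
  apply: (@le_geometric _ _ (2 * (C * expR (2 * K * t)) + 2 * (C * expR (2 * K * s)))) => k.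
  have -> : Y t - Y s = - (iterate k t - Y t) + (iterate k t - iterate k s) + (iterate k s - Y s).
    by rewrite opprB subrKA subrKA.
  have := lip k s t s0 st; have := hY k s s0; have := hY k t t0.
  have := ler_normD (- (iterate k t - Y t) + (iterate k t - iterate k s)) (iterate k s - Y s).
  have := ler_normD (- (iterate k t - Y t)) (iterate k t - iterate k s).
  rewrite normrN mulrDl; lra.
have Ycont : continuous (fun t => Y (pos t)).
  have pl (s t : R) : s <= t -> `|Y (pos t) - Y (pos s)| <= M * `|t - s|.
    move=> st; have p1 : 0 <= pos s by rewrite le_max lexx orbT.
    have p2 : pos s <= pos t by rewrite ge_max !le_max st lexx orbT.
    apply: (le_trans (Ylip _ _ p1 p2)); apply: ler_wpM2l => //.
    rewrite ger0_norm ?subr_ge0// /pos /Num.max.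
    by case: ltP => h1; case: ltP => h2; lra.
  have pl2 (s t : R) : `|Y (pos t) - Y (pos s)| <= M * `|t - s|.
    have [st|/ltW ts] := leP s t; first exact: pl.
    by rewrite distrC (distrC t); exact: pl.
  move=> t; apply/cvgrPdist_lt => e e0; near=> s.
  apply: (le_lt_trans (pl2 _ _)).
  apply: (@le_lt_trans _ _ ((M + 1) * `|t - s|)); first by rewrite ler_wpM2r// lerDl.
  rewrite mulrC -ltr_pdivlMr ?ltr_wpDl//; near: s.
  apply/nbhs_ballP; exists (e / (M + 1)) => /=; first by rewrite divr_gt0// ltr_wpDl.
  by [].
have [X0 dX] := stepP Ycont.
have dX' (t : R) : 0 <= t -> is_derive t (1 : R) (step Y) (Fld (Y t)).
  by move=> t0; rewrite -{2}(max_l t0); apply: dX; rewrite (lt_le_trans _ t0)// ltrN10.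
have XY (t : R) : 0 <= t -> step Y t = Y t.
  move=> t0; apply/eqP; rewrite -subr_eq0 -normr_le0.
  apply: (@le_geometric _ _ (3 * (C * expR (2 * K * t)))) => k; rewrite add0r.
  have h1 := hY k.+1 t t0.
  have c1 : 0 <= 2 * C / 2 ^+ k by apply: divr_ge0; [exact: mulr_ge0|exact: exprn_ge0].
  have c2 : iterate k.+1 0 = step Y 0 by rewrite iterate0 X0.
  have c3 r : 0 <= r -> `|iterate k r - Y r| <= 2 * C / 2 ^+ k * expR (2 * K * r).
    by move=> r0; apply: (le_trans (hY k r r0)); rewrite mulrA mulrAC.
  have h2 := @contraction (iterate k.+1) (step Y) _ t t0 c1 c2 (iterate k) Y
    (@iterate_derive k) dX' c3.
  have -> : step Y t - Y t = - (iterate k.+1 t - step Y t) + (iterate k.+1 t - Y t).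
    by rewrite opprB subrKA.
  apply: (le_trans (ler_normD _ _)); rewrite normrN.
  have e2 : 2 ^+ k.+1 = 2 * 2 ^+ k :> R by rewrite exprS.
  have k0 : 2 ^+ k != 0 :> R by rewrite expf_neq0.
  rewrite e2 in h1.
  rewrite (_ : 2 * C / 2 ^+ k / 2 * _ = C * expR (2 * K * t) / 2 ^+ k) in h2; last by field.
  rewrite (_ : 2 * (C * _) / _ = C * expR (2 * K * t) / 2 ^+ k) in h1; last by field.
  have := mulr_ge0 C0 (expR_ge0 (2 * K * t)).
  have : 0 <= (2 ^+ k)^-1 :> R by rewrite invr_ge0 exprn_ge0.
  move=> q1 q2; have := mulr_ge0 q2 q1; lra.
exists (step Y); split=> // t t0; rewrite XY//; exact: dX'.
Unshelve. all: by end_near. Qed.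

End Picard.

(** * Differentials and Gram matrices *)

Section Differentials.
Variable R : realType.

Lemma is_derive_comp_curve n (W : normedModType R) (g : 'rV[R]_n -> W)
    (x : R -> 'rV[R]_n) (dx : 'rV[R]_n) (t : R) :
  differentiable g (x t) -> is_derive t (1 : R) x dx ->
  is_derive t (1 : R) (fun s => g (x s)) ('D_dx g (x t)).
Proof.
move=> dg [/derivable1_diffP dex <-].
have dgx : differentiable (g \o x) t by exact: differentiable_comp.
apply: DeriveDef; first exact/derivable1_diffP.
rewrite deriveE// diff_comp//= deriveE//.
by rewrite -(deriveE _ dex).
Qed.

Lemma derive_grad n (f : 'rV[R]_n -> R) x v : differentiable f x ->
  'D_v f x = dot (grad f x) v.
Proof.
move=> df; rewrite deriveE// {1}(row_sum_delta v) linear_sum/=.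
apply: eq_bigr => i _; rewrite linearZ/= mxE deriveE// mulrC.
by [].
Qed.

Lemma derive_chain n k (W : normedModType R) (F : 'rV[R]_k -> W)
    (g : 'rV[R]_n -> 'rV[R]_k) x v :
  differentiable g x -> differentiable F (g x) ->
  'D_v (fun z => F (g z)) x = 'D_('D_v g x) F (g x).
Proof.
move=> dg dF; have dFg : differentiable (F \o g) x by exact: differentiable_comp.
by rewrite deriveE// diff_comp//= deriveE// deriveE.
Qed.

Lemma elipschitz_derive n k (L : R) (g : 'rV[R]_n -> 'rV[R]_k) x v :
  differentiable g x -> elipschitz L g -> enorm ('D_v g x) <= L * enorm v.
Proof.
move=> dg Lg; have : derivable g x v by exact: diff_derivable.
rewrite /derivable -/('D_v g x) => cv.
have ce : enorm (h^-1 *: ((g \o shift x) (h *: v) - g x)) @[h --> (0 : R)^'] -->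
    enorm ('D_v g x).
  by apply: continuous_cvg; [exact: enorm_continuous|exact: cv].
have -> : enorm ('D_v g x) = lim (enorm (h^-1 *: ((g \o shift x) (h *: v) - g x)) @[h --> (0 : R)^']).
  by apply/esym/cvg_lim.
apply: limr_le; first by apply/cvg_ex; exists (enorm ('D_v g x)).
near=> h; have h0 : h != 0 by near: h; exact: nbhs_dnbhs_neq.
rewrite enormZ normfV ler_pdivrMl ?normr_gt0//=.
by apply: (le_trans (Lg _ _)); rewrite addrK enormZ mulrCA.
Unshelve. all: by end_near. Qed.

Lemma jacobian_row_mx n m k (h : 'rV[R]_n -> 'rV[R]_m) (q : 'rV[R]_n -> 'rV[R]_k) x v :
  differentiable h x -> differentiable q x -> differentiable (coords h q) x ->
  'D_v (coords h q) x = row_mx ('D_v h x) ('D_v q x).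
Proof.
move=> dh dq dc; have dh1 := @diff_derivable _ _ _ _ _ v dh.
have dq1 := @diff_derivable _ _ _ _ _ v dq.
rewrite derive_mx; last exact: diff_derivable.
rewrite (derive_mx dh1) (derive_mx dq1); apply/rowP => j; rewrite mxE.
case: (split_ordP j) => i ->; rewrite ?row_mxEl ?row_mxEr mxE.
  by congr ('D_v _ x); apply/funext => y; rewrite /coords row_mxEl.
by congr ('D_v _ x); apply/funext => y; rewrite /coords row_mxEr.
Qed.

Lemma embed_differentiable m k (e : 'rV[R]_k) :
  differentiable (fun e : 'rV[R]_k => row_mx (0 : 'rV[R]_m) e) e.
Proof.
pose M : 'M[R]_(k, m + k) := row_mx 0 1%:M.
have -> : (fun e : 'rV[R]_k => row_mx (0 : 'rV[R]_m) e) = mulmxr M.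
  by apply/funext => v; rewrite /= /M mul_mx_row mulmx0 mulmx1.
apply: linear_differentiable => v.
apply/(@cvgrPdist_lt _ _ _ _ (nbhs_filter (v : 'rV[R]_k : normedModType R))) => d d0.
near=> w.
rewrite -linearB/= mul_mx_row mulmx0 mulmx1.
apply: (@le_lt_trans _ _ `|v - w|).
  apply: norm_le_coord => // i; case: (split_ordP i) => j ->.
    by rewrite row_mxEl mxE normr0.
  by rewrite row_mxEr; exact: coord_le_norm.
near: w; apply/nbhs_ballP; exists d => //=.
by move=> w; rewrite -ball_normE.
Unshelve. all: by end_near. Qed.

Lemma derive_embed m k (e v : 'rV[R]_k) :
  'D_v (fun e : 'rV[R]_k => row_mx (0 : 'rV[R]_m) e) e = row_mx 0 v.
Proof.
pose M : 'M[R]_(k, m + k) := row_mx 0 1%:M.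
have E : (fun e : 'rV[R]_k => row_mx (0 : 'rV[R]_m) e) = mulmxr M.
  by apply/funext => w; rewrite /= /M mul_mx_row mulmx0 mulmx1.
have : derivable (fun e : 'rV[R]_k => row_mx (0 : 'rV[R]_m) e) e v.
  by apply: diff_derivable; exact: embed_differentiable.
rewrite /derive => _.
apply: cvg_lim => //; apply: cvg_near_cst; near=> d.
have d0 : d != 0 by near: d; exact: nbhs_dnbhs_neq.
rewrite /= -[row_mx _ (_ + e)]add0r opp_row_mx add0r add_row_mx addrK subr0.
by rewrite scale_row_mx scaler0 scalerA mulVf// scale1r.
Unshelve. all: by end_near. Qed.

End Differentials.

Section Psd.
Variables (R : realType) (k : nat).

Lemma psd_gap (A : 'M[R]_k) a (v : 'rV[R]_k) : psd (A - a%:M) ->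
  a * dot v v <= dot (v *m A) v.
Proof.
move=> [_ /(_ v)]; rewrite dot_mx mulmxBr mul_mx_scalar dotDl dotNl dotZl.
by rewrite subr_ge0.
Qed.

Lemma psd_gap_unit (A : 'M[R]_k) a : 0 < a -> psd (A - a%:M) -> A \in unitmx.
Proof.
move=> a0 hA; rewrite -row_free_unit; apply: inj_row_free => v vA.
apply: enorm_eq0; apply/eqP; rewrite -sqrf_eq0 enorm_sqr eq_le dot_ge0 andbT.
by rewrite -(pmulr_rle0 _ a0) (le_trans (psd_gap v hA))// vA dot0l.
Qed.

End Psd.

Section Gram.
Variables (R : realType) (n k : nat) (g : 'rV[R]_n -> 'rV[R]_k) (x : 'rV[R]_n).

Lemma gramT : (gram g x)^T = gram g x.
Proof. by rewrite /gram trmx_mul trmxK. Qed.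

Lemma enorm_mulmx_jacobianT L v : differentiable g x -> elipschitz L g ->
  0 <= L -> enorm (v *m ('J g x)^T) <= L * enorm v.
Proof.
move=> dg Lg L0; set w := v *m _.
have [->|w0] := eqVneq w 0; first by rewrite enorm0 mulr_ge0 ?enorm_ge0.
have nw := enorm_gt0 w0; rewrite -(ler_pM2l nw) -expr2 enorm_sqr.
rewrite {1}/w dot_mulmx trmxK (le_trans (dot_le _ _))// -deriveEjacobian//.
have := ler_wpM2l (enorm_ge0 v) (elipschitz_derive w dg Lg); lra.
Qed.

Lemma enorm_mulmx_gram L v : differentiable g x -> elipschitz L g ->
  0 <= L -> enorm (v *m gram g x) <= L ^+ 2 * enorm v.
Proof.
move=> dg Lg L0; rewrite /gram mulmxA -deriveEjacobian//.
apply: (le_trans (elipschitz_derive _ dg Lg)).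
by rewrite expr2 -mulrA ler_wpM2l// enorm_mulmx_jacobianT.
Qed.

End Gram.

(** * The quadratic energy of the multiplier block *)

Section PILyapunov.
Variables (R : realType) (m : nat) (mlow a kap : R) (G : 'M[R]_m).
Hypothesis mlow0 : 0 < mlow.
Hypothesis mlow_a : mlow <= a.
Hypothesis kap0 : 0 < kap.
Hypothesis kap_mlow : kap < mlow.
Hypothesis GT : G^T = G.
Hypothesis G_gap : forall v : 'rV[R]_m, mlow * dot v v <= dot (v *m G) v.
Hypothesis G_norm : forall v : 'rV[R]_m, enorm (v *m G) <= a * enorm v.

(** In the time unit [1 / kp], with [kap = ki / kp ^+ 2], the multiplier block is
    [w' = (p - w) G + kap (w - z)], [z' = kap (w - z)].  For [p = 0] the
    first two terms of [piU] decrease along it, but the decrease degenerates in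
    [w] when [kap] approaches [mlow]; the cross term, of weight [pi_delta], restores it and makes
    [pi_rate] independent of [kap]. *)
Definition pi_delta : R := mlow / (8 * a).
Local Notation de := pi_delta.
Definition pi_rate : R := de * mlow / 18.
Definition pi_gain : R := a ^+ 2 / (de * mlow / 9).

Definition piU (w z : 'rV[R]_m) : R :=
  dot w w / 2 + mlow / (2 * kap) * dot z z - de * dot w z.

(** The derivative of [piU] when [w] and [z] move with velocities [dw] and [dz]. *)
Definition piU' (w z dw dz : 'rV[R]_m) : R :=
  dot w dw + mlow / kap * dot z dz - de * (dot dw z + dot w dz).

Let a0 : 0 < a. Proof. exact: lt_le_trans mlow0 mlow_a. Qed.
Let de0 : 0 < de. Proof. by rewrite divr_gt0// mulr_gt0. Qed.
Let de_a : de * a = mlow / 8. Proof. by rewrite /de; field; rewrite gt_eqF. Qed.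
Let de1 : de <= 1 / 8.
Proof. by rewrite -(ler_pM2r a0) de_a; have := mlow_a; lra. Qed.

Lemma pi_rate_gt0 : 0 < pi_rate.
Proof. by rewrite divr_gt0// mulr_gt0. Qed.

Lemma pi_gain_gt0 : 0 < pi_gain.
Proof. by rewrite !divr_gt0// ?exprn_gt0// mulr_gt0. Qed.

Lemma dot_wz (w z : 'rV[R]_m) (s : R) :
  2 * s * dot w z <= s ^+ 2 * dot w w + dot z z.
Proof.
have := dot_ge0 (s *: w - z); rewrite !dotE (dotC z w); lra.
Qed.

Lemma piU_ge w z : (dot w w + dot z z) / 4 <= piU w z.
Proof.
have h1 : 1 <= mlow / kap by rewrite ler_pdivlMr// mul1r ltW.
have h2 := ler_wpM2r (dot_ge0 z) h1.
have h3 := dot_wz w z 1; rewrite expr1n in h3.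
have wz : dot w z <= (dot w w + dot z z) / 2 by lra.
have h4 := ler_wpM2l (ltW de0) wz.
have s0 : 0 <= dot w w + dot z z by rewrite addr_ge0 ?dot_ge0.
have h5 := ler_wpM2r s0 de1.
rewrite /piU (_ : mlow / (2 * kap) = mlow / kap / 2); last by field; rewrite gt_eqF.
lra.
Qed.

Lemma piU_le w z : piU w z <= (1 + mlow / kap) * (dot w w + dot z z).
Proof.
have h1 : 1 <= mlow / kap by rewrite ler_pdivlMr// mul1r ltW.
have h3 := dot_wz w z (-1).
have wz : - dot w z <= (dot w w + dot z z) / 2 by lra.
have h4 := ler_wpM2l (ltW de0) wz.
have s0 : 0 <= dot w w + dot z z by rewrite addr_ge0 ?dot_ge0.
have h5 := ler_wpM2r s0 de1.
have h6 := ler_wpM2r (dot_ge0 w) h1; have h7 := ler_wpM2r (dot_ge0 z) h1.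
rewrite /piU (_ : mlow / (2 * kap) = mlow / kap / 2); last by field; rewrite gt_eqF.
have := dot_ge0 w; have := dot_ge0 z; lra.
Qed.

(** The gap of [G] is used twice: for [w], and for [w - de z], which turns the
    product of [w G] and [z] into squares. *)
Lemma piU_decay (w z p : 'rV[R]_m) :
  piU' w z ((p - w) *m G + kap *: (w - z)) (kap *: (w - z)) <=
  - (pi_rate * (dot w w + dot z z)) + pi_gain * dot p p.
Proof.
set P := p *m G.
have GC u v : dot (u *m G) v = dot (v *m G) u by rewrite dot_mulmx GT dotC.
have PP : dot P P <= a ^+ 2 * dot p p.
  rewrite -!enorm_sqr -exprMn; apply: lerXn2r; rewrite ?nnegrE ?enorm_ge0 ?G_norm//.
  by apply: mulr_ge0; [exact: ltW|exact: enorm_ge0].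
have -> : piU' w z ((p - w) *m G + kap *: (w - z)) (kap *: (w - z)) =
    - dot (w *m G) w + kap * dot w w + (mlow - kap) * dot w z +
    (de * kap - mlow) * dot z z - de * kap * dot w w + de * dot (w *m G) z +
    (dot P w - de * dot P z).
  rewrite /piU' mulmxBl -/P !dotE (dotC z w) (dotC w P) (dotC w (w *m G)).
  by field; rewrite gt_eqF.
have F1 := G_gap w.
have F2 : dot (z *m G) z <= a * dot z z.
  rewrite (le_trans (dot_le _ _))// -enorm_sqr expr2 mulrA.
  by rewrite ler_wpM2r ?enorm_ge0.
have F3 : kap * dot (w - de *: z) (w - de *: z) <=
    dot ((w - de *: z) *m G) (w - de *: z).
  apply: le_trans (G_gap _); by rewrite ler_wpM2r ?dot_ge0// ltW.
rewrite mulmxBl -scalemxAl !dotE (dotC z w) (GC z w) in F3.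
have F4 := dot_wz w z (8 / 9).
pose y := (mlow - kap) / 2 + de * kap.
pose x := mlow - kap + de * kap.
have dk : 0 < de * kap by rewrite mulr_gt0.
have dk1 : de * kap <= mlow / 8.
  have h1 := ler_wpM2r (ltW kap0) de1; have := kap_mlow; lra.
have d2 : de * (de * a) <= mlow / 64.
  by rewrite de_a; have := ler_wpM2r (ltW mlow0) de1; lra.
have yge : de * mlow <= y.
  have h0 : 0 <= (mlow - kap) * (1 / 2 - de).
    by apply: mulr_ge0; [have := kap_mlow; lra|have := de1; lra].
  by rewrite /y; lra.
have yle : y <= mlow / 2.
  have h0 : 0 <= kap * (1 / 2 - de).
    by apply: mulr_ge0; [exact: ltW|have := de1; lra].
  by rewrite /y; lra.
have y0 : 0 < y by apply: lt_le_trans yge; rewrite mulr_gt0.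
have x0 : 0 <= x by rewrite /x; have := kap_mlow; lra.
have xy : x <= 2 * y by rewrite /x /y; lra.
have ww0 := dot_ge0 w; have zz0 := dot_ge0 z.
have G1 : x * dot w z <= y * (8 / 9 * dot w w + 9 / 8 * dot z z).
  have h1 : dot w z <= (8 / 9 * dot w w + 9 / 8 * dot z z) / 2 by lra.
  have h2 := ler_wpM2l x0 h1.
  have h3 : 0 <= (8 / 9 * dot w w + 9 / 8 * dot z z) / 2 by lra.
  have := ler_wpM2r h3 xy; lra.
have G2 : de ^+ 2 * dot (z *m G) z <= mlow / 64 * dot z z.
  have h1 := ler_wpM2l (sqr_ge0 de) F2; have h2 := ler_wpM2r zz0 d2; lra.
have G3 : 0 <= de ^+ 2 * kap * dot z z.
  by apply: mulr_ge0 => //; apply: mulr_ge0; [exact: sqr_ge0|exact: ltW].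
have G4 := ler_wpM2r zz0 dk1.
have G5 := ler_wpM2r zz0 yle.
have G6 := ler_wpM2r ww0 yge.
have main : - dot (w *m G) w + kap * dot w w + (mlow - kap) * dot w z +
    (de * kap - mlow) * dot z z - de * kap * dot w w + de * dot (w *m G) z <=
    - (y / 9 * dot w w) - mlow / 4 * dot z z.
  have mzz : 0 <= mlow * dot z z by rewrite mulr_ge0// ltW.
  rewrite /x /y in G1 G5 *; lra.
have c10 : 0 < de * mlow / 9 by rewrite divr_gt0// mulr_gt0.
set c1 := de * mlow / 9 in c10.
have F5 := dot_wz w P c1; have F6 := dot_wz z P (- c1).
have H1 : dot P w <= dot P P / (2 * c1) + c1 / 2 * dot w w.
  rewrite -(ler_pM2l c10) (dotC P w).
  rewrite (_ : c1 * (_ + _) = dot P P / 2 + c1 ^+ 2 * dot w w / 2); last by field; rewrite gt_eqF.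
  lra.
have H2 : - dot P z <= dot P P / (2 * c1) + c1 / 2 * dot z z.
  rewrite -(ler_pM2l c10) (dotC P z).
  rewrite (_ : c1 * (_ + _) = dot P P / 2 + c1 ^+ 2 * dot z z / 2); last by field; rewrite gt_eqF.
  lra.
pose X := dot P P / (2 * c1) + c1 / 2 * dot z z.
have X0 : 0 <= X.
  apply: addr_ge0; first by rewrite divr_ge0 ?dot_ge0// mulr_ge0// ltW.
  by rewrite mulr_ge0 ?dot_ge0// divr_ge0// ltW.
have H3 : - (de * dot P z) <= X.
  have H2' : de * (- dot P z) <= de * X by rewrite ler_pM2l.
  by have := ler_wpM2r X0 de1; lra.
have H4 : dot P P / c1 <= pi_gain * dot p p.
  by rewrite /pi_gain -/c1 mulrAC ler_pM2r ?invr_gt0.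
have H5 : dot P P / (2 * c1) = dot P P / c1 / 2 by field; rewrite gt_eqF.
have H6 : c1 * dot z z <= mlow / 4 * dot z z.
  by rewrite ler_wpM2r// /c1; have := ler_wpM2r (ltW mlow0) de1; lra.
have c1E : pi_rate = c1 / 2 by rewrite /pi_rate /c1; field.
have G7 : c1 * dot w w <= y / 9 * dot w w by rewrite /c1; lra.
rewrite c1E; rewrite /X in H3; clearbody c1 y; lra.
Qed.

End PILyapunov.

(** * Flows of locally Lipschitz fields *)

Section LocallyLipschitz.
Variables (R : realType) (n : nat).
Implicit Types (f g : 'rV[R]_n -> R) (u v : 'rV[R]_n).

(** The bound on [f] itself is included so that the property is stable under
    products. *)
Definition lip_cubes f := forall r, 0 < r -> exists K, 0 <= K /\
  (forall u v, `|u| <= r -> `|v| <= r -> `|f u - f v| <= K * `|u - v|) /\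
  (forall u, `|u| <= r -> `|f u| <= K).

Lemma lip_cubes_cst (c : R) : lip_cubes (fun=> c).
Proof.
move=> r r0; exists `|c|; split=> //; split=> // u v _ _.
by rewrite subrr normr0 mulr_ge0.
Qed.

Lemma lip_cubes_coord i : lip_cubes (fun u => u 0 i).
Proof.
move=> r r0; exists (1 + r); split; first lra; split=> [u v _ _|u ur].
  have := coord_le_norm (u - v) i; rewrite !mxE => /le_trans; apply.
  by rewrite ler_peMl//; lra.
by rewrite (le_trans (coord_le_norm _ _))// (le_trans ur)//; lra.
Qed.

Lemma lip_cubesD f g : lip_cubes f -> lip_cubes g -> lip_cubes (fun u => f u + g u).
Proof.
move=> hf hg r r0; have [K [K0 [f1 f2]]] := hf r r0; have [L [L0 [g1 g2]]] := hg r r0.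
exists (K + L); split; first by rewrite addr_ge0.
split=> [u v ur vr|u ur].
  rewrite opprD addrACA mulrDl (le_trans (ler_normD _ _))// lerD//.
    exact: f1.
  exact: g1.
by rewrite (le_trans (ler_normD _ _))// lerD ?f2 ?g2.
Qed.

Lemma lip_cubesM f g : lip_cubes f -> lip_cubes g -> lip_cubes (fun u => f u * g u).
Proof.
move=> hf hg r r0; have [K [K0 [f1 f2]]] := hf r r0; have [L [L0 [g1 g2]]] := hg r r0.
have KL : 0 <= K * L by rewrite mulr_ge0.
exists (2 * (K * L)); split; first lra.
split=> [u v ur vr|u ur]; last first.
  rewrite normrM; apply: (@le_trans _ _ (K * L)); last lra.
  by apply: ler_pM => //; [exact: f2|exact: g2].
rewrite (_ : f u * g u - f v * g v = f u * (g u - g v) + (f u - f v) * g v); last by ring.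
rewrite (le_trans (ler_normD _ _))// !normrM.
have h1 : `|f u| * `|g u - g v| <= K * (L * `|u - v|).
  by apply: ler_pM => //; [exact: f2|exact: g1].
have h2 : `|f u - f v| * `|g v| <= K * `|u - v| * L.
  by apply: ler_pM => //; [exact: f1|exact: g2].
lra.
Qed.

Lemma lip_cubesN f : lip_cubes f -> lip_cubes (fun u => - f u).
Proof.
move=> hf; have := lip_cubesM (lip_cubes_cst (-1)) hf.
by under eq_fun do rewrite mulN1r.
Qed.

Lemma lip_cubes_sum (I : Type) (s : seq I) (F : I -> 'rV[R]_n -> R) :
  (forall i, lip_cubes (F i)) -> lip_cubes (fun u => \sum_(i <- s) F i u).
Proof.
move=> hF; elim: s => [|i s IH].
  by under eq_fun do rewrite big_nil; exact: lip_cubes_cst.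
by under eq_fun do rewrite big_cons; exact: lip_cubesD.
Qed.

Lemma lip_cubes_C1 f : (forall x, differentiable f x) ->
  (forall v, continuous ('D_v f)) -> lip_cubes f.
Proof.
move=> df cf r r0.
pose A := [set u : 'rV[R]_n | `|u| <= r].
have cA : compact A.
  apply: bounded_closed_compact.
    exists r; split; first exact: num_real.
    by move=> x rx u /= ur; apply: (le_trans ur); exact: ltW.
  rewrite (_ : A = closed_ball (0 : 'rV[R]_n) r); first exact: closed_ball_closed.
  rewrite closed_ballE//; apply/seteqP; split=> u /=;
    by rewrite ?/A ?/closed_ball_/= sub0r normrN.
have A0 : A !=set0 by exists 0; rewrite /A/= normr0 ltW.
have bnd (phi : 'rV[R]_n -> R) : continuous phi -> exists B, forall u, `|u| <= r -> `|phi u| <= B.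
  move=> cphi; have cn : {within A, continuous (fun u => `|phi u|)}.
    apply: continuous_subspaceT => u.
    by apply: (@continuous_comp _ _ _ phi (fun y : R => `|y|)); [exact: cphi|exact: norm_continuous].
  have [c _ hc] := EVT_max_rV A0 cA cn.
  by exists `|phi c| => u ur; apply: hc; rewrite inE.
have cphi : continuous f by move=> x; exact: differentiable_continuous.
have [B0 hB0] := bnd f cphi.
have hb i : exists B, forall u, `|u| <= r -> `|'D_(delta_mx 0 i) f u| <= B by exact: bnd.
pose B i := projT1 (cid (hb i)).
have hB i u : `|u| <= r -> `|'D_(delta_mx 0 i) f u| <= B i := projT2 (cid (hb i)) u.
have z0 : `|0 : 'rV[R]_n| <= r by rewrite normr0 ltW.
have B_ge0 i : 0 <= B i := le_trans (normr_ge0 _) (hB i 0 z0).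
have B00 : 0 <= B0 := le_trans (normr_ge0 _) (hB0 0 z0).
have SB0 : 0 <= \sum_i B i by apply: sumr_ge0.
exists (B0 + \sum_i B i); split; first by rewrite addr_ge0.
split=> [u v ur vr|u ur]; last by rewrite (le_trans (hB0 u ur))// lerDl.
pose c (s : R) : 'rV[R]_n := v + s *: (u - v).
have dc (s : R) : is_derive s (1 : R) c (u - v).
  have := is_derive_addf (is_derive_constf v s)
    (is_derive_scalev (is_derive_id s (1 : R)) (is_derive_constf (u - v) s)).
  by rewrite scaler0 addr0 add0r scale1r.
have dfc s : is_derive s (1 : R) (fun s => f (c s)) ('D_(u - v) f (c s)).
  exact: is_derive_comp_curve.
have cr s : 0 <= s <= 1 -> `|c s| <= r.
  move=> /andP[s0 s1]; rewrite (_ : c s = s *: u + (1 - s) *: v).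
    rewrite (le_trans (ler_normD _ _))// !normrZ ger0_norm// ger0_norm ?subr_ge0//.
    have := ler_wpM2l s0 ur; have s1' : 0 <= 1 - s by rewrite subr_ge0.
    have := ler_wpM2l s1' vr; lra.
  by rewrite /c scalerBr scalerBl scale1r addrCA.
have [|s s01 e] := @MVT_segment R (fun s => f (c s)) (fun s => 'D_(u - v) f (c s)) 0 1 ler01 (fun s _ => dfc s).
  by apply: within_continuousW => s _; exact: is_derive_continuous.
have c1 : c 1 = u by rewrite /c scale1r addrC subrK.
have c0 : c 0 = v by rewrite /c scale0r addr0.
move: e; rewrite c1 c0 subr0 mulr1 => ->.
rewrite derive_grad// (le_trans (ler_norm_sum _ _ _))//.
apply: (@le_trans _ _ (\sum_i B i * `|u - v|)); last first.
  by rewrite -mulr_suml ler_wpM2r// lerDr.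
apply: ler_sum => i _; rewrite normrM; apply: ler_pM => //.
  by rewrite mxE; apply: hB; apply: cr; rewrite in_itv in s01.
exact: coord_le_norm.
Qed.

End LocallyLipschitz.

Section BoundedFlow.
Variables (R : realType) (n : nat).

(** The nearest-point projection on the cube of radius [r]; composing with it
    makes a function that is Lipschitz on the cube globally Lipschitz. *)
Definition clamp (r : R) (u : 'rV[R]_n) : 'rV[R]_n :=
  \row_i Num.max (- r) (Num.min r (u 0 i)).

Definition cutoff (r : R) (u : 'rV[R]_n) : R := Num.max 0 (Num.min 1 (2 - `|u| / r)).

Lemma clamp_norm r u : 0 < r -> `|clamp r u| <= r.
Proof.
move=> r0; apply: norm_le_coord => [|i]; first exact: ltW.
rewrite mxE ler_norml le_max lexx/= ge_max ge_min lexx/= andbT; lra.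
Qed.

Lemma clamp_lip r u v : `|clamp r u - clamp r v| <= `|u - v|.
Proof.
apply: norm_le_coord => // i; rewrite !mxE.
apply: le_trans (coord_le_norm (u - v) i); rewrite !mxE.
set x := u 0 i; set y := v 0 i.
wlog xy : x y / x <= y.
  move=> H; have [/H//|/ltW/H] := leP x y.
  by rewrite distrC (distrC y).
rewrite distrC (distrC x) ger0_norm ?subr_ge0; last first.
  by rewrite ge_max !le_max lexx/= !le_min !ge_min lexx xy !orbT.
rewrite ger0_norm ?subr_ge0// /Num.max /Num.min.
case: (ltP r y) => h1; case: (ltP r x) => h2.
- by case: ltP => h3; lra.
- by case: ltP => h3; case: ltP => h4; lra.
- by case: ltP => h3; case: ltP => h4; lra.
- by case: ltP => h3; case: ltP => h4; lra.
Qed.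

Lemma clamp_id r u : `|u| <= r -> clamp r u = u.
Proof.
move=> ur; apply/rowP => i; rewrite mxE.
have := le_trans (coord_le_norm u i) ur; rewrite ler_norml => /andP[h1 h2].
by rewrite (min_idPr h2) (max_idPr h1).
Qed.

Lemma cutoff_ge0 r u : 0 <= cutoff r u.
Proof. by rewrite le_max lexx. Qed.

Lemma cutoff_le1 r u : cutoff r u <= 1.
Proof. by rewrite ge_max ler01 ge_min lexx. Qed.

Lemma cutoff1 r u : 0 < r -> `|u| <= r -> cutoff r u = 1.
Proof.
move=> r0 ur; have h : 1 <= 2 - `|u| / r.
  by have : `|u| / r <= 1; [rewrite ler_pdivrMr// mul1r|lra].
by rewrite /cutoff (min_idPl h) (max_idPr ler01).
Qed.

Lemma cutoff0 r u : 0 < r -> 2 * r <= `|u| -> cutoff r u = 0.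
Proof.
move=> r0 ur; have h : 2 - `|u| / r <= 0.
  by have : 2 <= `|u| / r; [rewrite ler_pdivlMr|lra].
have h1 : 2 - `|u| / r <= 1 by lra.
by rewrite /cutoff (min_idPr h1) (max_idPl h).
Qed.

Lemma cutoff_lip r u v : 0 < r -> `|cutoff r u - cutoff r v| <= r^-1 * `|u - v|.
Proof.
move=> r0; set x := 2 - `|u| / r; set y := 2 - `|v| / r.
have : `|x - y| <= r^-1 * `|u - v|.
  rewrite (_ : x - y = r^-1 * (`|v| - `|u|)); last by rewrite /x /y; ring.
  rewrite normrM gtr0_norm ?invr_gt0// ler_pM2l ?invr_gt0// distrC.
  exact: ler_dist_dist.
apply: le_trans; rewrite /cutoff -/x -/y.
move: x y => x y; wlog xy : x y / x <= y.
  move=> H; have [/H//|/ltW/H] := leP x y.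
  by rewrite distrC (distrC y).
rewrite distrC (distrC x) ger0_norm ?subr_ge0; last first.
  by rewrite ge_max !le_max lexx/= !le_min !ge_min lexx xy !orbT.
rewrite ger0_norm ?subr_ge0// /Num.max /Num.min.
case: (ltP 1 y) => h1; case: (ltP 1 x) => h2.
- by case: ltP => h3; lra.
- by case: ltP => h3; case: ltP => h4; lra.
- by case: ltP => h3; case: ltP => h4; lra.
- by case: ltP => h3; case: ltP => h4; lra.
Qed.

(** Multiplying the field by [cutoff] makes it globally Lipschitz, and amounts to
    a change of time along the orbits.  Energies that decrease along [F] still
    decrease along [X]; if they confine [X] to the cube of radius [r], then [X]
    solves the original equation. *)
Lemma slowed_flow (F : 'rV[R]_n -> 'rV[R]_n) (r : R) (X0 : 'rV[R]_n) : 0 < r ->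
  (forall i, lip_cubes (fun u => F u 0 i)) ->
  exists (X : R -> 'rV[R]_n) (th : R -> R), X 0 = X0 /\
  forall t : R, 0 <= t ->
  [/\ is_derive t (1 : R) X (th t *: F (X t)), 0 <= th t & `|X t| <= r -> th t = 1].
Proof.
move=> r0 hF; have r20 : 0 < 2 * r by rewrite mulr_gt0.
pose K i := projT1 (cid (hF i (2 * r) r20)).
have hK i : 0 <= K i /\
  (forall u v, `|u| <= 2 * r -> `|v| <= 2 * r -> `|F u 0 i - F v 0 i| <= K i * `|u - v|) /\
  (forall u, `|u| <= 2 * r -> `|F u 0 i| <= K i) := projT2 (cid (hF i (2 * r) r20)).
pose M := \sum_i K i.
have KM i : K i <= M.
  by rewrite /M (bigD1 i)//= lerDl sumr_ge0// => j _; have [] := hK j.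
have M0 : 0 <= M by apply: sumr_ge0 => i _; have [] := hK i.
pose Ft u := cutoff r u *: F (clamp (2 * r) u).
have FtE u : Ft u = cutoff r u *: F u.
  rewrite /Ft; have [ur|/ltW ur] := leP `|u| (2 * r); first by rewrite clamp_id.
  by rewrite cutoff0// !scale0r.
have Fc u : `|F (clamp (2 * r) u)| <= M.
  apply: norm_le_coord => // i; apply: le_trans (KM i).
  by have [_ [_ ]] := hK i; apply; exact: clamp_norm.
have Fcl u v : `|F (clamp (2 * r) u) - F (clamp (2 * r) v)| <= M * `|u - v|.
  apply: norm_le_coord => [|i]; first by rewrite mulr_ge0.
  rewrite !mxE; have [K0 [h1 _]] := hK i.
  apply: (le_trans (h1 _ _ (clamp_norm _ r20) (clamp_norm _ r20))).
  by apply: ler_pM => //; exact: clamp_lip.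
have M1 : 0 <= M * r^-1 by rewrite mulr_ge0// invr_ge0 ltW.
have L0 : 0 < M + M * r^-1 + 1 by lra.
have FtL u v : `|Ft u - Ft v| <= (M + M * r^-1 + 1) * `|u - v|.
  rewrite (_ : Ft u - Ft v = cutoff r u *: (F (clamp (2 * r) u) - F (clamp (2 * r) v)) +
     (cutoff r u - cutoff r v) *: F (clamp (2 * r) v)); last first.
    by rewrite scalerBr scalerBl addrA subrK.
  rewrite (le_trans (ler_normD _ _))// !normrZ.
  have h1 : `|cutoff r u| * `|F (clamp (2 * r) u) - F (clamp (2 * r) v)| <= 1 * (M * `|u - v|).
    by apply: ler_pM => //; rewrite ger0_norm ?cutoff_ge0// cutoff_le1.
  have h2 : `|cutoff r u - cutoff r v| * `|F (clamp (2 * r) v)| <= r^-1 * `|u - v| * M.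
    by apply: ler_pM => //; exact: cutoff_lip.
  have := normr_ge0 (u - v); lra.
have FtM u : `|Ft u| <= M.
  rewrite normrZ ger0_norm ?cutoff_ge0// -[leRHS]mul1r.
  by apply: ler_pM => //; [exact: cutoff_ge0|exact: cutoff_le1].
have [X [X00 dX]] := picard_global L0 FtL FtM X0.
exists X, (fun t => cutoff r (X t)); split=> // t t0; split.
- by rewrite -FtE; exact: dX.
- exact: cutoff_ge0.
- exact: cutoff1.
Qed.

End BoundedFlow.

(** * Strongly convex functions *)

Lemma elipschitzW (R : realType) n k (L L' : R) (g : 'rV[R]_n -> 'rV[R]_k) :
  L <= L' -> elipschitz L g -> elipschitz L' g.
Proof.
by move=> LL' Lg x y; apply: (le_trans (Lg x y)); rewrite ler_wpM2r ?enorm_ge0.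
Qed.

Lemma smooth_differentiable (R : realType) (V W : normedModType R) (g : V -> W) :
  smooth g -> forall x, differentiable g x.
Proof. by move=> /(_ 1%N)[]. Qed.

Section StrongConvexity.
Variables (R : realType) (k : nat) (rho : R) (F : 'rV[R]_k -> R) (es : 'rV[R]_k).
Hypothesis rho0 : 0 < rho.
Hypothesis sc : strongly_convex rho F.
Hypothesis ges : grad F es = 0.

Lemma sc_gap e : rho / 2 * enorm (e - es) ^+ 2 <= F e - F es.
Proof. have := sc es e; rewrite ges mul0mx mxE; lra. Qed.

Lemma sc_upper e :
  F e - F es + rho / 2 * enorm (e - es) ^+ 2 <= dot (grad F e) (e - es).
Proof.
have := sc e es; rewrite dot_mx (enormB es) -(opprB e es) dotNr; lra.
Qed.

Lemma sc_gap_le_dot e : F e - F es <= enorm (grad F e) * enorm (e - es).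
Proof.
have := sc_upper e; have := dot_le (grad F e) (e - es).
have := mulr_ge0 (ltW rho0) (sqr_ge0 (enorm (e - es))); lra.
Qed.

Lemma sc_dist e : rho * enorm (e - es) <= enorm (grad F e).
Proof.
have := sc_upper e; have := sc_gap e; have := dot_le (grad F e) (e - es).
set d := enorm (e - es); set g := enorm (grad F e) => h1 h2 h3.
have [d0|] := leP d 0.
  have -> : d = 0 by apply/eqP; rewrite eq_le d0 enorm_ge0.
  by rewrite mulr0 enorm_ge0.
by move=> d0; rewrite -(ler_pM2r d0); lra.
Qed.

Lemma sc_gap_le e : 2 * rho * (F e - F es) <= enorm (grad F e) ^+ 2.
Proof.
have := sc_upper e; have := dot_le (grad F e) (e - es).
set d := enorm (e - es); set g := enorm (grad F e) => h1 h2.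
have h3 := sqr_ge0 (g - rho * d).
have : rho * (F e - F es + rho / 2 * d ^+ 2) <= rho * (g * d).
  by rewrite ler_pM2l//; lra.
lra.
Qed.

Lemma sc_halfspace e e' : F e' <= F e -> dot (grad F e) (e' - e) <= 0.
Proof.
have := sc e e'; rewrite dot_mx.
have := mulr_ge0 (ltW rho0) (sqr_ge0 (enorm (e' - e))); lra.
Qed.

Lemma sc_gap_ge0 e : 0 <= F e - F es.
Proof.
apply: le_trans (sc_gap e); apply: mulr_ge0; last exact: sqr_ge0.
by rewrite divr_ge0// ltW.
Qed.

End StrongConvexity.

(** * Smooth fields, continuity and Gronwall's lemma *)

Section SmoothLip.
Variables (R : realType) (n k : nat).

Lemma smooth_derive (V W : normedModType R) (g : V -> W) v :
  smooth g -> smooth ('D_v g).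
Proof. by move=> sg j; have [_] := sg j.+1; apply. Qed.

Lemma smooth_lip_cubes (f : 'rV[R]_n -> R) : smooth f -> lip_cubes f.
Proof.
move=> sf; apply: lip_cubes_C1; first exact: smooth_differentiable.
by move=> v; have [_] := sf 1%N; apply.
Qed.

Lemma smooth_coord_lip_cubes (g : 'rV[R]_n -> 'rV[R]_k) j :
  smooth g -> lip_cubes (fun x => g x 0 j).
Proof.
move=> sg; have dg := smooth_differentiable sg; apply: lip_cubes_C1 => [x|v].
  apply: (@differentiable_comp _ _ _ _ g (fun y : 'rV[R]_k => y 0 j)) => //.
  exact: differentiable_coord.
have -> : 'D_v (fun x => g x 0 j) = fun x => 'D_v g x 0 j.
  apply/funext => x; rewrite derive_mx ?mxE//; exact: diff_derivable.
move=> x; apply: (@continuous_comp _ _ _ ('D_v g) (fun y : 'rV[R]_k => y 0 j)).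
  have [_ cg] := sg 1%N; exact: cg.
exact: coord_continuous.
Qed.

Lemma lip_cubes_lsub (f : 'rV[R]_n -> R) :
  lip_cubes f -> lip_cubes (fun X : 'rV[R]_(n + k) => f (lsubmx X)).
Proof.
move=> hf r r0; have [K [K0 [h1 h2]]] := hf r r0.
have sub (X : 'rV[R]_(n + k)) : `|lsubmx X| <= `|X|.
  by apply: norm_le_coord => // i; rewrite mxE; exact: coord_le_norm.
exists K; split=> //; split=> [u v ur vr|u ur]; last first.
  by apply: h2; exact: le_trans (sub _) ur.
apply: (le_trans (h1 _ _ (le_trans (sub _) ur) (le_trans (sub _) vr))).
by apply: ler_wpM2l => //; have := sub (u - v); rewrite linearB.
Qed.

Lemma jacobianE (g : 'rV[R]_n -> 'rV[R]_k) x i j : differentiable g x ->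
  'J g x i j = 'D_(delta_mx 0 i) g x 0 j.
Proof. by move=> dg; rewrite deriveEjacobian// -rowE [RHS]mxE. Qed.

End SmoothLip.

Lemma piU_derive (R : realType) m (mlow a kap : R) (w z : R -> 'rV[R]_m)
    (dw dz : 'rV[R]_m) (t : R) :
  is_derive t (1 : R) w dw -> is_derive t (1 : R) z dz ->
  is_derive t (1 : R) (fun s => piU mlow a kap (w s) (z s))
    (piU' mlow a kap (w t) (z t) dw dz).
Proof.
move=> hw hz.
have h1 := is_derive_mulCf (1 / 2) (is_derive_dot hw hw).
have h2 := is_derive_mulCf (mlow / (2 * kap)) (is_derive_dot hz hz).
have h3 := is_derive_mulCf (pi_delta mlow a) (is_derive_dot hw hz).
have := is_derive_subf (is_derive_addf h1 h2) h3.
rewrite (_ : (fun s => _) = fun s => piU mlow a kap (w s) (z s)); last first.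
  by apply/funext => s; rewrite /piU; ring.
rewrite (_ : _ - _ = piU' mlow a kap (w t) (z t) dw dz) //.
rewrite /piU' (dotC dw (w t)) (dotC dz (z t)) invfM; lra.
Qed.

Section ContinuousRows.
Variables (R : realType) (T : topologicalType) (n : nat).

Lemma continuous_row (F : T -> 'rV[R]_n) :
  (forall i, continuous (fun t => F t 0 i)) -> continuous F.
Proof.
move=> h t; apply/(@cvgrPdist_le _ _ _ _ (nbhs_filter t)) => e e0; near=> s.
apply: norm_le_coord => [|i]; first exact: ltW.
rewrite !mxE; move: i; near: s; apply: filter_forall => i.
by have /cvgrPdist_le := h i t; apply.
Unshelve. all: by end_near. Qed.

Lemma continuous_lincomb (c : R) (F G : T -> 'rV[R]_n) :
  continuous F -> continuous G -> continuous (fun t => F t + c *: G t).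
Proof.
move=> cF cG t; by apply: cvgD; [exact: cF|apply: cvgZl_tmp; exact: cG].
Qed.

Lemma continuous_combr (c : R) (F G : T -> R) :
  continuous F -> continuous G -> continuous (fun t => F t + c * G t).
Proof.
move=> cF cG t; apply: cvgD; first exact: cF.
by apply: cvgM; [exact: cvg_cst|exact: cG].
Qed.

Lemma continuous_enorm (F : T -> 'rV[R]_n) :
  continuous F -> continuous (fun t => enorm (F t)).
Proof. by move=> cF t; apply: continuous_comp; [exact: cF|exact: enorm_continuous]. Qed.

Lemma continuous_dot (F G : T -> 'rV[R]_n) :
  continuous F -> continuous G -> continuous (fun t => dot (F t) (G t)).
Proof.
move=> cF cG.
have cp : continuous (fun t => enorm (F t + G t)).
  by apply: continuous_enorm => t; apply: cvgD; [exact: cF|exact: cG].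
have cm : continuous (fun t => enorm (F t - G t)).
  by apply: continuous_enorm => t; apply: cvgB; [exact: cF|exact: cG].
have -> : (fun t => dot (F t) (G t)) = (fun t => (enorm (F t + G t) * enorm (F t + G t)
    - enorm (F t - G t) * enorm (F t - G t)) * (1 / 4)).
  apply/funext => t; rewrite -!expr2 !enorm_sqr !dotE (dotC (G t)); lra.
move=> t; apply: cvgM; last exact: cvg_cst.
by apply: cvgB; apply: cvgM; [exact: cp|exact: cp|exact: cm|exact: cm].
Qed.

End ContinuousRows.

Section Gronwall.
Variable R : realType.

Lemma gronwall (u u' : R -> R) (k c a b : R) : a <= b ->
  (forall t, a < t < b -> is_derive t (1 : R) u (u' t)) ->
  (forall t, a < t < b -> u' t <= k * (u t - c)) ->
  {within `[a, b], continuous u} ->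
  u b - c <= expR (k * (b - a)) * (u a - c).
Proof.
move=> ab du hu cu.
have := @nincr_derive R (fun t => expR (- k * t) * (u t - c))
  (fun t => expR (- k * t) * (- k * 1) * (u t - c) + expR (- k * t) * (u' t - 0)) a b ab.
have h1 t : a < t < b -> is_derive t (1 : R) (fun t => expR (- k * t) * (u t - c))
   (expR (- k * t) * (- k * 1) * (u t - c) + expR (- k * t) * (u' t - 0)).
  move=> ht.
  exact: (is_derive_mulf (is_derive_expf (is_derive_mulCf (- k) (is_derive_id t (1 : R))))
    (is_derive_subf (du t ht) (is_derive_constf c t))).
move=> /(_ h1) h2.
have h3 : expR (- k * b) * (u b - c) <= expR (- k * a) * (u a - c).
  apply: h2 => [t ht|].
    have := ler_wpM2l (expR_ge0 (- k * t)) (hu t ht); lra.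
  have ce : {within `[a, b], continuous (fun t => expR (- k * t))}.
    apply: continuous_subspaceT => t.
    exact: is_derive_continuous (is_derive_expf (is_derive_mulCf (- k) (is_derive_id t (1 : R)))).
  move=> t; apply: cvgM; first exact: ce.
  by apply: cvgB; [exact: cu|exact: cvg_cst].
have := ler_wpM2l (expR_ge0 (k * b)) h3.
rewrite !mulrA -!expRD (_ : k * b + - k * b = 0); last by ring.
by rewrite expR0 mul1r (_ : k * b + - k * a = k * (b - a)); last by ring.
Qed.

End Gronwall.

(** * Uniform control of the transient *)

Section Transient.
Variables (R : realType) (qlow rho kdist thr B cH a2 dec mu : R).
Hypotheses (qlow_gt0 : 0 < qlow) (rho_gt0 : 0 < rho) (kdist_ge0 : 0 <= kdist).
Hypotheses (thr_gt0 : 0 < thr) (B_ge1 : 1 <= B) (cH_gt0 : 0 < cH) (a2_gt0 : 0 < a2).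
Hypotheses (dec_gt0 : 0 < dec) (mu_gt0 : 0 < mu).

(** What the transient estimate needs to know of a trajectory: [ga] is the
    distance of the reduced variable to the optimum, [hh] the constraint
    violation, [G] the size of the reduced gradient, [W] and [U] the energies.
    No bound of [W] by [ga] is available; [tr_over] makes up for it. *)
Record transient (ga hh G W U W' U' : R -> R) : Prop := Transient {
  tr_ga0 : forall t, 0 <= ga t;
  tr_hh0 : forall t, 0 <= hh t;
  tr_G0 : forall t, 0 <= G t;
  tr_U0 : forall t, 0 <= U t;
  tr_W0 : forall t, 0 <= W t;
  tr_h : forall t, hh t ^+ 2 <= cH * U t;
  tr_gaW : forall t, ga t ^+ 2 <= 2 / rho * W t;
  tr_WG : forall t, W t <= G t * ga t;
  tr_GW : forall t, 2 * rho * W t <= G t ^+ 2;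
  tr_dW : forall t : R, 0 < t -> is_derive t (1 : R) W (W' t);
  tr_dU : forall t : R, 0 < t -> is_derive t (1 : R) U (U' t);
  tr_W' : forall t, W' t <= - (qlow / 2 * G t ^+ 2) + kdist * hh t ^+ 2;
  tr_U' : forall t, U' t <= a2 * (hh t ^+ 2 + ga t ^+ 2);
  tr_dec : forall t, W' t + mu * U' t <= - (dec * (W t + mu * U t));
  tr_cga : forall b : R, {within `[0, b], continuous ga};
  tr_cU : forall b : R, {within `[0, b], continuous U};
  tr_over : forall Y t0 t1 : R, 0 < t0 -> t0 <= t1 -> 0 < Y ->
    (forall s, t0 <= s <= t1 -> hh s <= Y) ->
    (forall s, t0 <= s <= t1 -> thr * Y <= G s) -> ga t1 <= B * ga t0 }.

Lemma within_ge (u : R -> R) (c b : R) : 0 < b -> {within `[0, b], continuous u} ->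
  (forall s, 0 < s <= b -> c <= u s) -> c <= u 0.
Proof.
move=> b0 cu hu; rewrite leNgt; apply/negP => u0c.
have ub : c <= u b by apply: hu; rewrite b0 lexx.
have [|s] := IVT (ltW b0) cu (v := (u 0 + c) / 2).
  by rewrite ge_min le_max; apply/andP; split; apply/orP; [left|right]; lra.
rewrite in_itv/= => /andP[s0 sb] us.
have [s00|sN0] := eqVneq s 0; first by move: us; rewrite s00; lra.
have : c <= u s by apply: hu; rewrite lt_neqAle eq_sym sN0 s0.
lra.
Qed.

(** While the violation is at most [Y], [peakK2 * Y ^+ 2] bounds [ga ^+ 2] from the
    moment when the gradient has been below the threshold [thr * Y]. *)
Definition peakK2 : R := 2 / rho * (thr ^+ 2 / (2 * rho) + kdist / (qlow * rho)).
Definition peakK : R := 1 + peakK2.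

Lemma peakK2_ge0 : 0 <= peakK2.
Proof.
apply: mulr_ge0; first by rewrite divr_ge0// ltW.
apply: addr_ge0; first by rewrite divr_ge0 ?sqr_ge0// mulr_ge0// ltW.
by rewrite divr_ge0// mulr_ge0// ltW.
Qed.

Section Curve.
Variables ga hh G W U W' U' : R -> R.
Hypothesis tr : transient ga hh G W U W' U'.

(** Either the gradient has dominated the disturbance so far, and [tr_over]
    applies, or it has been dominated at some time [s]: then [W s] is of order
    [Y ^+ 2], and remains so by Gronwall's lemma. *)
Lemma transient_peak (Y t : R) : 0 < t -> 0 < Y ->
  (forall s, 0 <= s <= t -> hh s <= Y) -> ga t <= B * ga 0 + peakK * Y.
Proof.
move=> t0 Y0 hY; have K2 := peakK2_ge0.
have B0 : 0 < B by exact: lt_le_trans ltr01 B_ge1.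
have Bg0 : 0 <= B * ga 0 by apply: mulr_ge0; [exact: ltW|exact: tr_ga0 tr _].
have KY0 : 0 <= peakK * Y by rewrite /peakK mulr_ge0// ?ltW//; lra.
have [hall|] := pselect (forall s, 0 < s <= t -> thr * Y <= G s).
  suff : ga t / B <= ga 0 by rewrite ler_pdivrMr// mulrC; lra.
  have cg : {within `[0, t], continuous ga} by exact: (tr_cga tr).
  apply: (within_ge t0 cg) => s /andP[s0 st].
  rewrite ler_pdivrMr// mulrC; apply: (tr_over tr s0 st Y0) => r /andP[sr rt].
    by apply: hY; rewrite rt (le_trans (ltW s0)).
  by apply: hall; rewrite rt (lt_le_trans s0).
move=> /existsNP[s /not_implyP[/andP[s0 st] /negP]]; rewrite -ltNge => Gs.
have qr0 : 0 < qlow * rho by rewrite mulr_gt0.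
pose c := kdist * Y ^+ 2 / (qlow * rho).
have c0 : 0 <= c by rewrite divr_ge0 ?mulr_ge0 ?sqr_ge0// ltW.
have Wt : W t <= W s + c.
  have ds r : s <= r <= t -> 0 < r by move=> /andP[sr _]; exact: lt_le_trans sr.
  have := @gronwall R W W' (- (qlow * rho)) c s t st.
  have h1 r : s < r < t -> is_derive r (1 : R) W (W' r).
    by move=> /andP[sr _]; apply: tr_dW tr _ _; exact: lt_trans sr.
  have h2 r : s < r < t -> W' r <= - (qlow * rho) * (W r - c).
    move=> /andP[sr rt]; apply: (le_trans (tr_W' tr r)).
    have e1 : qlow * rho * c = kdist * Y ^+ 2.
      by rewrite /c mulrC divfK// gt_eqF.
    have hY2 : kdist * hh r ^+ 2 <= kdist * Y ^+ 2.
      apply: ler_wpM2l => //; apply: lerXn2r; rewrite ?nnegrE ?(tr_hh0 tr)//.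
        exact: ltW.
      by apply: hY; rewrite (ltW rt) ltW// (lt_trans s0).
    have := ler_wpM2l (ltW qlow_gt0) (tr_GW tr r); lra.
  have h3 : {within `[s, t], continuous W}.
    by apply: within_continuousW => r /ds r0; exact: is_derive_continuous (tr_dW tr r0).
  move=> /(_ h1 h2 h3).
  set e := expR _ => h4.
  have e0 : 0 <= e by exact: expR_ge0.
  have e1 : e <= 1.
    by rewrite /e -expR0 ler_expR mulNr oppr_le0 mulr_ge0 ?subr_ge0// ltW.
  have := ler_wpM2r (tr_W0 tr s) e1; have := mulr_ge0 e0 c0; lra.
have Ws : W s <= thr ^+ 2 / (2 * rho) * Y ^+ 2.
  have r2 : 0 < 2 * rho by rewrite mulr_gt0.
  rewrite mulrAC ler_pdivlMr// mulrC (le_trans (tr_GW tr s))// -exprMn.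
  apply: lerXn2r; rewrite ?nnegrE ?(tr_G0 tr)//; last exact: ltW.
  by rewrite mulr_ge0// ltW.
have r0 : 0 <= 2 / rho by rewrite divr_ge0// ltW.
have hg : ga t ^+ 2 <= peakK2 * Y ^+ 2.
  apply: (le_trans (tr_gaW tr t)); rewrite /peakK2 -[leRHS]mulrA; apply: ler_wpM2l => //.
  by move: Wt Ws; rewrite /c; lra.
have : ga t <= peakK * Y.
  rewrite -(@ler_pXn2r _ 2)// ?nnegrE ?(tr_ga0 tr)//.
  apply: (le_trans hg); rewrite exprMn; apply: ler_wpM2r; first exact: sqr_ge0.
  rewrite /peakK; have := sqr_ge0 peakK2; lra.
lra.
Qed.

(** During [horizon] the exponential growth of [U] does not exceed the factor
    [1 + peakE].  The value of [peakE] makes [2 * peakK ^+ 2 * peakE] equal to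
    [1 / 2], which allows [transient_short] to absorb its own bound. *)
Definition peakE : R := (4 * peakK ^+ 2)^-1.
Definition peakN : R := 4 * B ^+ 2 + 8 * peakK ^+ 2 * cH.
Definition peakU : R := 2 + peakN / cH.
Definition growth : R := a2 * cH.
Definition horizon : R := ln (1 + peakE) / growth.

Lemma peakK_ge1 : 1 <= peakK.
Proof. by rewrite /peakK lerDl peakK2_ge0. Qed.

Lemma peakE_gt0 : 0 < peakE.
Proof.
rewrite invr_gt0 mulr_gt0// exprn_gt0//; exact: lt_le_trans ltr01 peakK_ge1.
Qed.

Lemma peakE_le1 : peakE <= 1.
Proof.
have K1 := peakK_ge1; have K0 : 0 < 4 * peakK ^+ 2.
  by rewrite mulr_gt0// exprn_gt0//; lra.
rewrite /peakE invf_le1//; have := sqr_ge0 (peakK - 1); lra.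
Qed.

Lemma growth_gt0 : 0 < growth. Proof. by rewrite mulr_gt0. Qed.

Lemma horizon_gt0 : 0 < horizon.
Proof. by rewrite divr_gt0 ?growth_gt0// ln_gt0// ltrDl peakE_gt0. Qed.

Lemma peakN_gt0 : 0 < peakN.
Proof.
apply: addr_gt0; first by rewrite mulr_gt0// exprn_gt0//; exact: lt_le_trans ltr01 B_ge1.
rewrite mulr_gt0// mulr_gt0// exprn_gt0//; exact: lt_le_trans ltr01 peakK_ge1.
Qed.

Lemma peakU_gt0 : 0 < peakU.
Proof. by rewrite addr_gt0// divr_gt0// peakN_gt0. Qed.

Lemma transient_growth (N t : R) : 0 <= t <= horizon ->
  (forall s, 0 <= s <= horizon -> ga s <= N) ->
  U t <= 2 * U 0 + peakE / cH * N ^+ 2.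
Proof.
move=> /andP[t0 tT] hN; have gr0 := growth_gt0; have e0 := peakE_gt0.
have cU : {within `[0, t], continuous U} by exact: (tr_cU tr).
pose c := - (N ^+ 2 / cH).
have := @gronwall R U U' growth c 0 t t0.
have h1 s : 0 < s < t -> is_derive s (1 : R) U (U' s).
  by move=> /andP[s0 _]; exact: tr_dU tr _ s0.
have h2 s : 0 < s < t -> U' s <= growth * (U s - c).
  move=> /andP[s0 st]; apply: (le_trans (tr_U' tr s)).
  rewrite /growth -mulrA; apply: ler_wpM2l; first exact: ltW.
  rewrite /c opprK mulrDr [cH * (_ / _)]mulrC divfK ?gt_eqF//.
  apply: lerD; first exact: tr_h tr _.
  have N1 : ga s <= N by apply: hN; rewrite ltW// (le_trans (ltW st)).
  apply: lerXn2r => //; rewrite nnegrE ?(tr_ga0 tr)//.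
  exact: le_trans (tr_ga0 tr s) N1.
move=> /(_ h1 h2 cU).
set e := expR _ => h3.
have e1 : e <= 1 + peakE.
  rewrite -[leRHS]lnK ?posrE; last by rewrite addr_gt0.
  rewrite ler_expR subr0 -ler_pdivlMl// mulrC; exact: tT.
have e4 : 1 + peakE <= 2 by have := peakE_le1; lra.
have q0 : 0 <= N ^+ 2 / cH by rewrite divr_ge0 ?sqr_ge0// ltW.
have := ler_wpM2r q0 e1; have := ler_wpM2r (tr_U0 tr 0) (le_trans e1 e4).
rewrite mulrAC -mulrA; move: h3; rewrite /c opprK mulrDr; lra.
Qed.

(** With [N] the maximum of [ga] on the interval, [transient_growth] bounds the
    violation by [E] and [peakE * N ^+ 2], and [transient_peak] then bounds
    [N ^+ 2] by a multiple of [E] plus [N ^+ 2 / 2]. *)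
Lemma transient_short (E t : R) : 0 < E -> ga 0 ^+ 2 + U 0 <= E ->
  0 <= t <= horizon -> ga t ^+ 2 <= peakN * E /\ U t <= peakU * E.
Proof.
move=> E0 hE; have T0 := horizon_gt0; have e0 := peakE_gt0; have K1 := peakK_ge1.
have B0 : 0 < B by exact: lt_le_trans ltr01 B_ge1.
have cg : {within `[0, horizon], continuous ga} by exact: (tr_cga tr).
have [s0] := EVT_max (ltW T0) cg; rewrite in_itv/= => hs0 hmax.
set N := ga s0 in hmax.
have hN s : 0 <= s <= horizon -> ga s <= N by move=> hs; apply: hmax; rewrite in_itv.
have N0 : 0 <= N by exact: tr_ga0 tr _.
have U00 := tr_U0 tr 0; have g00 := sqr_ge0 (ga 0).
have hU s : 0 <= s <= horizon -> U s <= 2 * E + peakE / cH * N ^+ 2.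
  by move=> hs; apply: (le_trans (transient_growth hs hN)); lra.
have cE : 0 < cH * E by rewrite mulr_gt0.
have eN : 0 <= peakE * N ^+ 2 by rewrite mulr_ge0 ?sqr_ge0// ltW.
pose Y := Num.sqrt (2 * (cH * E) + peakE * N ^+ 2).
have Y2 : Y ^+ 2 = 2 * (cH * E) + peakE * N ^+ 2 by rewrite sqr_sqrtr//; lra.
have Y0 : 0 < Y by rewrite sqrtr_gt0; lra.
have hY s : 0 <= s <= horizon -> hh s <= Y.
  move=> hs; rewrite -(@ler_pXn2r _ 2)// ?nnegrE ?(tr_hh0 tr)//; last exact: ltW.
  rewrite Y2; apply: (le_trans (tr_h tr s)).
  have := ler_wpM2l (ltW cH_gt0) (hU s hs).
  rewrite mulrDr (mulrA cH (peakE / cH)) [cH * (peakE / _)]mulrC divfK ?gt_eqF//; lra.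
have gB : ga 0 ^+ 2 <= E by lra.
have N2 : N ^+ 2 <= peakN * E.
  have N1 : N <= B * ga 0 + peakK * Y.
    have [s00|sN0] := eqVneq s0 0.
      have : ga 0 <= B * ga 0 by rewrite ler_peMl// (tr_ga0 tr).
      have : 0 <= peakK * Y by rewrite mulr_ge0 ?(ltW Y0)//; lra.
      rewrite /N s00; lra.
    move: hs0 => /andP[s01 s02]; apply: transient_peak => //.
      by rewrite lt_neqAle eq_sym sN0.
    by move=> s /andP[h1 h2]; apply: hY; rewrite h1 (le_trans h2).
  have : N ^+ 2 <= (B * ga 0 + peakK * Y) ^+ 2.
    by apply: lerXn2r; rewrite ?nnegrE//; exact: le_trans N1.
  have := sqr_ge0 (B * ga 0 - peakK * Y).
  have := ler_wpM2l (sqr_ge0 B) gB; rewrite -!exprMn.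
  have e1 : peakK ^+ 2 * peakE = 1 / 4.
    by rewrite /peakE; field; rewrite gt_eqF//; lra.
  have : (peakK * Y) ^+ 2 = 2 * (peakK ^+ 2 * cH * E) + N ^+ 2 / 4.
    rewrite exprMn Y2 mulrDr (mulrA _ peakE) e1; ring.
  rewrite /peakN; lra.
move=> ht; split.
  apply: le_trans N2; apply: lerXn2r; rewrite ?nnegrE ?(tr_ga0 tr)//; exact: hN.
have h1 : peakE / cH * N ^+ 2 <= peakN / cH * E.
  rewrite mulrAC [leRHS]mulrAC ler_pM2r ?invr_gt0//.
  exact: (le_trans (ler_piMl (sqr_ge0 N) peakE_le1) N2).
have := hU t ht; rewrite /peakU; lra.
Qed.

(** Above [lowW * E] the excess satisfies [W' <= - (lowK / E) * W ^+ 2]: the second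
    term of [lowW] lets the dissipation absorb the disturbance, and the third
    bounds the solutions of this inequality after half of [horizon], whatever
    their initial value. *)
Definition lowK : R := qlow / (4 * peakN).
Definition lowW : R := 1 + kdist * cH * peakU / lowK + 2 / (lowK * horizon).

Lemma lowK_gt0 : 0 < lowK.
Proof. by rewrite divr_gt0// mulr_gt0// peakN_gt0. Qed.

Lemma lowQ_ge0 : 0 <= kdist * cH * peakU / lowK.
Proof.
apply: divr_ge0; last exact: ltW lowK_gt0.
by apply: mulr_ge0; [apply: mulr_ge0 => //|]; apply: ltW => //; exact: peakU_gt0.
Qed.

Lemma transient_low (E : R) : 0 < E -> ga 0 ^+ 2 + U 0 <= E ->
  exists t, [/\ 0 < t, t <= horizon & W t <= lowW * E].
Proof.
move=> E0 hE; have T0 := horizon_gt0; have k0 := lowK_gt0.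
have N0 := peakN_gt0; have P0 := peakU_gt0.
apply: contrapT => hno.
have hW t : 0 < t -> t <= horizon -> lowW * E < W t.
  by move=> t0 tT; rewrite ltNge; apply/negP => ?; apply: hno; exists t.
pose T2 := horizon / 2; have T20 : 0 < T2 by rewrite divr_gt0.
have T2T : T2 <= horizon by rewrite /T2; lra.
have c10 := lowQ_ge0.
have c20 : 0 < 2 / (lowK * horizon) by rewrite divr_gt0// mulr_gt0.
have l1 : 1 <= lowW by rewrite /lowW; lra.
have hT t : T2 <= t <= horizon -> 0 < t /\ t <= horizon.
  by move=> /andP[h1 h2]; split=> //; exact: lt_le_trans h1.
have Wp t : T2 <= t <= horizon -> 0 < W t.
  move=> /hT[t0 tT]; apply: lt_trans (hW t t0 tT).
  by rewrite mulr_gt0//; exact: lt_le_trans l1.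
have dW t : T2 <= t <= horizon -> W' t <= - (lowK / E * W t ^+ 2).
  move=> ht; have [t0 tT] := hT t ht.
  have [ga2 Ut] := transient_short E0 hE (t := t) (introT andP (conj (ltW t0) tT)).
  have h1 : W t ^+ 2 <= G t ^+ 2 * (peakN * E).
    apply: (@le_trans _ _ (G t ^+ 2 * ga t ^+ 2)); last first.
      by apply: ler_wpM2l => //; exact: sqr_ge0.
    rewrite -exprMn; apply: lerXn2r; rewrite ?nnegrE ?(tr_W0 tr)//.
      by apply: mulr_ge0; [exact: tr_G0 tr _|exact: tr_ga0 tr _].
    exact: tr_WG tr _.
  have h2 : 2 * (lowK / E) * W t ^+ 2 <= qlow / 2 * G t ^+ 2.
    have := ler_wpM2l (ltW (divr_gt0 k0 E0)) h1.
    rewrite (_ : lowK / E * (G t ^+ 2 * (peakN * E)) = qlow / 4 * G t ^+ 2); first lra.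
    by rewrite /lowK; field; rewrite (gt_eqF E0) (gt_eqF N0).
  have h3 : kdist * hh t ^+ 2 <= lowK / E * W t ^+ 2.
    apply: (@le_trans _ _ (kdist * (cH * (peakU * E)))).
      apply: ler_wpM2l => //; apply: (le_trans (tr_h tr t)).
      by apply: ler_wpM2l => //; exact: ltW.
    have WE := ltW (hW t t0 tT).
    have h4 : (lowW * E) ^+ 2 <= W t ^+ 2.
      apply: lerXn2r; rewrite ?nnegrE ?(tr_W0 tr)// mulr_ge0 ?(ltW E0)//; lra.
    apply: le_trans (ler_wpM2l (ltW (divr_gt0 k0 E0)) h4).
    rewrite (_ : lowK / E * (lowW * E) ^+ 2 = lowK * lowW ^+ 2 * E); last first.
      by field; rewrite gt_eqF.
    rewrite !mulrA; apply: ler_wpM2r; first exact: ltW.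
    have h5 : kdist * cH * peakU / lowK <= lowW ^+ 2.
      apply: (@le_trans _ _ lowW); first by rewrite /lowW; lra.
      by rewrite expr2 ler_peMl//; lra.
    by move: h5; rewrite ler_pdivrMr// [_ * lowK]mulrC expr2 mulrA.
  by have := tr_W' tr t; lra.
(* [1 / W] grows at least at the rate [lowK / E]. *)
have dV s : T2 <= s <= horizon -> is_derive s (1 : R)
    (fun r => lowK / E * r - (W r)^-1) (lowK / E * 1 - - W s ^- 2 *: W' s).
  move=> ht; have [t0 _] := hT s ht.
  have Wt0 : W s != 0 by rewrite gt_eqF// Wp.
  exact: (is_derive_subf (is_derive_mulCf (lowK / E) (is_derive_id s (1 : R)))
    (is_deriveV Wt0 (tr_dW tr t0))).
have := nincr_derive_cc T2T dV.
have nV t : T2 < t < horizon -> lowK / E * 1 - - W t ^- 2 *: W' t <= 0.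
  move=> /andP[h1 h2]; have ht : T2 <= t <= horizon by rewrite !ltW.
  have W2 : 0 < W t ^+ 2 by rewrite exprn_gt0// Wp.
  have := dW t ht; rewrite -mulNr => h3.
  have : W t ^- 2 * W' t <= - (lowK / E).
    by rewrite mulrC ler_pdivrMr.
  rewrite scaleNr opprK mulr1 /GRing.scale/=; lra.
move=> /(_ nV) h1.
have TT : T2 <= horizon <= horizon by rewrite T2T lexx.
have W1 := Wp _ TT.
have W2 : 0 < (W T2)^-1 by rewrite invr_gt0 Wp// lexx.
have h2 : lowK / E * T2 <= (W horizon)^-1.
  move: h1; rewrite /T2; lra.
have h3 : 0 < lowK / E * T2 by rewrite mulr_gt0// divr_gt0.
have h4 : W horizon <= 2 / (lowK * horizon) * E.
  have : W horizon <= (lowK / E * T2)^-1 by rewrite -[leLHS]invrK lef_pV2// ?posrE// invr_gt0.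
  rewrite (_ : (lowK / E * T2)^-1 = 2 / (lowK * horizon) * E)//.
  by rewrite /T2; field; rewrite (gt_eqF k0) (gt_eqF E0) (gt_eqF T0).
have := hW horizon T0 (lexx _); rewrite ltNge => /negP; apply.
apply: (le_trans h4); apply: ler_wpM2r; first exact: ltW.
rewrite /lowW; lra.
Qed.

Definition decayK : R :=
  expR (dec * horizon) * (peakN + peakU + (2 / rho + mu^-1) * (lowW + mu * peakU)).

Lemma decayK_gt0 : 0 < decayK.
Proof.
have N0 := peakN_gt0; have P0 := peakU_gt0; have k0 := lowK_gt0; have T0 := horizon_gt0.
apply: mulr_gt0; first exact: expR_gt0.
apply: addr_gt0; first exact: addr_gt0.
apply: mulr_gt0; first by rewrite addr_gt0 ?invr_gt0// divr_gt0.
apply: addr_gt0; last exact: mulr_gt0.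
apply: addr_gt0; last by rewrite divr_gt0// mulr_gt0.
by rewrite ltr_pwDl// lowQ_ge0.
Qed.

Lemma transient_decay (t : R) : 0 <= t ->
  ga t ^+ 2 + U t <= decayK * expR (- dec * t) * (ga 0 ^+ 2 + U 0).
Proof.
move=> t0; apply/ler_addgt0Pr => e e0.
have N0 := peakN_gt0; have P0 := peakU_gt0; have k0 := lowK_gt0; have T0 := horizon_gt0.
have D0 : 0 < decayK * expR (- dec * t) by rewrite mulr_gt0 ?decayK_gt0 ?expR_gt0.
set E00 := ga 0 ^+ 2 + U 0.
have E000 : 0 <= E00 by rewrite addr_ge0 ?sqr_ge0 ?(tr_U0 tr).
pose E := E00 + e / (decayK * expR (- dec * t)).
have eE : decayK * expR (- dec * t) * E = decayK * expR (- dec * t) * E00 + e.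
  by rewrite mulrDr [X in _ + X]mulrC divfK// gt_eqF.
have E0 : 0 < E by rewrite ltr_pwDr// divr_gt0.
have hE : E00 <= E by rewrite lerDl ltW// divr_gt0.
rewrite -eE {eE D0 e0}; clearbody E; rewrite /decayK.
set M := _ * (lowW + mu * peakU).
have [t2 [t20 t2T Wt2]] := transient_low E0 hE.
have M0 : 0 < 2 / rho + mu^-1 by rewrite addr_gt0 ?invr_gt0// divr_gt0.
have Ut2 : U t2 <= peakU * E.
  by have [] := transient_short E0 hE (introT andP (conj (ltW t20) t2T)).
have Et2 : W t2 + mu * U t2 <= (lowW + mu * peakU) * E.
  by rewrite mulrDl lerD// -mulrA ler_wpM2l// ltW.
have LE0 : 0 <= (lowW + mu * peakU) * E.
  by apply: le_trans Et2; rewrite addr_ge0 ?(tr_W0 tr)// mulr_ge0 ?(tr_U0 tr)// ltW.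
have ME0 : 0 <= M * E by rewrite /M -mulrA mulr_ge0// ltW.
have NE0 : 0 <= (peakN + peakU) * E by rewrite mulr_ge0// ltW// addr_gt0.
have [tT|Tt] := leP t horizon.
  have [h1 h2] := transient_short E0 hE (introT andP (conj t0 tT)).
  have h3 : 1 <= expR (dec * horizon) * expR (- dec * t).
    rewrite -expRD -expR0 ler_expR mulNr -mulrBr mulr_ge0 ?subr_ge0//; exact: ltW.
  have h4 : 0 <= (peakN + peakU + M) * E by lra.
  have := ler_wpM2r h4 h3; lra.
have t2t : t2 <= t by rewrite (le_trans t2T)// ltW.
have := @gronwall R (fun s => W s + mu * U s) (fun s => W' s + mu * U' s) (- dec) 0 t2 t t2t.
have ds s : t2 <= s <= t -> is_derive s (1 : R) (fun s => W s + mu * U s) (W' s + mu * U' s).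
  move=> /andP[ts _]; have s0 := lt_le_trans t20 ts.
  exact: (is_derive_addf (tr_dW tr s0) (is_derive_mulCf mu (tr_dU tr s0))).
have h1 s : t2 < s < t -> is_derive s (1 : R) (fun s => W s + mu * U s) (W' s + mu * U' s).
  by move=> /andP[a b]; apply: ds; rewrite !ltW.
have h2 s : t2 < s < t -> W' s + mu * U' s <= - dec * (W s + mu * U s - 0).
  by move=> _; rewrite subr0 mulNr; exact: tr_dec tr _.
have h3 : {within `[t2, t], continuous (fun s => W s + mu * U s)}.
  by apply: within_continuousW => s /ds d; exact: is_derive_continuous d.
move=> /(_ h1 h2 h3); rewrite !subr0 => h4.
have h5 : W t + mu * U t <= expR (dec * horizon) * expR (- dec * t) *
    ((lowW + mu * peakU) * E).
  apply: (le_trans h4); apply: ler_pM; last exact: Et2.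
  - exact: expR_ge0.
  - by rewrite addr_ge0 ?(tr_W0 tr)// mulr_ge0 ?(tr_U0 tr)// ltW.
  - rewrite -expRD ler_expR; have := ler_wpM2l (ltW dec_gt0) t2T; lra.
have h6 : ga t ^+ 2 + U t <= (2 / rho + mu^-1) * (W t + mu * U t).
  have := tr_gaW tr t; have : 0 <= 2 / rho * (mu * U t).
    by apply: mulr_ge0; [exact: divr_ge0 (ltW _) (ltW _)|apply: mulr_ge0; [exact: ltW|exact: tr_U0 tr _]].
  have : 0 <= mu^-1 * W t by rewrite mulr_ge0 ?(tr_W0 tr)// invr_ge0 ltW.
  have : mu^-1 * (mu * U t) = U t by rewrite mulrA mulVf ?mul1r// gt_eqF.
  lra.
apply: (le_trans h6); apply: (le_trans (ler_wpM2l (ltW M0) h5)).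
have X0 : 0 <= expR (dec * horizon) * expR (- dec * t).
  by rewrite mulr_ge0 ?expR_ge0.
have := ler_wpM2l X0 NE0; rewrite /M mulr0; lra.
Qed.

End Curve.
End Transient.

(** * The dynamics in adapted coordinates *)

Section Problem.
Variables (R : realType) (n m k : nat).
Variables (f : 'rV[R]_n -> R) (h : 'rV[R]_n -> 'rV[R]_m).
Variables (q : 'rV[R]_n -> 'rV[R]_k) (Psi : 'rV[R]_(m + k) -> 'rV[R]_n).
Variables (qlow mlow rho LP LS L1 L2 : R) (xs : 'rV[R]_n) (ls : 'rV[R]_m).
Hypothesis f_diff : forall x, differentiable f x.
Hypothesis h_diff : forall x, differentiable h x.
Hypothesis q_diff : forall x, differentiable q x.
Hypothesis qlow_gt0 : 0 < qlow.
Hypothesis Q_lower : forall x, psd (gram q x - qlow%:M).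
Hypothesis q_orth : forall x, ('J q x)^T *m 'J h x = 0.
Hypothesis Phi_diff : forall x, differentiable (coords h q) x.
Hypothesis Psi_diff : forall y, differentiable Psi y.
Hypothesis PhiK : cancel (coords h q) Psi.
Hypothesis PsiK : cancel Psi (coords h q).
Hypothesis mlow_gt0 : 0 < mlow.
Hypothesis gram_lower : forall x, psd (gram h x - mlow%:M).
Hypothesis rho_gt0 : 0 < rho.
Local Notation ft := (fun eta => f (Psi (row_mx 0 eta))).
Hypothesis f_sc : strongly_convex rho ft.
Hypothesis LP0 : 0 <= LP.
Hypothesis Phi_lip : elipschitz LP (coords h q).
Hypothesis LS_gt0 : 0 < LS.
Let LS0 : 0 <= LS. Proof. exact: ltW. Qed.
Hypothesis Psi_lip : elipschitz LS Psi.
Hypothesis L1_gt0 : 0 < L1.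
Hypothesis tan_lip : forall (y : 'rV[R]_m) (eta : 'rV[R]_k),
  enorm (grad f (Psi (row_mx y eta)) *m 'J q (Psi (row_mx y eta)) -
         grad f (Psi (row_mx 0 eta)) *m 'J q (Psi (row_mx 0 eta))) <= L1 * enorm y.
Hypothesis phi_lip : elipschitz L2 (phi f h).
Hypothesis L2_gt0 : 0 < L2.
Hypothesis ls_mult : lagrange_multiplier f h xs ls.

Lemma h_lip : elipschitz LP h.
Proof.
move=> x y; apply: le_trans (Phi_lip x y).
by rewrite /coords opp_row_mx add_row_mx enorm_lrow_mx.
Qed.

Lemma q_lip : elipschitz LP q.
Proof.
move=> x y; apply: le_trans (Phi_lip x y).
by rewrite /coords opp_row_mx add_row_mx enorm_rrow_mx.
Qed.

Lemma h_orth x : ('J h x)^T *m 'J q x = 0.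
Proof. by rewrite -[LHS]trmxK trmx_mul trmxK q_orth trmx0. Qed.

Lemma phi_gram x : phi f h x *m gram h x = - (grad f x *m 'J h x).
Proof.
rewrite /phi mulNmx mulmxKV//.
exact: psd_gap_unit mlow_gt0 (gram_lower x).
Qed.

Lemma phi_xs : phi f h xs = ls.
Proof.
have [/eqP hl _] := ls_mult; rewrite addr_eq0 in hl.
rewrite /phi (eqP hl) mulNmx -mulmxA -/(gram h xs) mulNmx opprK mulmxK//.
exact: psd_gap_unit mlow_gt0 (gram_lower xs).
Qed.

Lemma ft_diff e : differentiable ft e.
Proof.
apply: (@differentiable_comp _ _ _ _ (fun e : 'rV[R]_k => Psi (row_mx 0 e)) f).
  apply: (@differentiable_comp _ _ _ _ (fun e : 'rV[R]_k => row_mx (0 : 'rV[R]_m) e) Psi).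
    exact: embed_differentiable.
  exact: Psi_diff.
exact: f_diff.
Qed.

(** The inverse chart maps the direction [(0, w Q)] to [w ('J q)^T]: the
    differential of the chart sends the latter to its [h]-part, which vanishes
    by orthogonality, and to its [q]-part [w Q]. *)
Lemma grad_reduced e : let p := Psi (row_mx 0 e) in
  grad f p *m 'J q p = grad ft e *m gram q p.
Proof.
move=> p.
suff key w : dot (grad f p *m 'J q p) w = dot (grad ft e *m gram q p) w.
  apply/eqP; rewrite -subr_eq0; apply/eqP/enorm_eq0/eqP.
  rewrite -sqrf_eq0 enorm_sqr {1}(dotDl) dotNl; apply/eqP.
  by rewrite key subrr.
set u := w *m ('J q p)^T.
rewrite dot_mulmx -/u -derive_grad//.
rewrite dot_mulmx gramT dotC -[RHS]dotC -derive_grad; last exact: ft_diff.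
rewrite (@derive_chain _ _ _ _ f (fun e : 'rV[R]_k => Psi (row_mx 0 e))); last 2 first.
- apply: (@differentiable_comp _ _ _ _ (fun e : 'rV[R]_k => row_mx (0 : 'rV[R]_m) e) Psi).
    exact: embed_differentiable.
  exact: Psi_diff.
- exact: f_diff.
rewrite (@derive_chain _ _ _ _ Psi (fun e : 'rV[R]_k => row_mx (0 : 'rV[R]_m) e)); last 2 first.
- exact: embed_differentiable.
- exact: Psi_diff.
rewrite derive_embed -/p; congr ('D_ _ f p).
have Phip : coords h q p = row_mx 0 e by rewrite PsiK.
have -> : row_mx 0 (w *m gram q p) = 'D_u (coords h q) p.
  rewrite jacobian_row_mx// !deriveEjacobian// /u -!mulmxA q_orth mulmx0.
  by rewrite /gram.
rewrite -Phip -derive_chain//.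
by rewrite (_ : (fun z => _) = id) ?derive_id//; apply/funext => z; rewrite PhiK.
Qed.

Let es := q xs.

Lemma row_mx_opt : row_mx 0 es = coords h q xs.
Proof. by rewrite /coords; have [_ ->] := ls_mult. Qed.

Lemma grad_reduced_opt : grad ft es = 0.
Proof.
have := grad_reduced es; rewrite /= row_mx_opt PhiK.
have [/eqP hl _] := ls_mult; rewrite addr_eq0 in hl.
rewrite (eqP hl) mulNmx -mulmxA h_orth mulmx0 oppr0 => /esym g0.
have := mulmxK (psd_gap_unit qlow_gt0 (Q_lower xs)) (grad ft es).
by rewrite g0 mul0mx => /esym.
Qed.

Definition vel x lam : 'rV[R]_n := - grad f x - lam *m ('J h x)^T.

Lemma vel_normal x lam : vel x lam *m 'J h x = (phi f h x - lam) *m gram h x.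
Proof. by rewrite mulmxBl mulNmx mulmxBl phi_gram -mulmxA. Qed.

Lemma vel_tangent x lam : vel x lam *m 'J q x = - (grad f x *m 'J q x).
Proof. by rewrite mulmxBl mulNmx -mulmxA h_orth mulmx0 subr0. Qed.

Local Notation g x := (grad ft (q x)).

(** The tangential velocity is the one of a gradient descent of the reduced cost
    in the metric of the feasible point with the same [eta], up to an error
    controlled by the violation. *)
Lemma vel_tangent_split x lam : exists2 e, vel x lam *m 'J q x =
    - (g x *m gram q (Psi (row_mx 0 (q x)))) - e & enorm e <= L1 * enorm (h x).
Proof.
exists (grad f x *m 'J q x - g x *m gram q (Psi (row_mx 0 (q x)))).
  by rewrite vel_tangent opprB addrA addNr add0r.
by rewrite -grad_reduced; have := tan_lip (h x) (q x); rewrite -/(coords h q x) PhiK.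
Qed.

Lemma reduced_descent x lam : dot (g x) (vel x lam *m 'J q x) <=
  - (qlow * enorm (g x) ^+ 2) + L1 * enorm (h x) * enorm (g x).
Proof.
have [e -> he] := vel_tangent_split x lam.
rewrite dotDr !dotNr -(dotC (g x *m _)).
have := psd_gap (g x) (Q_lower (Psi (row_mx 0 (q x)))); rewrite -enorm_sqr => h1.
have h2 : - dot (g x) e <= L1 * enorm (h x) * enorm (g x).
  rewrite -dotNr (le_trans (dot_le _ _))// enormN mulrC.
  by rewrite ler_wpM2r ?enorm_ge0.
lra.
Qed.

Lemma tangent_speed x lam : enorm (vel x lam *m 'J q x) <=
  LP ^+ 2 * enorm (g x) + L1 * enorm (h x).
Proof.
have [e -> he] := vel_tangent_split x lam.
rewrite (le_trans (enormBD _ _))// enormN lerD//.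
by apply: enorm_mulmx_gram => //; exact: q_lip.
Qed.

Lemma state_dist x :
  enorm (x - xs) <= LS * (enorm (h x) + enorm (q x - es)).
Proof.
rewrite -{1}(PhiK x) -{1}(PhiK xs) (le_trans (Psi_lip _ _))//.
rewrite ler_wpM2l// -row_mx_opt /coords opp_row_mx add_row_mx oppr0 addr0.
exact: enorm_row_mx_le.
Qed.

Lemma phi_dist x : enorm (phi f h x - ls) <=
  L2 * LS * (enorm (h x) + enorm (q x - es)).
Proof.
rewrite -phi_xs (le_trans (phi_lip _ _))// -mulrA ler_pM2l//.
exact: state_dist.
Qed.

(** * Energies *)

Definition gbound : R := LP ^+ 2 + mlow.
Local Notation a := gbound.
(** [mix] weighs the energies so that the forcing of [U] by the reduced gradient
    costs half of the dissipation of [W]; [kp_min] lets the dissipation of [U]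
    pay for the disturbance of [W] by the violation, which is [O(1 / kp)]. *)
Definition kphi : R := 2 * (L2 * LS) ^+ 2 * (1 + (rho ^+ 2)^-1).
Definition kdist : R := L1 ^+ 2 / (2 * qlow).
Definition mix : R := qlow / (4 * pi_gain mlow a * kphi).
Definition kp_min : R := 1 + 4 * (kdist + qlow / 4) / (mix * pi_rate mlow a).

Lemma mlow_gbound : mlow <= a.
Proof. by rewrite lerDr sqr_ge0. Qed.

Lemma gram_norm x v : enorm (v *m gram h x) <= a * enorm v.
Proof.
apply: (le_trans (enorm_mulmx_gram _ (h_diff x) h_lip LP0)).
by rewrite ler_wpM2r ?enorm_ge0// lerDl ltW.
Qed.

Lemma kphi_gt0 : 0 < kphi.
Proof.
apply: mulr_gt0; last by rewrite ltr_pwDl// invr_ge0 sqr_ge0.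
by apply: mulr_gt0 => //; apply: exprn_gt0; exact: mulr_gt0.
Qed.

Lemma kdist_ge0 : 0 <= kdist.
Proof. by apply: divr_ge0; [exact: sqr_ge0|rewrite mulr_ge0// ltW]. Qed.

Lemma mix_gt0 : 0 < mix.
Proof.
apply: divr_gt0 => //; apply: mulr_gt0; last exact: kphi_gt0.
by apply: mulr_gt0 => //; exact: pi_gain_gt0 mlow_gt0 mlow_gbound.
Qed.

Lemma kp_min_gt1 : 1 < kp_min.
Proof.
rewrite ltrDl; apply: divr_gt0; last first.
  by apply: mulr_gt0; [exact: mix_gt0|exact: pi_rate_gt0 mlow_gt0 mlow_gbound].
by have := kdist_ge0; have := qlow_gt0; lra.
Qed.

Lemma grad_reduced_dist x : rho * enorm (q x - es) <= enorm (g x).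
Proof. exact: sc_dist f_sc grad_reduced_opt _. Qed.

Lemma sqrD_le (u v : R) : (u + v) ^+ 2 <= 2 * (u ^+ 2 + v ^+ 2).
Proof. have := sqr_ge0 (u - v); lra. Qed.

Lemma phi_dist_sqr x : enorm (phi f h x - ls) ^+ 2 <=
  2 * (L2 * LS) ^+ 2 * (enorm (h x) ^+ 2 + enorm (q x - es) ^+ 2).
Proof.
have LL0 : 0 <= L2 * LS by rewrite ltW// mulr_gt0.
apply: (@le_trans _ _ ((L2 * LS * (enorm (h x) + enorm (q x - es))) ^+ 2)).
  apply: lerXn2r; rewrite ?nnegrE ?enorm_ge0 ?phi_dist//.
  by rewrite mulr_ge0 ?addr_ge0 ?enorm_ge0.
rewrite exprMn -mulrA [2 * _]mulrCA; apply: ler_wpM2l; first exact: sqr_ge0.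
exact: sqrD_le.
Qed.

Lemma phi_dist_grad x : enorm (phi f h x - ls) ^+ 2 <=
  kphi * (enorm (h x) ^+ 2 + enorm (g x) ^+ 2).
Proof.
apply: (le_trans (phi_dist_sqr x)); rewrite /kphi -mulrA.
rewrite -[leRHS]mulrA -[leRHS]mulrA; apply: ler_wpM2l => //.
apply: ler_wpM2l; first exact: sqr_ge0.
have h1 : enorm (q x - es) ^+ 2 <= (rho ^+ 2)^-1 * enorm (g x) ^+ 2.
  rewrite ler_pdivlMl ?exprn_gt0// -exprMn.
  apply: lerXn2r; rewrite ?nnegrE ?enorm_ge0 ?grad_reduced_dist//.
  by rewrite mulr_ge0 ?enorm_ge0// ltW.
have h2 : 0 <= (rho ^+ 2)^-1 * enorm (h x) ^+ 2.
  by rewrite mulr_ge0 ?sqr_ge0// invr_ge0 sqr_ge0.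
have := sqr_ge0 (enorm (g x)); lra.
Qed.

Variables (kp ki : R).
Hypothesis kp_large : kp_min < kp.
Hypothesis ki_gt0 : 0 < ki.
Hypothesis ki_small : ki < mlow * kp ^+ 2.

Lemma kp_gt1 : 1 < kp.
Proof. exact: lt_trans kp_min_gt1 kp_large. Qed.

Lemma kp_gt0 : 0 < kp.
Proof. exact: lt_trans ltr01 kp_gt1. Qed.

Definition kap : R := ki / kp ^+ 2.

Lemma kap_gt0 : 0 < kap.
Proof. by rewrite divr_gt0// exprn_gt0// kp_gt0. Qed.

Lemma kap_lt : kap < mlow.
Proof. by rewrite ltr_pdivrMr ?exprn_gt0 ?kp_gt0. Qed.

(** On trajectories [zdev] is [ki z - ls]; expressed by [x] and the multiplier it
    makes the energies functions of the state. *)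
Definition wdev (lam : 'rV[R]_m) : 'rV[R]_m := lam - ls.
Definition zdev (x : 'rV[R]_n) (lam : 'rV[R]_m) : 'rV[R]_m := lam - ls - kp *: h x.
Definition sdev x lam : R :=
  dot (wdev lam) (wdev lam) + dot (zdev x lam) (zdev x lam).
Definition energyW (x : 'rV[R]_n) : R := ft (q x) - ft es.
Definition energyU x lam : R := piU mlow a kap (wdev lam) (zdev x lam).
Definition energy x lam : R := energyW x + mix / kp * energyU x lam.

Definition dlam x lam : 'rV[R]_m := kp *: (vel x lam *m 'J h x) + ki *: h x.
Definition driftW x lam : R := dot (g x) (vel x lam *m 'J q x).
Definition driftU x lam : R :=
  piU' mlow a kap (wdev lam) (zdev x lam) (dlam x lam) (ki *: h x).
Definition drift x lam : R := driftW x lam + mix / kp * driftU x lam.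

Lemma zdevE x lam : wdev lam - zdev x lam = kp *: h x.
Proof. by rewrite /wdev /zdev opprB addrCA subrr addr0. Qed.

Lemma h_sdev x lam : enorm (h x) ^+ 2 <= 2 / kp ^+ 2 * sdev x lam.
Proof.
have kp0 := kp_gt0; have k20 : 0 < kp ^+ 2 by exact: exprn_gt0.
rewrite mulrAC ler_pdivlMr// mulrC -{1}(gtr0_norm kp0) -exprMn -enormZ -(zdevE x lam).
have := enormBD (wdev lam) (zdev x lam).
have n1 := enorm_ge0 (wdev lam - zdev x lam).
rewrite -(@ler_pXn2r _ 2)// ?nnegrE ?addr_ge0 ?enorm_ge0// => /le_trans; apply.
by rewrite /sdev -!enorm_sqr sqrD_le.
Qed.

Lemma driftU_le x lam : driftU x lam <=
  kp * (- (pi_rate mlow a * sdev x lam) +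
        pi_gain mlow a * enorm (phi f h x - ls) ^+ 2).
Proof.
have kp0 := kp_gt0.
have e1 : ki *: h x = kp *: (kap *: (wdev lam - zdev x lam)).
  rewrite zdevE !scalerA; congr (_ *: _); rewrite /kap; field.
  by rewrite gt_eqF.
have e2 : dlam x lam = kp *: ((phi f h x - ls - wdev lam) *m gram h x +
    kap *: (wdev lam - zdev x lam)).
  rewrite /dlam e1 [RHS]scalerDr vel_normal.
  rewrite (_ : phi f h x - ls - wdev lam = phi f h x - lam)//.
  by rewrite /wdev opprB subrKA.
have piUZ w z v1 v2 : piU' mlow a kap w z (kp *: v1) (kp *: v2) =
    kp * piU' mlow a kap w z v1 v2.
  by rewrite /piU' !dotZl !dotZr; ring.
rewrite /driftU e2 e1 piUZ ler_pM2l// enorm_sqr.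
apply: piU_decay => //; [exact: mlow_gbound|exact: kap_gt0|exact: kap_lt|exact: gramT| |].
- by move=> v; exact: psd_gap.
- by move=> v; exact: gram_norm.
Qed.

Lemma driftW_le x lam : driftW x lam <=
  - (qlow / 2 * enorm (g x) ^+ 2) + kdist * enorm (h x) ^+ 2.
Proof.
apply: (le_trans (reduced_descent x lam)).
have h1 := sqr_ge0 (qlow * enorm (g x) - L1 * enorm (h x)).
have q0 := qlow_gt0.
rewrite -(ler_pM2l q0) /kdist.
rewrite (_ : qlow * (- (qlow / 2 * _) + _) =
   - (qlow ^+ 2 / 2 * enorm (g x) ^+ 2) + L1 ^+ 2 / 2 * enorm (h x) ^+ 2).
  lra.
by field; rewrite gt_eqF.
Qed.

Lemma energyW_ge0 x : 0 <= energyW x.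
Proof. exact: sc_gap_ge0 rho_gt0 f_sc grad_reduced_opt _. Qed.

Lemma energyW_grad x : 2 * rho * energyW x <= enorm (g x) ^+ 2.
Proof. exact: sc_gap_le rho_gt0 f_sc _. Qed.

Lemma energyU_ge x lam : sdev x lam / 4 <= energyU x lam.
Proof. exact: piU_ge mlow_gt0 mlow_gbound kap_gt0 kap_lt _ _. Qed.

Definition kU : R := 1 + mlow / kap.

Lemma kU_gt0 : 0 < kU.
Proof. by rewrite addr_gt0// divr_gt0// kap_gt0. Qed.

Lemma energyU_le x lam : energyU x lam <= kU * sdev x lam.
Proof. exact: piU_le mlow_gt0 mlow_gbound kap_gt0 kap_lt _ _. Qed.

Lemma sdev_ge0 x lam : 0 <= sdev x lam.
Proof. by rewrite addr_ge0 ?dot_ge0. Qed.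

Lemma energyU_ge0 x lam : 0 <= energyU x lam.
Proof. by apply: le_trans (energyU_ge x lam); rewrite divr_ge0 ?sdev_ge0. Qed.

Definition decay : R := Num.min (qlow * rho / 2) (pi_rate mlow a * kp / (2 * kU)).

Lemma decay_gt0 : 0 < decay.
Proof.
rewrite lt_min; apply/andP; split; first by rewrite divr_gt0// mulr_gt0.
apply: divr_gt0; last by rewrite mulr_gt0// kU_gt0.
by apply: mulr_gt0 kp_gt0; exact: pi_rate_gt0 mlow_gt0 mlow_gbound.
Qed.

(** The coupling terms are the forcing of [U] by the reduced gradient, absorbed by
    the choice of [mix], and the terms in [|h x| ^+ 2], which are at most
    [2 / kp ^+ 2] times [sdev] and are absorbed when [kp] exceeds [kp_min]. *)
Lemma drift_le x lam : drift x lam <= - (decay * energy x lam).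
Proof.
have kp0 := kp_gt0; have kp1 := kp_gt1; have q0 := qlow_gt0.
set c0 := pi_rate mlow a; set C0 := pi_gain mlow a.
have c00 : 0 < c0 := pi_rate_gt0 mlow_gt0 mlow_gbound.
have C00 : 0 < C0 := pi_gain_gt0 mlow_gt0 mlow_gbound.
have be0 := mix_gt0; set be := mix in be0.
set S := sdev x lam; have S0 : 0 <= S := sdev_ge0 x lam.
set Y := enorm (h x) ^+ 2; set G2 := enorm (g x) ^+ 2.
have hW : driftW x lam <= - (qlow / 2 * G2) + kdist * Y := driftW_le x lam.
have hp : enorm (phi f h x - ls) ^+ 2 <= kphi * (Y + G2) := phi_dist_grad x.
have hU : be / kp * driftU x lam <= - (be * c0 * S) + qlow / 4 * (Y + G2).
  have bk : 0 < be / kp by rewrite divr_gt0.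
  have := ler_wpM2l (ltW bk) (driftU_le x lam).
  rewrite -/c0 -/C0 -/S mulrA divfK ?gt_eqF// => /le_trans; apply.
  rewrite mulrDr mulrN mulrA lerD2l.
  have e1 : be * C0 * kphi = qlow / 4.
    rewrite /be /mix -/C0; have := kphi_gt0 => k0.
    by field; rewrite !gt_eqF.
  rewrite -e1 (_ : be * C0 * kphi * (Y + G2) = be * (C0 * (kphi * (Y + G2)))); last by ring.
  apply: ler_wpM2l; first exact: ltW.
  by apply: ler_wpM2l; first exact: ltW.
have hY : Y <= 2 / kp ^+ 2 * S := h_sdev x lam.
have k20 : 0 < kp ^+ 2 by exact: exprn_gt0.
have kk : 4 * (kdist + qlow / 4) <= be * c0 * kp ^+ 2.
  have bc0 : 0 < be * c0 by rewrite mulr_gt0.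
  have : 4 * (kdist + qlow / 4) / (be * c0) <= kp ^+ 2.
    have := kp_large; rewrite /kp_min -/be -/c0 => h1.
    apply: (@le_trans _ _ kp); first lra.
    by rewrite expr2; apply: ler_peMl; exact: ltW.
  by rewrite ler_pdivrMr// [leRHS]mulrC.
have hYS : (kdist + qlow / 4) * Y <= be * c0 / 2 * S.
  have kd : 0 <= kdist + qlow / 4 by have := kdist_ge0; lra.
  apply: (le_trans (ler_wpM2l kd hY)).
  rewrite mulrA; apply: ler_wpM2r => //.
  rewrite mulrA ler_pdivrMr//; lra.
have hr : decay * energy x lam <= qlow / 4 * G2 + be * c0 / 2 * S.
  have W0 := energyW_ge0 x; have U0 := energyU_ge0 x lam.
  rewrite /energy mulrDr; apply: lerD.
    apply: (@le_trans _ _ (qlow * rho / 2 * energyW x)).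
      by rewrite ler_wpM2r// ge_min lexx.
    by have := energyW_grad x; rewrite -/G2 => /(ler_wpM2l (ltW q0)); lra.
  apply: (@le_trans _ _ (c0 * kp / (2 * kU) * (be / kp * energyU x lam))).
    apply: ler_wpM2r; last by rewrite ge_min lexx orbT.
    by apply: mulr_ge0 => //; apply: divr_ge0; exact: ltW.
  have kU0 := kU_gt0.
  rewrite (_ : c0 * kp / (2 * kU) * _ = be * c0 / 2 * (energyU x lam / kU)); last first.
    by field; rewrite !gt_eqF.
  apply: ler_wpM2l; first by rewrite divr_ge0// ltW// mulr_gt0.
  by rewrite ler_pdivrMr// mulrC; exact: energyU_le.
rewrite /drift -/be; lra.
Qed.

(** * Existence of trajectories *)

Local Notation out x z := (pi_output h kp ki x z).

(** The factor [th] lets the same computations serve for trajectories and for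
    those of the slowed field. *)
Section Flow.
Variables (x : R -> 'rV[R]_n) (z : R -> 'rV[R]_m) (th t : R).
Local Notation lam := (fun s => out (x s) (z s)).
Hypothesis dx : is_derive t (1 : R) x (th *: vel (x t) (lam t)).
Hypothesis dz : is_derive t (1 : R) z (th *: h (x t)).

Lemma flow_h : is_derive t (1 : R) (fun s => h (x s))
  (th *: (vel (x t) (lam t) *m 'J h (x t))).
Proof.
rewrite scalemxAl -deriveEjacobian//.
exact: (is_derive_comp_curve (h_diff _) dx).
Qed.

Lemma flow_q : is_derive t (1 : R) (fun s => q (x s))
  (th *: (vel (x t) (lam t) *m 'J q (x t))).
Proof.
rewrite scalemxAl -deriveEjacobian//.
exact: (is_derive_comp_curve (q_diff _) dx).
Qed.

Lemma flow_energyW : is_derive t (1 : R) (fun s => energyW (x s))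
  (th * driftW (x t) (lam t)).
Proof.
have := is_derive_subf (is_derive_comp_curve (ft_diff _) flow_q)
  (is_derive_constf (ft es) t).
rewrite subr0 derive_grad; last exact: ft_diff.
by rewrite dotZr.
Qed.

Lemma flow_lam : is_derive t (1 : R) lam (th *: dlam (x t) (lam t)).
Proof.
have := is_derive_addf
  (is_derive_scalev (is_derive_constf kp t) flow_h)
  (is_derive_scalev (is_derive_constf ki t) dz).
rewrite !scale0r !add0r (_ : _ + _ = th *: dlam (x t) (lam t)) //.
by rewrite /dlam scalerDr !scalerA (mulrC th kp) (mulrC th ki).
Qed.

Lemma flow_energyU : is_derive t (1 : R) (fun s => energyU (x s) (lam s))
  (th * driftU (x t) (lam t)).
Proof.
have hw : is_derive t (1 : R) (fun s => wdev (lam s)) (th *: dlam (x t) (lam t)).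
  by have := is_derive_subf flow_lam (is_derive_constf ls t); rewrite subr0.
have hz : is_derive t (1 : R) (fun s => zdev (x s) (lam s)) (th *: (ki *: h (x t))).
  have := is_derive_subf hw (is_derive_scalev (is_derive_constf kp t) flow_h).
  rewrite scale0r add0r (_ : _ - _ = th *: (ki *: h (x t))) //.
  rewrite /dlam scalerDr !scalerA (mulrC th kp) addrAC subrr add0r.
  by [].
have <- : piU' mlow a kap (wdev (lam t)) (zdev (x t) (lam t))
    (th *: dlam (x t) (lam t)) (th *: (ki *: h (x t))) = th * driftU (x t) (lam t).
  by rewrite /driftU /piU' !dotZl !dotZr; ring.
exact: (piU_derive mlow a kap hw hz).
Qed.

Lemma flow_energy : is_derive t (1 : R) (fun s => energy (x s) (lam s))
  (th * drift (x t) (lam t)).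
Proof.
have := is_derive_addf flow_energyW (is_derive_mulCf (mix / kp) flow_energyU).
by rewrite mulrCA -mulrDr.
Qed.

End Flow.

Lemma mix_kp_gt0 : 0 < mix / kp.
Proof. by apply: divr_gt0; [exact: mix_gt0|exact: kp_gt0]. Qed.

Lemma energy_ge0 x lam : 0 <= energy x lam.
Proof. by rewrite addr_ge0 ?energyW_ge0// mulr_ge0 ?energyU_ge0// ltW// mix_kp_gt0. Qed.

Lemma energyW_le_energy x lam : energyW x <= energy x lam.
Proof. by rewrite lerDl mulr_ge0 ?energyU_ge0// ltW// mix_kp_gt0. Qed.

Lemma sdev_le_energy x lam : sdev x lam <= 4 * kp / mix * energy x lam.
Proof.
have kp0 := kp_gt0; have mx0 := mix_gt0.
have mk : 0 < mix / kp by rewrite divr_gt0.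
have h1 := energyU_ge x lam.
have h2 : mix / kp * energyU x lam <= energy x lam by rewrite lerDr energyW_ge0.
have := ler_wpM2l (ltW mk) h1 => h3; have h4 := le_trans h3 h2.
have k0 : 0 <= 4 * kp / mix by apply: divr_ge0; [apply: mulr_ge0|]; exact: ltW.
have := ler_wpM2l k0 h4.
rewrite (_ : 4 * kp / mix * (mix / kp * (sdev x lam / 4)) = sdev x lam) //.
by field; rewrite (gt_eqF kp0) (gt_eqF mx0).
Qed.

Lemma qdist_energyW x : enorm (q x - es) ^+ 2 <= 2 / rho * energyW x.
Proof.
have := sc_gap f_sc grad_reduced_opt (q x); rewrite -/(energyW x) => h1.
have r0 : 0 <= 2 / rho by rewrite divr_ge0// ltW.
have := ler_wpM2l r0 h1.
by rewrite (_ : 2 / rho * (rho / 2 * _) = enorm (q x - es) ^+ 2)//; field; rewrite gt_eqF.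
Qed.

Lemma le_1sqr (u A : R) : u ^+ 2 <= A -> u <= 1 + A.
Proof. have := sqr_ge0 (u - 1 / 2); lra. Qed.

(** The energy controls the violation and the distance of the reduced variable,
    hence [x] through the chart, and then [z] through [zdev]. *)
Lemma energy_bounded E : exists r, 0 < r /\ forall x z,
  energy x (out x z) <= E -> `|x| <= r /\ `|z| <= r.
Proof.
have kp0 := kp_gt0; have mx0 := mix_gt0.
pose S := 4 * kp / mix * `|E|.
pose H := 1 + 2 / kp ^+ 2 * S; pose Q := 1 + 2 / rho * `|E|.
pose r1 := `|xs| + LS * (H + Q); pose r2 := (1 + S + enorm ls) / ki.
have k0 : 0 <= 4 * kp / mix by apply: divr_ge0; [apply: mulr_ge0|]; exact: ltW.
have k2 : 0 <= 2 / kp ^+ 2 by apply: divr_ge0 => //; apply: exprn_ge0; exact: ltW.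
have rh : 0 <= 2 / rho by apply: divr_ge0 => //; exact: ltW.
have S0 : 0 <= S by exact: mulr_ge0.
have H0 : 0 <= H by apply: addr_ge0 => //; exact: mulr_ge0.
have Q0 : 0 <= Q by apply: addr_ge0 => //; exact: mulr_ge0.
have r10 : 0 <= r1 by apply: addr_ge0 => //; apply: mulr_ge0 => //; exact: addr_ge0.
have r20 : 0 <= r2.
  by apply: divr_ge0; [rewrite !addr_ge0 ?enorm_ge0|exact: ltW].
exists (r1 + r2 + 1); split; first lra.
move=> x z hE; have {}hE : energy x (out x z) <= `|E| by exact: le_trans (ler_norm _).
have hS : sdev x (out x z) <= S.
  apply: (le_trans (sdev_le_energy _ _)); exact: ler_wpM2l.
have hH : enorm (h x) <= H.
  apply: le_1sqr; apply: (le_trans (h_sdev x (out x z))).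
  exact: ler_wpM2l.
have hQ : enorm (q x - es) <= Q.
  apply: le_1sqr; apply: (le_trans (qdist_energyW x)).
  apply: ler_wpM2l => //.
  exact: le_trans (energyW_le_energy _ _) hE.
have hx : `|x| <= r1.
  rewrite -(subrK xs x) addrC (le_trans (ler_normD _ _))// lerD2l.
  apply: (le_trans (norm_le_enorm _)); apply: (le_trans (state_dist x)).
  by apply: ler_wpM2l => //; exact: lerD.
split; first lra.
have hz : ki *: z = zdev x (out x z) + ls.
  by rewrite /zdev /pi_output addrAC subrK addrAC subrr add0r.
have nz : enorm (zdev x (out x z)) <= 1 + S.
  apply: le_1sqr; rewrite enorm_sqr; apply: le_trans hS.
  by rewrite lerDr dot_ge0.
have : ki * enorm z <= 1 + S + enorm ls.
  rewrite -{1}(gtr0_norm ki_gt0) -enormZ hz (le_trans (enormD _ _))//.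
  by rewrite lerD2r.
rewrite mulrC -ler_pdivlMr// -/r2 => h1.
have := norm_le_enorm z; lra.
Qed.

Hypothesis f_smooth : smooth f.
Hypothesis h_smooth : smooth h.

Let Fld (X : 'rV[R]_(n + m)) : 'rV[R]_(n + m) :=
  row_mx (vel (lsubmx X) (out (lsubmx X) (rsubmx X))) (h (lsubmx X)).

Lemma velE x lam j : vel x lam 0 j = - 'D_(delta_mx 0 j) f x +
  - \sum_(i < m) lam 0 i * 'D_(delta_mx 0 j) h x 0 i.
Proof.
rewrite /vel [LHS]mxE [X in X + _]mxE [grad _ _ _ _]mxE [X in _ + X]mxE.
congr (_ - _); rewrite [LHS]mxE; apply: eq_bigr => i _.
by rewrite [(_^T) _ _]mxE jacobianE.
Qed.

Lemma pi_field_lip i : lip_cubes (fun X => Fld X 0 i).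
Proof.
case: (split_ordP i) => j ->; rewrite /Fld; last first.
  under eq_fun do rewrite row_mxEr.
  exact: (lip_cubes_lsub m (smooth_coord_lip_cubes j h_smooth)).
have -> : (fun X : 'rV[R]_(n + m) => row_mx (vel (lsubmx X) (out (lsubmx X) (rsubmx X)))
      (h (lsubmx X)) 0 (lshift m j)) =
    (fun X => - 'D_(delta_mx 0 j) f (lsubmx X) +
      - \sum_(i < m) (kp * h (lsubmx X) 0 i + ki * X 0 (rshift n i)) *
         'D_(delta_mx 0 j) h (lsubmx X) 0 i).
  apply/funext => X; rewrite row_mxEl velE; congr (_ - _).
  by apply: eq_bigr => l _; rewrite !mxE.
apply: lip_cubesD; apply: lip_cubesN.
  exact: (lip_cubes_lsub m (smooth_lip_cubes (@smooth_derive R _ _ f (delta_mx 0 j) f_smooth))).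
apply: lip_cubes_sum => l; apply: lip_cubesM; last first.
  exact: (lip_cubes_lsub m (smooth_coord_lip_cubes l (@smooth_derive R _ _ h (delta_mx 0 j) h_smooth))).
apply: lip_cubesD; apply: lip_cubesM; try exact: lip_cubes_cst.
  exact: (lip_cubes_lsub m (smooth_coord_lip_cubes l h_smooth)).
exact: lip_cubes_coord.
Qed.

Lemma is_derive_lsub (X : R -> 'rV[R]_(n + m)) u v (t : R) :
  is_derive t (1 : R) X (row_mx u v) ->
  is_derive t (1 : R) (fun s => lsubmx (X s)) u /\
  is_derive t (1 : R) (fun s => rsubmx (X s)) v.
Proof.
move=> dX; split; apply: is_derive_rowP => i.
  have := is_derive_coord (lshift m i) dX; rewrite row_mxEl.
  by under [X in _ -> is_derive _ _ X _]eq_fun do rewrite mxE.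
have := is_derive_coord (rshift n i) dX; rewrite row_mxEr.
by under [X in _ -> is_derive _ _ X _]eq_fun do rewrite mxE.
Qed.

Lemma pi_solution_exists x0 z0 : exists x z,
  [/\ pi_solution f h kp ki x z, x 0 = x0 & z 0 = z0].
Proof.
have [r [r0 hr]] := energy_bounded (energy x0 (out x0 z0)).
have [X [th [X00 hX]]] := slowed_flow (row_mx x0 z0) r0 pi_field_lip.
pose x t := lsubmx (X t); pose z t := rsubmx (X t).
have x00 : x 0 = x0 by rewrite /x X00 row_mxKl.
have z00 : z 0 = z0 by rewrite /z X00 row_mxKr.
have dxz (t : R) : 0 <= t ->
    is_derive t (1 : R) x (th t *: vel (x t) (out (x t) (z t))) /\
    is_derive t (1 : R) z (th t *: h (x t)).
  move=> t0; have [d _ _] := hX t t0.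
  by rewrite /Fld scale_row_mx in d; exact: is_derive_lsub.
have th1 t : 0 <= t -> th t = 1.
  move=> t0; have [_ _] := hX t t0; apply.
  have [] := hr (x t) (z t).
    rewrite -x00 -z00.
    apply: (@nincr_derive_cc _ (fun s => energy (x s) (out (x s) (z s)))
      (fun s => th s * drift (x s) (out (x s) (z s))) 0 t t0).
      by move=> s /andP[s0 _]; have [d1 d2] := dxz s s0; exact: flow_energy.
    move=> s /andP[s0 _]; have [_ th0 _] := hX s (ltW s0).
    apply: mulr_ge0_le0 => //; apply: (le_trans (drift_le _ _)).
    by rewrite oppr_le0 mulr_ge0 ?energy_ge0// ltW// decay_gt0.
  move=> h1 h2; apply: norm_le_coord => [|i]; first exact: ltW.
  rewrite -(hsubmxK (X t)); case: (split_ordP i) => j ->.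
    by rewrite row_mxEl (le_trans (coord_le_norm _ _)).
  by rewrite row_mxEr (le_trans (coord_le_norm _ _)).
exists x, z; split=> //; split.
- apply: continuous_in_subspaceT => t; rewrite inE/= in_itv/= andbT => t0.
  by have [d _] := dxz t t0; exact: is_derive_continuous d.
- apply: continuous_in_subspaceT => t; rewrite inE/= in_itv/= andbT => t0.
  by have [_ d] := dxz t t0; exact: is_derive_continuous d.
- move=> t t0; have [d1 d2] := dxz t (ltW t0).
  by rewrite th1 ?ltW// !scale1r in d1 d2.
Qed.

(** * The reduced variable does not overshoot *)

Hypothesis Psi_smooth : smooth Psi.

Lemma embed_Psi_continuous (W : normedModType R) (F : 'rV[R]_(m + k) -> W) :
  continuous F -> continuous (fun e : 'rV[R]_k => F (row_mx 0 e)).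
Proof.
move=> cF e; apply: (@continuous_comp _ _ _ (fun e : 'rV[R]_k => row_mx (0 : 'rV[R]_m) e) F).
  exact: differentiable_continuous (embed_differentiable _ _).
exact: cF.
Qed.

(** Continuity of the reduced gradient is needed for the clock of
    [reduced_overshoot], a primitive of its norm. *)
Lemma grad_ft_continuous : continuous (fun e => grad ft e).
Proof.
apply: continuous_row => i.
have -> : (fun e => grad ft e 0 i) = fun e => dot (grad f (Psi (row_mx 0 e)))
    ('D_(row_mx 0 (delta_mx 0 i)) Psi (row_mx 0 e)).
  apply/funext => e; rewrite mxE.
  rewrite (@derive_chain _ _ _ _ f (fun e : 'rV[R]_k => Psi (row_mx 0 e))); last 2 first.
  - apply: (@differentiable_comp _ _ _ _ (fun e : 'rV[R]_k => row_mx (0 : 'rV[R]_m) e) Psi).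
      exact: embed_differentiable.
    exact: Psi_diff.
  - exact: f_diff.
  rewrite (@derive_chain _ _ _ _ Psi (fun e : 'rV[R]_k => row_mx (0 : 'rV[R]_m) e)); last 2 first.
  - exact: embed_differentiable.
  - exact: Psi_diff.
  by rewrite derive_embed derive_grad.
have cf : continuous (grad f).
  apply: continuous_row => j.
  rewrite (_ : (fun x => _) = 'D_(delta_mx 0 j) f).
    by have [_] := f_smooth 1%N; apply.
  by apply/funext => x; rewrite mxE.
apply: continuous_dot.
  apply: (@embed_Psi_continuous _ (fun y => grad f (Psi y))).
  move=> y; apply: (@continuous_comp _ _ _ Psi (grad f)); last exact: cf.
  exact: differentiable_continuous.
apply: (@embed_Psi_continuous _ ('D_(row_mx 0 (delta_mx 0 i)) Psi)).
by have [_] := Psi_smooth 1%N; apply.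
Qed.

Section Trajectory.
Variables (x : R -> 'rV[R]_n) (z : R -> 'rV[R]_m).
Hypothesis sol : pi_solution f h kp ki x z.
Local Notation lam := (fun t => out (x t) (z t)).

Lemma traj_derive (t : R) : 0 < t ->
  is_derive t (1 : R) x (1 *: vel (x t) (lam t)) /\
  is_derive t (1 : R) z (1 *: h (x t)).
Proof. by move=> t0; have [_ _ /(_ t t0)] := sol; rewrite !scale1r. Qed.

Lemma traj_q (t : R) : 0 < t ->
  is_derive t (1 : R) (fun s => q (x s)) (vel (x t) (lam t) *m 'J q (x t)).
Proof. by move=> /traj_derive[d1 _]; have := flow_q d1; rewrite scale1r. Qed.

Lemma traj_W (t : R) : 0 < t ->
  is_derive t (1 : R) (fun s => energyW (x s)) (driftW (x t) (lam t)).
Proof. by move=> /traj_derive[d1 _]; have := flow_energyW d1; rewrite mul1r. Qed.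

Lemma traj_U (t : R) : 0 < t ->
  is_derive t (1 : R) (fun s => energyU (x s) (lam s)) (driftU (x t) (lam t)).
Proof. by move=> /traj_derive[d1 d2]; have := flow_energyU d1 d2; rewrite mul1r. Qed.

Lemma sub_itv (a b : R) : 0 <= a -> `[a, b] `<=` `[0, +oo[%classic.
Proof.
move=> a0 t; rewrite /= !in_itv/= andbT => /andP[at1 _]; exact: le_trans a0 at1.
Qed.

Lemma traj_x_cont (a b : R) : 0 <= a -> {within `[a, b], continuous x}.
Proof.
by move=> a0; have [cx _ _] := sol; apply: continuous_subspaceW cx; exact: sub_itv.
Qed.

Lemma traj_z_cont (a b : R) : 0 <= a -> {within `[a, b], continuous z}.
Proof.
by move=> a0; have [_ cz _] := sol; apply: continuous_subspaceW cz; exact: sub_itv.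
Qed.

Lemma traj_cont (W : topologicalType) (F : 'rV[R]_n -> W) (a b : R) : 0 <= a ->
  continuous F -> {within `[a, b], continuous (fun t => F (x t))}.
Proof.
move=> a0 cF t; apply: continuous_comp; last exact: cF.
exact: traj_x_cont.
Qed.

Lemma traj_h_cont (a b : R) : 0 <= a ->
  {within `[a, b], continuous (fun t => h (x t))}.
Proof. by move=> a0; apply: traj_cont => // y; exact: differentiable_continuous. Qed.

Lemma traj_lam_cont (a b : R) : 0 <= a -> {within `[a, b], continuous lam}.
Proof.
move=> a0; have h1 := @traj_h_cont a b a0; have h2 := @traj_z_cont a b a0.
rewrite (_ : lam = fun t => 0 + kp *: h (x t) + ki *: z t); last first.
  by apply/funext => t; rewrite add0r.
apply: continuous_lincomb h2; apply: continuous_lincomb h1; exact: cst_continuous.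
Qed.

Lemma traj_wdev_cont (a b : R) : 0 <= a ->
  {within `[a, b], continuous (fun t => wdev (lam t))}.
Proof.
move=> a0; rewrite (_ : (fun t => wdev (lam t)) = fun t => - ls + 1 *: lam t); last first.
  by apply/funext => t; rewrite scale1r addrC.
apply: continuous_lincomb (@traj_lam_cont a b a0); exact: cst_continuous.
Qed.

Lemma traj_zdev_cont (a b : R) : 0 <= a ->
  {within `[a, b], continuous (fun t => zdev (x t) (lam t))}.
Proof.
move=> a0; rewrite (_ : (fun t => zdev (x t) (lam t)) =
    fun t => wdev (lam t) + (- kp) *: h (x t)); last first.
  by apply/funext => t; rewrite scaleNr.
exact: continuous_lincomb (@traj_wdev_cont a b a0) (@traj_h_cont a b a0).
Qed.

Lemma traj_U_cont (a' b : R) : 0 <= a' ->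
  {within `[a', b], continuous (fun t => energyU (x t) (lam t))}.
Proof.
move=> a0; have cw := @traj_wdev_cont a' b a0; have cz := @traj_zdev_cont a' b a0.
rewrite (_ : (fun t => energyU (x t) (lam t)) = fun t => 0 +
    2^-1 * dot (wdev (lam t)) (wdev (lam t)) +
    mlow / (2 * kap) * dot (zdev (x t) (lam t)) (zdev (x t) (lam t)) +
    (- pi_delta mlow a) * dot (wdev (lam t)) (zdev (x t) (lam t))); last first.
  by apply/funext => t; rewrite /energyU /piU; ring.
apply: continuous_combr (continuous_dot cw cz).
apply: continuous_combr (continuous_dot cz cz).
apply: continuous_combr (continuous_dot cw cw).
exact: cst_continuous.
Qed.

End Trajectory.

Definition overshoot_speed : R := LP ^+ 2 + qlow / 2.

(** The half-space of normal [- grad] at [eta] contains the sublevel set through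
    [eta], by convexity, hence the future of the curve and the optimum.  The
    speed is at most [overshoot_speed] times the gradient and its component
    along the normal at least [qlow / 2] times the gradient; so the ratio of the
    two constants bounds the angle, and [length_bound_all] applies. *)
Lemma reduced_overshoot : exists B, 1 <= B /\ forall x z (Y t0 t1 : R),
  pi_solution f h kp ki x z -> 0 < t0 -> t0 <= t1 -> 0 < Y ->
  (forall s, t0 <= s <= t1 -> enorm (h (x s)) <= Y) ->
  (forall s, t0 <= s <= t1 -> 2 * L1 * Y / qlow <= enorm (g (x s))) ->
  enorm (q (x t1) - es) <= B * enorm (q (x t0) - es).
Proof.
have q0 := qlow_gt0; have V0 : 0 < overshoot_speed by rewrite ltr_pwDr ?sqr_ge0// divr_gt0.
set V := overshoot_speed in V0; pose c := qlow / 2 / V.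
have c0 : 0 < c by rewrite !divr_gt0.
have c1 : c <= 1 by rewrite ler_pdivrMr// mul1r lerDr sqr_ge0.
have [C [C0 HC]] := @length_bound_all R k k c c0 c1.
exists (1 + C); split; first lra.
move=> x z Y t0 t1 sol t00 t01 Y0 hY hg.
pose lam t := out (x t) (z t).
pose gn s := enorm (g (x s)).
have gn0 s : t0 <= s <= t1 -> 0 < gn s.
  by move=> /hg; apply: lt_le_trans; rewrite divr_gt0// !mulr_gt0.
have Lg s : t0 <= s <= t1 -> L1 * enorm (h (x s)) <= qlow / 2 * gn s.
  move=> hs; have := ler_wpM2l (ltW L1_gt0) (hY s hs).
  have := hg s hs; rewrite ler_pdivrMr// -/(gn s); lra.
have ts s : t0 <= s <= t1 -> 0 < s by move=> /andP[h1 _]; exact: lt_le_trans h1.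
(* Freezing the gradient before [t0] makes the speed of the clock continuous on
   the whole line. *)
pose gc s := V * gn (Num.max s t0).
have cgc : continuous gc.
  move=> s; apply: cvgM; first exact: cvg_cst.
  have cgx : continuous (fun s => g (x (Num.max s t0))).
    move=> r; have m0 : 0 < Num.max r t0 by rewrite lt_max t00 orbT.
    apply: (@continuous_comp _ _ _ (fun r => x (Num.max r t0)) (fun y => g y)).
      apply: (@continuous_comp _ _ _ (fun r => Num.max r t0) x).
        by apply: continuous_max => //; exact: cst_continuous.
      by have [d _] := traj_derive sol m0; exact: is_derive_continuous d.
    apply: (@continuous_comp _ _ _ q (fun e => grad ft e)).
      exact: differentiable_continuous.
    exact: grad_ft_continuous.
  exact: continuous_enorm cgx s.
have [l [_ dl]] := primitive_exists cgc.
have gcE s : t0 <= s <= t1 -> gc s = V * gn s.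
  by move=> /andP[h1 _]; rewrite /gc (max_idPl h1).
pose gam s := q (x s) - es.
pose dgam s := vel (x s) (lam s) *m 'J q (x s).
pose nu s := - (gn s)^-1 *: g (x s).
have hd s : t0 <= s <= t1 -> dot (g (x s)) (dgam s) <= - (qlow / 2 * gn s ^+ 2).
  move=> hs; apply: (le_trans (reduced_descent _ _)).
  have := ler_wpM2r (ltW (gn0 s hs)) (Lg s hs); rewrite -/(gn s) ; lra.
have dc : descent_curve 1%:M c t0 t1 gam dgam nu l gc.
  split=> [s hs|s hs|s hs|s hs|s t hs st tt].
  - exact: submx1.
  - split; last by apply: dl; rewrite (lt_trans _ (ts s hs))// ltrN10.
    have := is_derive_subf (traj_q sol (ts s hs)) (is_derive_constf es s).
    by rewrite subr0.
  - split; last first.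
      rewrite enormZ normrN ger0_norm ?invr_ge0 ?enorm_ge0//.
      by rewrite mulVf// gt_eqF// gn0.
    rewrite gcE// (le_trans (tangent_speed _ _))//.
    have := Lg s hs; rewrite -/(gn s) /V /overshoot_speed; lra.
  - rewrite gcE// /nu dotZl mulNr.
    have gs := gn0 s hs; rewrite -(ler_pM2l gs).
    rewrite mulrN [X in _ <= - X]mulrA divff ?gt_eqF// mul1r.
    have := hd s hs; rewrite /c (_ : qlow / 2 / V * (V * gn s) = qlow / 2 * gn s).
      lra.
    by field; rewrite gt_eqF.
  - have s01 : t0 <= s <= t1 by rewrite hs (le_trans st).
    rewrite /nu dotZl mulNr oppr_ge0; apply: mulr_ge0_le0.
      by rewrite invr_ge0 ltW// gn0.
    rewrite /gam opprB addrA subrK.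
    apply: (sc_halfspace rho_gt0 f_sc).
    suff : energyW (x t) <= energyW (x s) by rewrite /energyW; lra.
    have sub r : s <= r <= t -> t0 <= r <= t1.
      by move=> /andP[r1 r2]; rewrite (le_trans hs r1) (le_trans r2 tt).
    apply: (@nincr_derive_cc _ (fun r => energyW (x r)) (fun r => driftW (x r) (lam r)) s t st).
      by move=> r /sub/ts r0; exact: traj_W.
    move=> r /andP[r1 r2]; have hr : t0 <= r <= t1 by apply: sub; rewrite !ltW.
    apply: (le_trans (hd r hr)); rewrite oppr_le0; apply: mulr_ge0; last exact: sqr_ge0.
    by rewrite divr_ge0// ltW.
have k0 : kept t0 t1 gam nu 0.
  move=> s hs; rewrite /nu dotZl mulNr oppr_ge0; apply: mulr_ge0_le0.
    by rewrite invr_ge0 ltW// gn0.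
  rewrite /gam sub0r opprB; apply: (sc_halfspace rho_gt0 f_sc).
  have := energyW_ge0 (x s); rewrite /energyW; lra.
have hl := HC 1%:M t0 t1 gam dgam nu l gc t01 (rank_leq_row _) dc k0.
have hc := chord_le_clock dc (lexx t0) t01 (lexx t1).
have := enorm_dist (gam t1) (gam t0); rewrite -/(gam t1) -/(gam t0); lra.
Qed.

(** * Exponential stability *)

Definition cpl : R := kp * (pi_gain mlow a * (2 * (L2 * LS) ^+ 2)).

Lemma traj_transient : exists2 B, 1 <= B & forall x z,
  pi_solution f h kp ki x z ->
  transient qlow rho kdist (2 * L1 / qlow) B (8 / kp ^+ 2) cpl decay (mix / kp)
    (fun t => enorm (q (x t) - es)) (fun t => enorm (h (x t)))
    (fun t => enorm (g (x t))) (fun t => energyW (x t))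
    (fun t => energyU (x t) (out (x t) (z t)))
    (fun t => driftW (x t) (out (x t) (z t)))
    (fun t => driftU (x t) (out (x t) (z t))).
Proof.
have [B [B1 HB]] := reduced_overshoot; exists B => // x z sol.
have kp0 := kp_gt0; have k20 : 0 < kp ^+ 2 by rewrite exprn_gt0.
split.
- by move=> t; exact: enorm_ge0.
- by move=> t; exact: enorm_ge0.
- by move=> t; exact: enorm_ge0.
- by move=> t; exact: energyU_ge0.
- by move=> t; exact: energyW_ge0.
- move=> t; set lam := out _ _.
  apply: (le_trans (h_sdev (x t) lam)).
  have := energyU_ge (x t) lam; have := divr_gt0 (ltr0Sn R 1) k20 => h1 h2.
  by have := ler_wpM2l (ltW h1) h2; lra.
- by move=> t; exact: qdist_energyW.
- by move=> t; exact: (sc_gap_le_dot es rho_gt0 f_sc (q (x t))).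
- by move=> t; exact: energyW_grad.
- by move=> t t0; exact: traj_W.
- by move=> t t0; exact: traj_U.
- by move=> t; exact: driftW_le.
- move=> t; set lam := out _ _.
  apply: (le_trans (driftU_le (x t) lam)); rewrite /cpl -mulrA.
  apply: ler_wpM2l; first exact: ltW.
  rewrite -mulrA; have g0 := ltW (pi_gain_gt0 mlow_gt0 mlow_gbound).
  have := ler_wpM2l g0 (phi_dist_sqr (x t)).
  have := mulr_ge0 (ltW (pi_rate_gt0 mlow_gt0 mlow_gbound)) (sdev_ge0 (x t) lam).
  lra.
- by move=> t; exact: drift_le.
- move=> b; have cd : continuous (fun y => enorm (q y - es)).
    apply: continuous_enorm => y.
    have c1 : {for y, continuous q} by exact: differentiable_continuous.
    have c2 : {for y, continuous (fun _ : 'rV[R]_n => es)} by exact: cst_continuous.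
    exact: cvgB c1 c2.
  exact: (traj_cont sol (lexx 0) cd).
- by move=> b; exact: (traj_U_cont sol (lexx 0)).
- move=> Y t0 t1 t00 t01 Y0 hY hG; apply: (HB x z Y t0 t1 sol t00 t01 Y0 hY).
  by move=> s /hG; rewrite mulrAC.
Qed.

Definition state (x : 'rV[R]_n) (z : 'rV[R]_m) : R :=
  enorm (row_mx (x - xs) (out x z - ls)).

Lemma h_opt : h xs = 0. Proof. by have [] := ls_mult. Qed.

Lemma h_dist x : enorm (h x) <= LP * enorm (x - xs).
Proof. by have := h_lip x xs; rewrite h_opt subr0. Qed.

Definition upK : R := 2 * LS ^+ 2 * (8 / kp ^+ 2 + 1) + 4.
Definition lowC : R := LP ^+ 2 + kU * (3 + 2 * kp ^+ 2 * LP ^+ 2).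

Lemma upK_gt0 : 0 < upK.
Proof.
have k2 : 0 < kp ^+ 2 by rewrite exprn_gt0// kp_gt0.
rewrite ltr_pwDr// mulr_ge0//; first by rewrite mulr_ge0// sqr_ge0.
by rewrite addr_ge0// divr_ge0// ltW.
Qed.

Lemma lowC_gt0 : 0 < lowC.
Proof.
rewrite ltr_wpDl ?sqr_ge0// mulr_gt0 ?kU_gt0// ltr_pwDl//.
exact: mulr_ge0 (mulr_ge0 (ler0n _ _) (sqr_ge0 _)) (sqr_ge0 _).
Qed.

Lemma state_le x z : state x z ^+ 2 <=
  upK * (enorm (q x - es) ^+ 2 + energyU x (out x z)).
Proof.
have kp0 := kp_gt0; have k2 : 0 < kp ^+ 2 by rewrite exprn_gt0.
rewrite /state enorm_row_mx; set lam := out x z.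
have h1 : enorm (lam - ls) ^+ 2 <= 4 * energyU x lam.
  have := energyU_ge x lam; rewrite /sdev enorm_sqr -/(wdev lam).
  by have := dot_ge0 (zdev x lam); lra.
have h2 : enorm (h x) ^+ 2 <= 8 / kp ^+ 2 * energyU x lam.
  apply: (le_trans (h_sdev x lam)).
  have h3 := energyU_ge x lam; have h4 : 0 <= 2 / kp ^+ 2 by rewrite divr_ge0// ltW.
  by have := ler_wpM2l h4 h3; lra.
have h3 : enorm (x - xs) ^+ 2 <= 2 * LS ^+ 2 * (enorm (h x) ^+ 2 + enorm (q x - es) ^+ 2).
  apply: (@le_trans _ _ ((LS * (enorm (h x) + enorm (q x - es))) ^+ 2)).
    by apply: lerXn2r; rewrite ?nnegrE ?enorm_ge0 ?state_dist// mulr_ge0 ?addr_ge0 ?enorm_ge0.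
  rewrite exprMn -mulrA [2 * _]mulrCA; apply: ler_wpM2l; first exact: sqr_ge0.
  exact: sqrD_le.
have L20 : 0 <= 2 * LS ^+ 2 by rewrite mulr_ge0// sqr_ge0.
have U0 := energyU_ge0 x lam; have g0 := sqr_ge0 (enorm (q x - es)).
have h5 := ler_wpM2l L20 h2.
have h6 : 0 <= 2 * LS ^+ 2 * (8 / kp ^+ 2 * enorm (q x - es) ^+ 2).
  by apply: mulr_ge0 => //; apply: mulr_ge0 => //; rewrite divr_ge0// ltW.
have h7 := mulr_ge0 L20 U0.
rewrite /upK; lra.
Qed.

Lemma state_ge x z : enorm (q x - es) ^+ 2 + energyU x (out x z) <=
  lowC * state x z ^+ 2.
Proof.
have kU0 := ltW kU_gt0; rewrite /state enorm_row_mx; set lam := out x z.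
set X := enorm (x - xs) ^+ 2; set D := enorm (lam - ls) ^+ 2.
have X0 : 0 <= X by exact: sqr_ge0.
have D0 : 0 <= D by exact: sqr_ge0.
have lip2 u : u <= LP * enorm (x - xs) -> 0 <= u -> u ^+ 2 <= LP ^+ 2 * X.
  by move=> h1 u0; rewrite -exprMn; apply: lerXn2r; rewrite ?nnegrE// mulr_ge0 ?enorm_ge0.
have h1 : enorm (q x - es) ^+ 2 <= LP ^+ 2 * X by apply: lip2; rewrite ?enorm_ge0 ?q_lip.
have h2 : enorm (h x) ^+ 2 <= LP ^+ 2 * X by apply: lip2; rewrite ?enorm_ge0 ?h_dist.
have h3 : sdev x lam <= 3 * D + 2 * (kp ^+ 2 * enorm (h x) ^+ 2).
  rewrite /sdev -!enorm_sqr -/D.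
  suff : enorm (zdev x lam) ^+ 2 <= 2 * (D + kp ^+ 2 * enorm (h x) ^+ 2) by rewrite /wdev -/D; lra.
  rewrite -exprMn; apply: le_trans (sqrD_le _ _).
  apply: lerXn2r; rewrite ?nnegrE ?enorm_ge0//.
    by rewrite addr_ge0 ?enorm_ge0// mulr_ge0 ?enorm_ge0// ltW// kp_gt0.
  by rewrite -[X in X * _](gtr0_norm kp_gt0) -enormZ; exact: enormBD.
have h4 := ler_wpM2l (sqr_ge0 kp) h2.
have h5 : sdev x lam <= (3 + 2 * kp ^+ 2 * LP ^+ 2) * (X + D).
  have := mulr_ge0 (mulr_ge0 (sqr_ge0 kp) (sqr_ge0 LP)) D0; lra.
have h6 := le_trans (energyU_le x lam) (ler_wpM2l kU0 h5).
have h7 := mulr_ge0 (sqr_ge0 LP) D0.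
rewrite /lowC; lra.
Qed.

Theorem pi_exponentially_stable : globally_exponentially_stable f h kp ki xs ls.
Proof.
split; first exact: pi_solution_exists.
have [B B1 HB] := traj_transient.
have kp0 := kp_gt0; have k20 : 0 < kp ^+ 2 by rewrite exprn_gt0.
have thr0 : 0 < 2 * L1 / qlow by rewrite divr_gt0// mulr_gt0.
have cH0 : 0 < 8 / kp ^+ 2 by rewrite divr_gt0.
have a20 : 0 < cpl.
  rewrite mulr_gt0// mulr_gt0 ?(pi_gain_gt0 mlow_gt0 mlow_gbound)//.
  by rewrite mulr_gt0// exprn_gt0// mulr_gt0.
set dK := decayK qlow rho kdist (2 * L1 / qlow) B (8 / kp ^+ 2) cpl decay (mix / kp).
have dK0 : 0 < dK.
  by apply: decayK_gt0 => //; [exact: kdist_ge0|exact: mix_kp_gt0].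
pose K := upK * dK * lowC.
have K0 : 0 < K by rewrite mulr_gt0 ?lowC_gt0// mulr_gt0// upK_gt0.
exists (1 + K), (decay / 2); split.
- by rewrite lerDl ltW.
- by rewrite divr_gt0// decay_gt0.
- move=> x z sol t t0.
rewrite -/(state (x t) (z t)) -/(state (x 0) (z 0)).
have h1 := @transient_decay R _ _ _ _ _ _ _ _ _ qlow_gt0 rho_gt0 kdist_ge0 thr0 B1 cH0 a20
  decay_gt0 mix_kp_gt0 _ _ _ _ _ _ _ (HB x z sol) t t0.
have s0 u : 0 <= state (x u) (z u) by exact: enorm_ge0.
have h2 : state (x t) (z t) ^+ 2 <= K * expR (- decay * t) * state (x 0) (z 0) ^+ 2.
  apply: (le_trans (state_le _ _)).
  apply: (le_trans (ler_wpM2l (ltW upK_gt0) h1)); rewrite -/dK.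
  have dE : 0 <= upK * (dK * expR (- decay * t)).
    exact: mulr_ge0 (ltW upK_gt0) (mulr_ge0 (ltW dK0) (expR_ge0 _)).
  have := ler_wpM2l dE (state_ge (x 0) (z 0)); rewrite /K; lra.
have e0 := expR_ge0 (- (decay / 2) * t).
rewrite -(@ler_pXn2r _ 2)// ?nnegrE//; last first.
  by rewrite mulr_ge0// mulr_ge0//; lra.
apply: (le_trans h2); rewrite !exprMn; apply: ler_wpM2r; first exact: sqr_ge0.
rewrite (_ : expR (- (decay / 2) * t) ^+ 2 = expR (- decay * t)); last first.
  by rewrite expr2 -expRD; congr expR; lra.
apply: ler_wpM2r; first exact: expR_ge0.
by have := sqr_ge0 K; lra.
Qed.

End Problem.

Theorem theorem3 (R : realType) (n m : nat) (hmn : (m <= n)%N)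
  (f : 'rV[R]_n -> R) (h : 'rV[R]_n -> 'rV[R]_m)
  (q : 'rV[R]_n -> 'rV[R]_(n - m)) (Psi : 'rV[R]_(m + (n - m)) -> 'rV[R]_n)
  (qlow mlow rho_eta L_Phi L_Psi L1 L2 : R)
  (xs : 'rV[R]_n) (ls : 'rV[R]_m)
  (f_smooth : smooth f) (h_smooth : smooth h) (q_smooth : smooth q)
  (qlow_gt0 : 0 < qlow)
  (Q_lower : forall x, psd (gram q x - qlow%:M))
  (q_orth : forall x, ('J q x)^T *m 'J h x = 0)
  (Phi_diffeo : diffeomorphism (coords h q) Psi)
  (mlow_gt0 : 0 < mlow)
  (gram_lower : forall x, psd (gram h x - mlow%:M))
  (feasible_connected : connected [set x | h x = 0])
  (rho_eta_gt0 : 0 < rho_eta)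
  (f_strongly_convex :
     strongly_convex rho_eta (fun eta => f (Psi (row_mx 0 eta))))
  (Phi_lipschitz : elipschitz L_Phi (coords h q))
  (Psi_lipschitz : elipschitz L_Psi Psi)
  (L1_gt0 : 0 < L1)
  (tangential_lipschitz : forall (y : 'rV[R]_m) (eta : 'rV[R]_(n - m)),
     let xt := Psi (row_mx y eta) in
     let p := Psi (row_mx 0 eta) in
     enorm (grad f xt *m 'J q xt - grad f p *m 'J q p) <= L1 * enorm y)
  (L2_gt0 : 0 < L2)
  (phi_lipschitz : elipschitz L2 (phi f h))
  (xs_optimizer : global_optimizer f h xs)
  (ls_multiplier : lagrange_multiplier f h xs ls) :
  exists kp_star : R, 0 < kp_star /\
    forall kp ki : R, kp_star < kp -> 0 < ki -> ki < mlow * kp ^+ 2 ->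
      globally_exponentially_stable f h kp ki xs ls.
Proof.
have [Phi_smooth Psi_smooth PhiK PsiK] := Phi_diffeo.
(* The given Lipschitz constants might not be positive, when the dimension is 0. *)
pose LP := `|L_Phi| + 1; pose LS := `|L_Psi| + 1.
have LP0 : 0 <= LP by rewrite addr_ge0.
have LS0 : 0 < LS by rewrite ltr_pwDr.
have LPl : elipschitz LP (coords h q).
  by apply: elipschitzW Phi_lipschitz; rewrite (le_trans (ler_norm _))// lerDl.
have LSl : elipschitz LS Psi.
  by apply: elipschitzW Psi_lipschitz; rewrite (le_trans (ler_norm _))// lerDl.
exists (kp_min qlow mlow rho_eta LP LS L1 L2); split.
  apply: lt_trans ltr01 _; apply: kp_min_gt1 => //.
move=> kp ki kp_large ki_gt0 ki_small.
have fd := smooth_differentiable f_smooth.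
have hd := smooth_differentiable h_smooth.
have qd := smooth_differentiable q_smooth.
have Phid := smooth_differentiable Phi_smooth.
have Psid := smooth_differentiable Psi_smooth.
by apply: (@pi_exponentially_stable R n m (n - m) f h q Psi qlow mlow rho_eta LP LS L1 L2).
Qed.
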